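(* Let $A$ be a based quasi-hereditary graded $\Bbbk$-superalgebra with $\mathfrak a$-conforming heredity data $I,X,Y$, and let $n\ge d$. Then the standard codeterminants $$\{\mathcal B^{\boldsymbol\lambda}_{\boldsymbol S,\boldsymbol T}\mid\boldsymbol\lambda\in\Lambda^I_+(n,d),\ \boldsymbol S\in\mathrm{Std}^X(\boldsymbol\lambda),\ \boldsymbol T\in\mathrm{Std}^Y(\boldsymbol\lambda)\}$$ form a $\Bbbk$-basis of $T^A_{\mathfrak a}(n,d)$.
   Context: $\Bbbk$ is a commutative integral domain of characteristic $0$, $n\in\mathbb Z_{>0}$, $d\in\mathbb Z_{\ge0}$. Based quasi-hereditary algebras. A graded $\Bbbk$-supermodule is $V=\bigoplus_{m\in\mathbb Z,\varepsilon\in\mathbb Z/2}V^m_\varepsilon$, with $V_\varepsilon=\bigoplus_mV^m_\varepsilon$; elements of the $V^m_\varepsilon$ are homogeneous; for a set $S$ of homogeneous elements, $S_\varepsilon=S\cap V_\varepsilon$. A graded $\Bbbk$-superalgebra is a (not necessarily unital) associative algebra $A$ with $A^m_\varepsilon A^l_\delta\subseteq A^{m+l}_{\varepsilon+\delta}$. Heredity data on $A$ consist of a finite poset $I$ and finite sets $X=\bigsqcup_{i\in I}X(i)$, $Y=\bigsqcup_{i\in I}Y(i)$ of homogeneous elements with distinguished initial elements $e_i\in X(i)\cap Y(i)$ such that, with $A^{>i}=\mathrm{span}(xy\mid j>i,\ x\in X(j),\ y\in Y(j))$: (a) $B=\{xy\mid i\in I,x\in X(i),y\in Y(i)\}$ is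 a basis of $A$; (b) for $x\in X(i)$, $y\in Y(i)$, $a\in A$, $ax$ is congruent mod $A^{>i}$ to a linear combination of elements of $X(i)$, and $ya$ to one of elements of $Y(i)$; (c) for $i,j\in I$, $x\in X(i)$, $y\in Y(i)$: $xe_i=x$, $e_ix=\delta_{x,e_i}x$, $e_iy=y$, $ye_i=\delta_{y,e_i}y$, $e_jx\in\{x,0\}$, $ye_j\in\{y,0\}$. Then $A$ is called based quasi-hereditary. For a subalgebra $\mathfrak a\subseteq A_{\bar0}$ the data is $\mathfrak a$-conforming if $I,X_{\bar0},Y_{\bar0}$ is heredity data for $\mathfrak a$. Write $I=\{0,\dots,\ell\}$, numbered so that the natural order refines the partial order of $I$. The algebra $T^A_{\mathfrak a}(n,d)$. Let $B_{\mathfrak c}=\{xy\mid i\in I,\ x\in X(i)_{\bar1},\ y\in Y(i)_{\bar1}\}$ and $H$ be the set of nonzero homogeneous elements of $A$. For $P\subseteq H$, $\mathrm{Tri}^P(n,d)$ is the set of $(\boldsymbol p,\boldsymbol r,\boldsymbol s)\in P^d\times[1,n]^d\times[1,n]^d$ such that for $k\ne l$, $(p_k,r_k,s_k)=(p_l,r_l,s_l)$ only if $p_k$ is even. $\mathfrak S_d$ acts on words by $(z_1\cdots z_d)\sigma=z_{\sigma1}\cdots z_{\sigma d}$, diagonally on triples. Put $\xi^a_{r,s}=aE_{r,s}\in M_n(A)$. $\mathfrak S_d$ acts on the superalgebra $M_n(A)^{\otimes d}$ by $(\xi^{a_1}_{r_1,s_1}\otimes\cdots\otimes\xi^{a_d}_{r_d,s_d})^\sigma=(-1)^{\langle\sigma;\boldsymbol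 a\rangle}\xi^{a_{\sigma1}}_{r_{\sigma1},s_{\sigma1}}\otimes\cdots\otimes\xi^{a_{\sigma d}}_{r_{\sigma d},s_{\sigma d}}$, $\langle\sigma;\boldsymbol a\rangle=\#\{k<l\mid\sigma^{-1}k>\sigma^{-1}l,\ a_k,a_l\text{ odd}\}$; $S^A(n,d)$ is the algebra of invariants. For $(\boldsymbol a,\boldsymbol r,\boldsymbol s)\in\mathrm{Tri}^H(n,d)$, $\xi^{\boldsymbol a}_{\boldsymbol r,\boldsymbol s}=\sum_\sigma(\xi^{a_1}_{r_1,s_1}\otimes\cdots\otimes\xi^{a_d}_{r_d,s_d})^\sigma$ over shortest representatives of $\mathrm{Stab}(\boldsymbol a,\boldsymbol r,\boldsymbol s)\backslash\mathfrak S_d$. For $(\boldsymbol b,\boldsymbol r,\boldsymbol s)\in\mathrm{Tri}^B(n,d)$, $\eta^{\boldsymbol b}_{\boldsymbol r,\boldsymbol s}=\big(\prod_{b\in B_{\mathfrak c},\,r,s\in[1,n]}\#\{k\mid(b_k,r_k,s_k)=(b,r,s)\}!\big)\,\xi^{\boldsymbol b}_{\boldsymbol r,\boldsymbol s}$, and $T^A_{\mathfrak a}(n,d)=\mathrm{span}_\Bbbk(\eta^{\boldsymbol b}_{\boldsymbol r,\boldsymbol s})$, a subalgebra of $S^A(n,d)$. Codeterminants. $\Lambda^I_+(n,d)$ is the set of tuples $\boldsymbol\lambda=(\lambda^{(0)},\dots,\lambda^{(\ell)})$ of partitions with at most $n$ parts (written as $n$-tuples) with $\sum_i|\lambda^{(i)}|=d$.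 Fix total orders on $\mathscr A_{X(i)}=[1,n]\times X(i)$ (elements written $r^x$, with colour $x$) with $r^x<s^x$ if $r<s$. $\mathrm{Std}^X(\boldsymbol\lambda)$ is the set of $\boldsymbol S=(S^{(i)})_{i\in I}$, $S^{(i)}:[\lambda^{(i)}]\to\mathscr A_{X(i)}$ maps on Young diagrams, with entries weakly increasing along rows (equal entries in a row only for even colours) and weakly increasing down columns (equal entries in a column only for odd colours); similarly $\mathrm{Std}^Y(\boldsymbol\lambda)$. Reading entries of $S^{(0)},\dots,S^{(\ell)}$ successively, each along rows from top to bottom, gives $r_1^{x_1}\cdots r_d^{x_d}$; $\boldsymbol x^{\boldsymbol S}=x_1\cdots x_d$, $\boldsymbol l^{\boldsymbol S}=r_1\cdots r_d$ (similarly $\boldsymbol y^{\boldsymbol T},\boldsymbol l^{\boldsymbol T}$); $\boldsymbol l^{\boldsymbol\lambda}$ is the concatenation of the words $1^{\lambda^{(i)}_1}\cdots n^{\lambda^{(i)}_n}$, $i=0,\dots,\ell$. $\mathcal X_{\boldsymbol S}=\xi^{\boldsymbol x^{\boldsymbol S}}_{\boldsymbol l^{\boldsymbol S},\boldsymbol l^{\boldsymbol\lambda}}$, $\mathcal Y_{\boldsymbol T}=\xi^{\boldsymbol y^{\boldsymbol T}}_{\boldsymbol l^{\boldsymbol\lambda},\boldsymbol l^{\boldsymbol T}}$, $\mathcal B^{\boldsymbol\lambda}_{\boldsymbol S,\boldsymbol T}=\mathcal X_{\boldsymbol S}\mathcal Y_{\boldsymbol T}$. *)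

(* Defs.v *)
From HB Require Import structures.
From mathcomp Require Import all_boot perm all_algebra finmap.
From mathcomp Require Import boolp classical_sets fsbigop.

Set Implicit Arguments.
Unset Strict Implicit.
Unset Printing Implicit Defensive.

Import GRing.Theory.
Local Open Scope quotient_scope.
Local Open Scope ring_scope.

Section LinearAlgebra.
Variables (R : comNzRingType) (V : lmodType R).

Definition span (P : V -> Prop) (v : V) : Prop :=
  exists (m : nat) (c : 'I_m -> R) (w : 'I_m -> V),
    (forall i, P (w i)) /\ v = \sum_i c i *: w i.

Definition lin_indep (J : Type) (f : J -> V) : Prop :=
  forall (m : nat) (j : 'I_m -> J) (c : 'I_m -> R),
    injective j -> \sum_i c i *: f (j i) = 0 -> forall i, c i = 0.

Definition is_basis (J : Type) (U : V -> Prop) (f : J -> V) : Prop :=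
  lin_indep f /\ (forall v, U v <-> span (fun w => exists j, w = f j) v).

End LinearAlgebra.

Section TensorPower.
Variables (R : comNzRingType) (M : lmodType R) (d : nat).

Definition upd (u : {ffun 'I_d -> M}) (i : 'I_d) (x : M) : {ffun 'I_d -> M} :=
  [ffun k => if k == i then x else u k].

Definition multilinear (V : lmodType R) (f : {ffun 'I_d -> M} -> V) : Prop :=
  forall u i c x y,
    f (upd u i (c *: x + y)) = c *: f (upd u i x) + f (upd u i y).

Definition fsum : Type := seq (R * {ffun 'I_d -> M}).
HB.instance Definition _ := Choice.on fsum.

Definition feval (V : lmodType R) (f : {ffun 'I_d -> M} -> V) (s : fsum) : V :=
  \sum_(p <- s) p.1 *: f p.2.

(* Two formal combinations are identified when every multilinear map takes the
   same value on them; the quotient is M (x) ... (x) M, see [tlift_pure] and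
   [tpure_span] for its universal property. *)
Definition feq (s t : fsum) : bool :=
  `[< forall (V : lmodType R) (f : {ffun 'I_d -> M} -> V),
        multilinear f -> feval f s = feval f t >].

Lemma feq_refl : reflexive feq.
Proof. by move=> s; apply/asboolP. Qed.

Lemma feq_sym : symmetric feq.
Proof.
by move=> s t; apply/asboolP/asboolP => st V f mf; rewrite st.
Qed.

Lemma feq_trans : transitive feq.
Proof.
move=> t s w /asboolP st /asboolP tw; apply/asboolP => V f mf.
by rewrite st // tw.
Qed.

Canonical feq_equiv := EquivRel feq feq_refl feq_sym feq_trans.

Definition tpow : Type := {eq_quot feq}.
HB.instance Definition _ := Choice.on tpow.
HB.instance Definition _ := Quotient.on tpow.
HB.instance Definition _ := EqQuotient.on tpow.

Definition fscale (c : R) (s : fsum) : fsum := [seq (c * p.1, p.2) | p <- s].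

Definition tzero : tpow := \pi_tpow ([::] : fsum).
Definition tadd (s t : tpow) : tpow := \pi_tpow ((repr s ++ repr t) : fsum).
Definition tscale (c : R) (s : tpow) : tpow := \pi_tpow (fscale c (repr s)).
Definition topp (s : tpow) : tpow := tscale (- 1) s.

Definition tpure (u : {ffun 'I_d -> M}) : tpow := \pi_tpow ([:: (1, u)] : fsum).

(* The linear map on the tensor power induced by a multilinear map [f]. *)
Definition tlift (V : lmodType R) (f : {ffun 'I_d -> M} -> V) (t : tpow) : V :=
  feval f (repr t).

Lemma feval_cat (V : lmodType R) (f : {ffun 'I_d -> M} -> V) (s t : fsum) :
  feval f (s ++ t) = feval f s + feval f t.
Proof. by rewrite /feval big_cat. Qed.

Lemma feval_scale (V : lmodType R) (f : {ffun 'I_d -> M} -> V) c (s : fsum) :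
  feval f (fscale c s) = c *: feval f s.
Proof.
rewrite /feval big_map scaler_sumr; apply: eq_bigr => p _ /=.
by rewrite scalerA.
Qed.

Lemma tlift_pi (V : lmodType R) (f : {ffun 'I_d -> M} -> V) (s : fsum) :
  multilinear f -> tlift f (\pi_tpow s) = feval f s.
Proof.
move=> mf; rewrite /tlift.
have /eqmodP/asboolP E : repr (\pi_tpow s) = s %[mod tpow] by rewrite reprK.
exact: E.
Qed.

Lemma tpow_ext (s t : tpow) :
  (forall (V : lmodType R) (f : {ffun 'I_d -> M} -> V),
     multilinear f -> tlift f s = tlift f t) -> s = t.
Proof.
move=> E; rewrite -[s]reprK -[t]reprK; apply/eqmodP/asboolP => V f mf.
exact: E.
Qed.

Lemma tlift_zero (V : lmodType R) (f : {ffun 'I_d -> M} -> V) :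
  multilinear f -> tlift f tzero = 0.
Proof. by move=> mf; rewrite tlift_pi // /feval big_nil. Qed.

Lemma tlift_add (V : lmodType R) (f : {ffun 'I_d -> M} -> V) s t :
  multilinear f -> tlift f (tadd s t) = tlift f s + tlift f t.
Proof. by move=> mf; rewrite tlift_pi // feval_cat. Qed.

Lemma tlift_scale (V : lmodType R) (f : {ffun 'I_d -> M} -> V) c t :
  multilinear f -> tlift f (tscale c t) = c *: tlift f t.
Proof. by move=> mf; rewrite tlift_pi // feval_scale. Qed.

Fact taddA : associative tadd.
Proof.
by move=> x y z; apply: tpow_ext => V f mf; rewrite !tlift_add // addrA.
Qed.

Fact taddC : commutative tadd.
Proof.
by move=> x y; apply: tpow_ext => V f mf; rewrite !tlift_add // addrC.
Qed.

Fact tadd0 : left_id tzero tadd.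
Proof.
by move=> x; apply: tpow_ext => V f mf; rewrite tlift_add // tlift_zero // add0r.
Qed.

Fact taddN : left_inverse tzero topp tadd.
Proof.
move=> x; apply: tpow_ext => V f mf.
by rewrite tlift_add // tlift_scale // tlift_zero // scaleN1r addNr.
Qed.

HB.instance Definition _ := GRing.isZmodule.Build tpow taddA taddC tadd0 taddN.

Fact tscaleA a b v : tscale a (tscale b v) = tscale (a * b) v.
Proof.
by apply: tpow_ext => V f mf; rewrite !tlift_scale // scalerA.
Qed.

Fact tscale1 : left_id 1 tscale.
Proof. by move=> v; apply: tpow_ext => V f mf; rewrite tlift_scale // scale1r. Qed.

Fact tscaleDr : right_distributive tscale +%R.
Proof.
move=> a u v; apply: tpow_ext => V f mf.
by rewrite !(tlift_scale, tlift_add) // scalerDr.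
Qed.

Fact tscaleDl v : {morph tscale^~ v : a b / a + b}.
Proof.
move=> a b; apply: tpow_ext => V f mf.
by rewrite !(tlift_scale, tlift_add) // scalerDl.
Qed.

HB.instance Definition _ :=
  GRing.Zmodule_isLmodule.Build R tpow tscaleA tscale1 tscaleDr tscaleDl.

Lemma tpure_multilinear : multilinear tpure.
Proof.
move=> u i c x y; apply: tpow_ext => V f mf.
rewrite tlift_add // tlift_scale // !tlift_pi //.
by rewrite /feval !big_seq1 /= !scale1r mf.
Qed.

Lemma tlift_linear (V : lmodType R) (f : {ffun 'I_d -> M} -> V) :
  multilinear f -> linear (tlift f).
Proof. by move=> mf c s t; rewrite tlift_add // tlift_scale. Qed.

Lemma tlift_pure (V : lmodType R) (f : {ffun 'I_d -> M} -> V) u :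
  multilinear f -> tlift f (tpure u) = f u.
Proof. by move=> mf; rewrite tlift_pi // /feval big_seq1 scale1r. Qed.

Lemma tpure_span (t : tpow) : t = \sum_(p <- repr t) p.1 *: tpure p.2.
Proof.
apply: tpow_ext => V f mf.
have tl0 := tlift_zero mf.
rewrite {1}/tlift /feval; elim: (repr t : seq _) => [|p s IH].
  by rewrite !big_nil tl0.
by rewrite !big_cons IH (tlift_add _ _ mf) (tlift_scale _ _ mf) tlift_pure.
Qed.

End TensorPower.

(* The Z x Z/2-grading is carried by its homogeneous component projections:
   A^m_eps is the image of [gs_comp (m, eps)], with eps = true the odd part. *)
Record gsAlg (R : comNzRingType) := GsAlg {
  gs_sort :> lmodType R;
  gs_mul : gs_sort -> gs_sort -> gs_sort;
  gs_comp : int * bool -> gs_sort -> gs_sort;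
  gs_mul_linearl : forall b, linear (gs_mul^~ b);
  gs_mul_linearr : forall a, linear (gs_mul a);
  gs_mulA : associative gs_mul;
  gs_comp_linear : forall p, linear (gs_comp p);
  gs_compK : forall p q a,
    gs_comp p (gs_comp q a) = if p == q then gs_comp p a else 0;
  gs_comp_sum : forall a, exists2 s : seq (int * bool),
    uniq s & a = \sum_(p <- s) gs_comp p a;
  gs_mul_graded : forall p q a b,
    gs_comp p a = a -> gs_comp q b = b ->
    gs_comp (p.1 + q.1, p.2 (+) q.2) (gs_mul a b) = gs_mul a b
}.

Section Parity.
Variables (R : comNzRingType) (A : gsAlg R).

Definition homogeneous (a : A) : Prop := exists p, gs_comp p a = a.

(* The projection to A_eps; only finitely many terms are nonzero. *)
Definition parity_part (eps : bool) (a : A) : A :=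
  \sum_(m \in [set: int]) gs_comp (m, eps) a.

Definition gs_even (a : A) : bool := parity_part false a == a.
Definition gs_odd (a : A) : bool := parity_part true a == a.


Lemma gs_comp0 p : gs_comp p (0 : A) = 0.
Proof.
by have := gs_comp_linear p (-1) 0 (0 : A); rewrite scaler0 addr0 scaleN1r addNr.
Qed.

Lemma gs_comp_big p (J : Type) (r : seq J) (Q : pred J) (F : J -> A) :
  gs_comp p (\sum_(j <- r | Q j) F j) = \sum_(j <- r | Q j) gs_comp p (F j).
Proof.
apply: (big_morph (gs_comp p)); last exact: gs_comp0.
by move=> x y; have := gs_comp_linear p 1 x y; rewrite !scale1r.
Qed.

Lemma gs_comp_out (s : seq (int * bool)) (a : A) q :
  a = \sum_(p <- s) gs_comp p a -> q \notin s -> gs_comp q a = 0.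
Proof.
move=> -> qs; rewrite gs_comp_big big_seq big1 // => p ps.
by rewrite gs_compK; case: eqP => // qp; rewrite qp ps in qs.
Qed.

Lemma gs_comp_sub (s t : seq (int * bool)) (a : A) :
  a = \sum_(p <- s) gs_comp p a -> uniq s -> uniq t -> {subset s <= t} ->
  a = \sum_(p <- t) gs_comp p a.
Proof.
move=> E us ut st; rewrite (bigID (mem s)) /= [X in _ + X]big1 ?addr0; last first.
  by move=> p ps; apply: gs_comp_out E ps.
rewrite -big_filter {1}E; apply: perm_big; apply: uniq_perm => //.
  exact: filter_uniq.
move=> p; rewrite mem_filter /=; case ps: (p \in s) => //=.
by rewrite (st _ ps).
Qed.

Lemma gs_comp_cover (a b : A) : exists2 s : seq (int * bool), uniq s &
  a = \sum_(p <- s) gs_comp p a /\ b = \sum_(p <- s) gs_comp p b.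
Proof.
have [s us Es] := gs_comp_sum a; have [t ut Et] := gs_comp_sum b.
exists (undup (s ++ t)); first exact: undup_uniq.
split.
  apply: gs_comp_sub Es us (undup_uniq _) _ => p ps.
  by rewrite mem_undup mem_cat ps.
apply: gs_comp_sub Et ut (undup_uniq _) _ => p pt.
by rewrite mem_undup mem_cat pt orbT.
Qed.

Lemma parity_partE eps (a : A) (s : seq (int * bool)) :
  uniq s -> a = \sum_(p <- s) gs_comp p a ->
  parity_part eps a = \sum_(p <- s | p.2 == eps) gs_comp p a.
Proof.
move=> us E; rewrite /parity_part.
pose r := [seq p.1 | p <- s & p.2 == eps].
have memr m : (m \in r) = ((m, eps) \in s).
  apply/mapP/idP => [[[m' e]] | ms]; last by exists (m, eps); rewrite ?mem_filter /= ?eqxx.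
  by rewrite mem_filter /= => /andP[/eqP -> ms] ->.
have ur : uniq r.
  rewrite map_inj_in_uniq ?filter_uniq // => -[m e] [m' e'].
  by rewrite !mem_filter /= => /andP[/eqP -> _] /andP[/eqP -> _] ->.
rewrite (fsbigTE [fset m in r]%fset); last first.
  by move=> m; rewrite !inE memr => ms; apply: gs_comp_out E ms.
rewrite -[RHS]big_filter (perm_big r) /=; last first.
  by apply: uniq_perm => //; [exact: fset_uniq | move=> m; rewrite !inE].
rewrite big_map; apply: eq_big_seq => -[m e].
by rewrite mem_filter /= => /andP[/eqP -> _].
Qed.

Lemma parity_part_linear eps : linear (parity_part eps).
Proof.
move=> c a b; have [s us [Ea Eb]] := gs_comp_cover a b.
rewrite (parity_partE eps us Ea) (parity_partE eps us Eb).
rewrite (@parity_partE eps (c *: a + b) s) //.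
  rewrite scaler_sumr -big_split; apply: eq_bigr => p _; exact: gs_comp_linear.
rewrite {1}Ea {1}Eb scaler_sumr -big_split; apply: eq_bigr => p _.
by rewrite gs_comp_linear.
Qed.

Lemma parity_partK eps del (a : A) :
  parity_part eps (parity_part del a) = if eps == del then parity_part eps a else 0.
Proof.
have [s us Ea] := gs_comp_sum a.
pose b := parity_part del a.
have Eb : b = \sum_(p <- s | p.2 == del) gs_comp p a by apply: parity_partE.
have cb p : gs_comp p b = if (p \in s) && (p.2 == del) then gs_comp p a else 0.
  case: ifP => [/andP[ps pd]|/negbT ps].
    rewrite Eb gs_comp_big big_mkcond (bigD1_seq p) //= pd gs_compK eqxx big1 ?addr0 //.
    move=> q qp; case: ifP => // _; rewrite gs_compK eq_sym (negbTE qp) //.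
  rewrite Eb gs_comp_big big_seq_cond big1 // => q /andP[qs qd].
  rewrite gs_compK; case: eqP => // pq; rewrite pq qs qd in ps; by [].
have Eb' : b = \sum_(p <- s) gs_comp p b.
  rewrite {1}Eb [LHS]big_mkcond; apply: eq_big_seq => p ps.
  by rewrite cb ps.
rewrite (parity_partE eps us Eb') (parity_partE eps us Ea).
case: ifP => [/eqP ->|ed].
  rewrite big_seq_cond [RHS]big_seq_cond; apply: eq_bigr => p /andP[ps pd].
  by rewrite cb ps pd.
rewrite big1 // => p /eqP pe; rewrite cb pe ed andbF //.
Qed.

Lemma parity_part_sum (a : A) : a = parity_part false a + parity_part true a.
Proof.
have [s us Ea] := gs_comp_sum a.
rewrite !(parity_partE _ us Ea) {1}Ea (bigID (fun p => p.2 == false)) /=.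
by congr (_ + _); apply: eq_bigl => -[m []].
Qed.

End Parity.

Section MatrixSuperalgebra.
Variables (R : comNzRingType) (A : gsAlg R) (n : nat).

Definition amx : Type := 'M[A]_n.
HB.instance Definition _ := GRing.Zmodule.on amx.

Definition amx_scale (c : R) (U : amx) : amx := map_mx ( *:%R c) U.

Fact amx_scaleA a b (U : amx) : amx_scale a (amx_scale b U) = amx_scale (a * b) U.
Proof. by apply/matrixP => i j; rewrite !mxE scalerA. Qed.
Fact amx_scale1 : left_id 1 amx_scale.
Proof. by move=> U; apply/matrixP => i j; rewrite !mxE scale1r. Qed.
Fact amx_scaleDr : right_distributive amx_scale +%R.
Proof. by move=> a U V; apply/matrixP => i j; rewrite !mxE scalerDr. Qed.
Fact amx_scaleDl U : {morph amx_scale^~ U : a b / a + b}.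
Proof. by move=> a b; apply/matrixP => i j; rewrite !mxE scalerDl. Qed.
HB.instance Definition _ := GRing.Zmodule_isLmodule.Build R amx
  amx_scaleA amx_scale1 amx_scaleDr amx_scaleDl.

Definition amx_mul (U V : amx) : amx := \matrix_(r, s) \sum_t gs_mul (U r t) (V t s).
Definition amx_comp (p : int * bool) (U : amx) : amx := map_mx (gs_comp p) U.

Lemma amxZE c (U : amx) r s : (c *: U) r s = c *: U r s.
Proof. by rewrite [LHS]mxE. Qed.

Lemma amx_linP c (U V : amx) r s : (c *: U + V) r s = c *: U r s + V r s.
Proof. by rewrite [LHS]mxE amxZE. Qed.

Lemma gs_mul0l (b : A) : gs_mul 0 b = 0.
Proof. by have := gs_mul_linearl b (-1) 0 0; rewrite scaler0 addr0 scaleN1r addNr. Qed.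

Lemma gs_mul0r (a : A) : gs_mul a 0 = 0.
Proof. by have := gs_mul_linearr a (-1) 0 0; rewrite scaler0 addr0 scaleN1r addNr. Qed.

Lemma gs_mul_suml (J : Type) (r : seq J) (F : J -> A) b :
  gs_mul (\sum_(j <- r) F j) b = \sum_(j <- r) gs_mul (F j) b.
Proof.
elim: r => [|j r IH]; first by rewrite !big_nil gs_mul0l.
rewrite !big_cons -IH.
by have := gs_mul_linearl b 1 (F j) (\sum_(i <- r) F i); rewrite !scale1r.
Qed.

Lemma gs_mul_sumr (J : Type) (r : seq J) (F : J -> A) a :
  gs_mul a (\sum_(j <- r) F j) = \sum_(j <- r) gs_mul a (F j).
Proof.
elim: r => [|j r IH]; first by rewrite !big_nil gs_mul0r.
rewrite !big_cons -IH.
by have := gs_mul_linearr a 1 (F j) (\sum_(i <- r) F i); rewrite !scale1r.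
Qed.

Fact amx_mul_linearl V : linear (amx_mul^~ V).
Proof.
move=> c U U'; apply/matrixP => r s; rewrite amx_linP !mxE.
rewrite scaler_sumr -big_split; apply: eq_bigr => t _.
by rewrite amx_linP gs_mul_linearl.
Qed.

Fact amx_mul_linearr U : linear (amx_mul U).
Proof.
move=> c V V'; apply/matrixP => r s; rewrite amx_linP !mxE.
rewrite scaler_sumr -big_split; apply: eq_bigr => t _.
by rewrite amx_linP gs_mul_linearr.
Qed.

Fact amx_mulA : associative amx_mul.
Proof.
move=> U V W; apply/matrixP => r s; rewrite !mxE.
under eq_bigr do rewrite mxE gs_mul_sumr.
rewrite exchange_big; apply: eq_bigr => t _ /=.
by rewrite mxE gs_mul_suml; apply: eq_bigr => v _; rewrite gs_mulA.
Qed.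

Fact amx_comp_linear p : linear (amx_comp p).
Proof.
by move=> c U V; apply/matrixP => r s; rewrite amx_linP [LHS]mxE amx_linP gs_comp_linear ![amx_comp _ _ _ _]mxE.
Qed.

Fact amx_compK p q (U : amx) :
  amx_comp p (amx_comp q U) = if p == q then amx_comp p U else 0.
Proof.
by apply/matrixP => r s; rewrite !mxE gs_compK; case: eqP; rewrite !mxE.
Qed.

Fact amx_comp_sum (U : amx) : exists2 s : seq (int * bool),
  uniq s & U = \sum_(p <- s) amx_comp p U.
Proof.
have /choice[S HS] : forall rs : 'I_n * 'I_n, exists s : seq (int * bool),
    uniq s /\ U rs.1 rs.2 = \sum_(p <- s) gs_comp p (U rs.1 rs.2).
  by move=> rs; have [s us E] := gs_comp_sum (U rs.1 rs.2); exists s.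
pose s := undup (flatten [seq S rs | rs : 'I_n * 'I_n]).
exists s; first exact: undup_uniq.
apply/matrixP => i j; rewrite summxE.
have [us E] := HS (i, j).
under eq_bigr do rewrite mxE.
apply: gs_comp_sub E us (undup_uniq _) _ => p ps.
rewrite mem_undup; apply/flatten_mapP; exists (i, j) => //.
by rewrite mem_enum.
Qed.

Fact amx_mul_graded (p q : int * bool) (U V : amx) :
  amx_comp p U = U -> amx_comp q V = V ->
  amx_comp (p.1 + q.1, p.2 (+) q.2) (amx_mul U V) = amx_mul U V.
Proof.
move=> /matrixP EU /matrixP EV; apply/matrixP => r s; rewrite !mxE gs_comp_big.
apply: eq_bigr => t _; apply: gs_mul_graded; first by rewrite -[RHS]EU mxE.
by rewrite -[RHS]EV mxE.
Qed.

Definition mx_gsAlg : gsAlg R :=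
  @GsAlg R amx amx_mul amx_comp amx_mul_linearl amx_mul_linearr amx_mulA
    amx_comp_linear amx_compK amx_comp_sum amx_mul_graded.

(* The matrix a E_(r,s), written xi^a_(r,s). *)
Definition xi1 (a : A) (r s : 'I_n) : mx_gsAlg :=
  (\matrix_(i, j) if (i == r) && (j == s) then a else 0) : 'M[A]_n.

End MatrixSuperalgebra.

Section TensorSuperalgebra.
Variables (R : comNzRingType) (B : gsAlg R) (d : nat).

Definition koszul (eps del : {ffun 'I_d -> bool}) : R :=
  (-1) ^+ #|[set p : 'I_d * 'I_d | [&& (p.2 < p.1)%N, eps p.1 & del p.2]]%SET|.

(* On words with homogeneous letters this is
   (u_1 (x) ... (x) u_d)(v_1 (x) ... (x) v_d)
     = (-1)^(sum over k > l of |u_k||v_l|) u_1 v_1 (x) ... (x) u_d v_d,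
   see [tmul_pure]; in general the letters are split into parity parts. *)
Definition tmul_words (u v : {ffun 'I_d -> B}) : tpow B d :=
  \sum_(eps : {ffun 'I_d -> bool}) \sum_(del : {ffun 'I_d -> bool})
    koszul eps del *: tpure
      [ffun k => gs_mul (parity_part (eps k) (u k)) (parity_part (del k) (v k))].

Definition tmul (x y : tpow B d) : tpow B d :=
  tlift (fun u => tlift (tmul_words u) y) x.

Lemma multilinear_sum (J : finType) (f : J -> {ffun 'I_d -> B} -> tpow B d) :
  (forall j, multilinear (f j)) -> multilinear (fun u => \sum_j f j u).
Proof.
move=> mf u i c x y; rewrite scaler_sumr -big_split.
by apply: eq_bigr => j _; rewrite mf.
Qed.

Lemma multilinear_comp (c0 : R) (g : 'I_d -> B -> B) :
  (forall k, linear (g k)) ->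
  multilinear (fun u : {ffun 'I_d -> B} => c0 *: tpure [ffun k => g k (u k)]).
Proof.
move=> lg u i c x y.
have E z : [ffun k => g k (upd u i z k)] = upd [ffun k => g k (u k)] i (g i z).
  by apply/ffunP => k; rewrite !ffunE; case: eqP => [->|].
by rewrite !E lg tpure_multilinear scalerDr !scalerA mulrC.
Qed.

Lemma tmul_words_multilinearr u : multilinear (tmul_words u).
Proof.
apply: multilinear_sum => eps; apply: multilinear_sum => del.
apply: (@multilinear_comp _ (fun k b => gs_mul (parity_part (eps k) (u k))
  (parity_part (del k) b))) => k c x y.
by rewrite parity_part_linear gs_mul_linearr.
Qed.

Lemma tmul_words_multilinearl v : multilinear (tmul_words^~ v).
Proof.
apply: multilinear_sum => eps; apply: multilinear_sum => del.
apply: (@multilinear_comp _ (fun k b => gs_mul (parity_part (eps k) b)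
  (parity_part (del k) (v k)))) => k c x y.
by rewrite parity_part_linear gs_mul_linearl.
Qed.

Lemma tmul_lift_multilinear y : multilinear (fun u => tlift (tmul_words u) y).
Proof.
move=> u i c x z; rewrite /tlift /feval scaler_sumr -big_split.
apply: eq_bigr => p _ /=.
by rewrite tmul_words_multilinearl scalerDr !scalerA mulrC.
Qed.

Lemma tmul_linearl y : linear (tmul^~ y).
Proof. exact: tlift_linear (tmul_lift_multilinear y). Qed.

Lemma tmul_linearr x : linear (tmul x).
Proof.
move=> c y z; rewrite /tmul /tlift /feval scaler_sumr -big_split.
apply: eq_bigr => p _ /=.
rewrite -!/(feval _ _) -!/(tlift _ _) tlift_linear //.
  by rewrite scalerDr !scalerA mulrC.
exact: tmul_words_multilinearr.
Qed.

Lemma tpure0 (u : {ffun 'I_d -> B}) k : u k = 0 -> tpure u = 0.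
Proof.
move=> uk; have := tpure_multilinear u k (-1) 0 0.
rewrite scaler0 addr0 scaleN1r addNr => <-; congr tpure.
by apply/ffunP => j; rewrite ffunE; case: eqP => [->|].
Qed.

Lemma tmul_pure (u v : {ffun 'I_d -> B}) (eps del : {ffun 'I_d -> bool}) :
  (forall k, parity_part (eps k) (u k) = u k) ->
  (forall k, parity_part (del k) (v k) = v k) ->
  tmul (tpure u) (tpure v) =
    koszul eps del *: tpure [ffun k => gs_mul (u k) (v k)].
Proof.
move=> Hu Hv; rewrite /tmul (tlift_pure _ (tmul_lift_multilinear _)).
rewrite (tlift_pure _ (tmul_words_multilinearr _)) /tmul_words.
have vanish (w : {ffun 'I_d -> B}) (e e' : {ffun 'I_d -> bool}) :
    (forall k, parity_part (e k) (w k) = w k) -> e' != e ->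
    exists k, parity_part (e' k) (w k) = 0.
  move=> Hw ne; have /existsP[k nk] : [exists k, e' k != e k].
    rewrite -negb_forall; apply: contra ne => /forallP E.
    by apply/eqP/ffunP => k; apply/eqP.
  by exists k; rewrite -Hw parity_partK (negbTE nk).
rewrite (bigD1 eps) //= [X in _ + X]big1 ?addr0; last first.
  move=> e' /(vanish _ _ _ Hu)[k uk]; apply: big1 => del' _.
  by rewrite (@tpure0 _ k) ?scaler0 // ffunE uk gs_mul0l.
rewrite (bigD1 del) //= [X in _ + X]big1 ?addr0; last first.
  move=> e' /(vanish _ _ _ Hv)[k vk].
  by rewrite (@tpure0 _ k) ?scaler0 // ffunE vk gs_mul0r.
by congr (_ *: tpure _); apply/ffunP => k; rewrite !ffunE Hu Hv.
Qed.

End TensorSuperalgebra.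

Section HeredityData.
Variables (R : comNzRingType) (A : gsAlg R) (ell : nat).
Implicit Types (X Y : 'I_ell.+1 -> {fset A}) (le : rel 'I_ell.+1).

Definition heredity_prod X Y (p : {i : 'I_ell.+1 & (X i * Y i)%type}) : A :=
  gs_mul (val (tagged p).1) (val (tagged p).2).

(* The submodule A^{>i}. *)
Definition heredity_gt le X Y (i : 'I_ell.+1) : A -> Prop :=
  span (fun w => exists j x y,
    [/\ (j != i) && le i j, x \in X j, y \in Y j & w = gs_mul x y]).

(* Heredity data on the (not necessarily unital) subalgebra U of A, so that the
   same definition serves for A itself and for a subalgebra of A_0. *)
Record heredity_data (U : A -> Prop) le X Y (e : 'I_ell.+1 -> A) : Prop := {
  hd_order : [/\ reflexive le, antisymmetric le & transitive le];
  hd_X : forall i x, x \in X i -> U x /\ homogeneous x;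
  hd_Y : forall i y, y \in Y i -> U y /\ homogeneous y;
  hd_X_disj : forall i j, i != j -> [disjoint X i & X j]%fset;
  hd_Y_disj : forall i j, i != j -> [disjoint Y i & Y j]%fset;
  hd_e : forall i, e i \in X i /\ e i \in Y i;
  hd_basis : is_basis U (@heredity_prod X Y);
  hd_mull : forall i x a, x \in X i -> U a ->
    exists w, span (fun z => z \in X i) w /\
              heredity_gt le X Y i (gs_mul a x - w);
  hd_mulr : forall i y a, y \in Y i -> U a ->
    exists w, span (fun z => z \in Y i) w /\
              heredity_gt le X Y i (gs_mul y a - w);
  hd_xe : forall i x, x \in X i -> gs_mul x (e i) = x;
  hd_ex : forall i x, x \in X i -> gs_mul (e i) x = if x == e i then x else 0;
  hd_ey : forall i y, y \in Y i -> gs_mul (e i) y = y;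
  hd_ye : forall i y, y \in Y i -> gs_mul y (e i) = if y == e i then y else 0;
  hd_ejx : forall i j x, x \in X i -> gs_mul (e j) x = x \/ gs_mul (e j) x = 0;
  hd_yej : forall i j y, y \in Y i -> gs_mul y (e j) = y \/ gs_mul y (e j) = 0
}.

Definition even_part X : 'I_ell.+1 -> {fset A} :=
  fun i => [fset x in X i | gs_even x]%fset.
Definition odd_part X : 'I_ell.+1 -> {fset A} :=
  fun i => [fset x in X i | gs_odd x]%fset.

Definition subalgebra (U : A -> Prop) : Prop :=
  [/\ U 0, (forall c a b, U a -> U b -> U (c *: a + b))
    & (forall a b, U a -> U b -> U (gs_mul a b))].

Definition conforming (U : A -> Prop) le X Y e : Prop :=
  [/\ subalgebra U, (forall a, U a -> gs_even a)
    & heredity_data U le (even_part X) (even_part Y) e].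

Definition prod_set X Y : {fset A} :=
  \big[fsetU/fset0]_(i : 'I_ell.+1) [fset gs_mul x y | x in X i, y in Y i]%fset.

(* B_c *)
Definition odd_prod_set X Y : {fset A} := prod_set (odd_part X) (odd_part Y).

End HeredityData.

Section SchurAlgebra.
Variables (R : comNzRingType) (A : gsAlg R) (n d : nat).

(* The right action z |-> z sigma of permutations on words. *)
Definition word_act (T : Type) (z : {ffun 'I_d -> T}) (sg : 'S_d) :
  {ffun 'I_d -> T} := [ffun k => z (sg k)].

Definition triple_stab (a : {ffun 'I_d -> A}) (r s : {ffun 'I_d -> 'I_n}) :
    {set 'S_d} :=
  [set h | [&& word_act a h == a, word_act r h == r & word_act s h == s]]%SET.

Definition perm_length (sg : 'S_d) : nat :=
  #|[set p : 'I_d * 'I_d | (p.1 < p.2)%N && (sg p.2 < sg p.1)%N]%SET|.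

(* [sg] has minimal length in the coset G sg. Products of permutations are
   read from left to right in the library, so [(sg * h)%g] is h o sg. *)
Definition shortest_in_coset (G : {set 'S_d}) (sg : 'S_d) : bool :=
  [forall h in G, (perm_length sg <= perm_length (sg * h)%g)%N].

(* < sg ; a > *)
Definition odd_inversions (sg : 'S_d) (a : {ffun 'I_d -> A}) : nat :=
  #|[set p : 'I_d * 'I_d | [&& (p.1 < p.2)%N, (sg^-1%g p.2 < sg^-1%g p.1)%N,
       gs_odd (a p.1) & gs_odd (a p.2)]]%SET|.

Definition xi_tensor (a : {ffun 'I_d -> A}) (r s : {ffun 'I_d -> 'I_n}) :
    tpow (mx_gsAlg A n) d :=
  tpure [ffun k => xi1 (a k) (r k) (s k)].

(* (xi^{a_1}_{r_1,s_1} (x) ... (x) xi^{a_d}_{r_d,s_d})^sg *)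
Definition xi_tensor_act (a : {ffun 'I_d -> A}) (r s : {ffun 'I_d -> 'I_n})
    (sg : 'S_d) : tpow (mx_gsAlg A n) d :=
  (-1) ^+ odd_inversions sg a *:
    xi_tensor (word_act a sg) (word_act r sg) (word_act s sg).

Definition xi (a : {ffun 'I_d -> A}) (r s : {ffun 'I_d -> 'I_n}) :
    tpow (mx_gsAlg A n) d :=
  \sum_(sg : 'S_d | shortest_in_coset (triple_stab a r s) sg)
    xi_tensor_act a r s sg.

Definition Tri (P : {fset A}) (a : {ffun 'I_d -> A})
    (r s : {ffun 'I_d -> 'I_n}) : Prop :=
  (forall k, a k \in P) /\
  (forall k l, k != l -> (a k, r k, s k) = (a l, r l, s l) -> gs_even (a k)).

Variables (ell : nat) (X Y : 'I_ell.+1 -> {fset A}).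

Definition eta (b : {ffun 'I_d -> A}) (r s : {ffun 'I_d -> 'I_n}) :
    tpow (mx_gsAlg A n) d :=
  (\prod_(c <- odd_prod_set X Y) \prod_(i < n) \prod_(j < n)
     (#|[set k | (b k, r k, s k) == (c, i, j)]%SET|)`!)%N%:R *: xi b r s.

Definition T_alg : tpow (mx_gsAlg A n) d -> Prop :=
  span (fun v => exists b r s, Tri (prod_set X Y) b r s /\ v = eta b r s).

End SchurAlgebra.

Section Codeterminants.
Variables (ell n d : nat).

(* Partitions with at most n parts are weakly decreasing n-tuples. *)
Definition is_multipart (lam : {ffun 'I_ell.+1 -> n.-tuple nat}) : bool :=
  [forall i, sorted geq (lam i)] && ((\sum_i sumn (lam i))%N == d).

Definition multipart : Type :=
  {lam : {ffun 'I_ell.+1 -> n.-tuple nat} | is_multipart lam}.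

(* A node is [Tagged _ c], with c < mu_r the column and the tag r the row. *)
Definition diagram (mu : n.-tuple nat) : Type := {r : 'I_n & 'I_(tnth mu r)}.
HB.instance Definition _ mu := Finite.on (diagram mu).

Definition node_row mu (u : diagram mu) : 'I_n := tag u.
Definition node_col mu (u : diagram mu) : nat := tagged u.

Section Reading.
Variables (lam : multipart) (T : Type) (f : forall i, diagram (val lam i) -> T).

Definition reading_seq : seq T :=
  flatten [seq flatten [seq [seq f (Tagged (fun r => 'I_(tnth (val lam i) r)) c)
                              | c <- enum 'I_(tnth (val lam i) r)]
                         | r <- enum 'I_n]
            | i <- enum 'I_ell.+1].

Lemma size_reading_seq : size reading_seq == d.
Proof.
have /andP[_ /eqP <-] := valP lam.
rewrite /reading_seq size_flatten /shape -map_comp sumnE big_map big_enum /=.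
apply/eqP; apply: eq_bigr => i _.
rewrite size_flatten /shape -map_comp sumnE big_map big_enum /=.
rewrite sumnE big_tuple; apply: eq_bigr => r _.
by rewrite size_map size_enum_ord.
Qed.

Definition reading : {ffun 'I_d -> T} :=
  [ffun k => tnth (Tuple size_reading_seq) k].

End Reading.

(* l^lambda: reading every entry as its row index gives
   1^{lambda_1} ... n^{lambda_n} for each component. *)
Definition row_word (lam : multipart) : {ffun 'I_d -> 'I_n} :=
  reading (fun i (u : diagram (val lam i)) => node_row u).

Variables (R : comNzRingType) (A : gsAlg R).
Implicit Types (X Y : 'I_ell.+1 -> {fset A}).

(* The alphabet: the pair (r, x) is the letter r of colour x. *)
Definition letter (S : {fset A}) : Type := ('I_n * S)%type.
HB.instance Definition _ S := Finite.on (letter S).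

Definition letter_order (S : {fset A}) (le : rel (letter S)) : Prop :=
  [/\ total le, antisymmetric le, transitive le
    & forall (x : S) (r s : 'I_n), (r < s)%N -> le (r, x) (s, x)].

Definition standard (S : {fset A}) (le : rel (letter S)) (mu : n.-tuple nat)
    (t : {ffun diagram mu -> letter S}) : bool :=
  [forall u, forall v,
     ((node_row u == node_row v) && (node_col u < node_col v)%N ==>
        le (t u) (t v) && ((t u == t v) ==> gs_even (val (t u).2))) &&
     ((node_col u == node_col v) && (node_row u < node_row v)%N ==>
        le (t u) (t v) && ((t u == t v) ==> gs_odd (val (t u).2)))].

Definition multitab X (lam : multipart) : Type :=
  {dffun forall i : 'I_ell.+1, {ffun diagram (val lam i) -> letter (X i)}}.

Definition Std X (le : forall i, rel (letter (X i))) (lam : multipart) : Type :=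
  {t : multitab X lam | [forall i, standard (@le i) (t i)]}.

Definition colour_word X lam (t : multitab X lam) : {ffun 'I_d -> A} :=
  reading (fun i u => val (t i u).2).

Definition letter_word X lam (t : multitab X lam) : {ffun 'I_d -> 'I_n} :=
  reading (fun i u => (t i u).1).

Definition codetX X lam (t : multitab X lam) : tpow (mx_gsAlg A n) d :=
  xi (colour_word t) (letter_word t) (row_word lam).

Definition codetY Y lam (t : multitab Y lam) : tpow (mx_gsAlg A n) d :=
  xi (colour_word t) (row_word lam) (letter_word t).

Definition codet X Y (leX : forall i, rel (letter (X i)))
    (leY : forall i, rel (letter (Y i)))
    (p : {lam : multipart & (Std leX lam * Std leY lam)%type}) :
    tpow (mx_gsAlg A n) d :=
  tmul (codetX (val (tagged p).1)) (codetY (val (tagged p).2)).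

End Codeterminants.

(* Main.v *)
Require Import Defs.
From HB Require Import structures.
From mathcomp Require Import all_boot perm all_algebra finmap.
From mathcomp Require Import boolp classical_sets fsbigop.
From mathcomp Require Import fingroup.
From mathcomp Require Import zify.

Set Implicit Arguments.
Unset Strict Implicit.
Unset Printing Implicit Defensive.

Import GRing.Theory.
Local Open Scope ring_scope.

(** Products [x y] with [x] in [X i], [y] in [Y j] vanish for distinct [i], [j],
    because the idempotents [e i], [e j] are orthogonal. Hence a pair of a letter
    [r^x] and a letter [s^y] of the same component is the same thing as the basis
    element [x y E_(r,s)] of the matrix superalgebra, and the theorem becomes an
    integral super Cauchy decomposition, one factor for each component.

    A codeterminant is treated as follows. Besides its letters, a word carries at
    each place a block label (component, row). [X_S] and [Y_T] are signed orbit
    sums of labelled words ([xi_orb]), that is, signed invariant functions [F], [H]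
    of a word and a word of labels, and their product is the contraction
    [sum over b of F (u, b) * H (w, b)] ([codet_prodE]). The labels are even, so
    rows may be renamed freely and any set of row lengths may be sorted into a
    multipartition.

    Spanning ([standard_span]). Suppose that a row [p] and a later row [q] of the
    same component violate the column condition at some place. Put together the
    entries of row [p] that are at least the upper violating entry and the entries
    of row [q] that are at most the lower one: these are more than row [p] holds. The
    signed orbit with the regrouped labels, contracted back to the old labels, is a
    Garnir kernel: it contains the given word with coefficient 1, its other words
    have larger entries in row [q], and its product with anything is a product
    for the regrouped labels, which have a longer row. Induction on the shape and on the
    entries leaves standard words on both sides. Conversely every [eta] is, up to
    sign, a single product of two orbits ([monomial_product]): give places with the
    same even right letter a common label and all other places labels of their own;
    at most [d] labels are needed, and [d <= n]. The factorials in [eta] are the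
    number of ways to permute the labels of equal odd pairs, and for the same
    reason they divide the coefficients of every codeterminant
    ([contract_divisible]).

    Independence ([standard_independent]). In a relation choose a multipartition
    with the largest sum of row indices, and in it a pair of tableaux for which the
    entries, weighted by their rows, have the smallest sum. Antisymmetrize the
    relation along the columns of this shape and evaluate it at the chosen pair.
    Labels repeated in a column cancel; the remaining ones have at least the row
    sum of the shape, hence are column permutations of it; and since permuting a
    column of a standard tableau decreases the weighted sum, only the chosen pair
    contributes. It does so with a positive integer, which is not 0 in
    characteristic 0. *)

(** * Rearrangements of finite words *)

Section Rearrangement.
Variables (d : nat) (C : eqType) (cl : 'I_d -> C) (key : 'I_d -> nat).

Definition class_perm (s : 'S_d) : Prop := forall k, cl (s k) = cl k.

Definition class_sorted (v : 'I_d -> nat) : Prop :=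
  forall k l, cl k = cl l -> (key k < key l)%N -> (v k <= v l)%N.

Lemma class_permM s t : class_perm s -> class_perm t -> class_perm (s * t)%g.
Proof. by move=> hs ht k; rewrite permM ht hs. Qed.

Lemma class_permV s : class_perm s -> class_perm s^-1%g.
Proof. by move=> hs k; rewrite -(hs ((s^-1)%g k)) permKV. Qed.

Lemma class_perm1 : class_perm 1%g.
Proof. by move=> k; rewrite perm1. Qed.

Lemma class_perm_tperm k l : cl k = cl l -> class_perm (tperm k l).
Proof. by move=> h j; case: tpermP => [->|->|]. Qed.

Lemma swap_increases (f g : 'I_d -> nat) k l :
  (f k < f l)%N -> (g l < g k)%N ->
  (\sum_j f j * g j < \sum_j f j * g (tperm k l j))%N.
Proof.
move=> fkl gkl.
have kl : k != l by apply/eqP => e; rewrite e ltnn in fkl.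
rewrite (bigD1 k) //= (bigD1 l) 1?eq_sym //=.
rewrite [X in (_ < X)%N](bigD1 k) //= [X in (_ < _ + X)%N](bigD1 l) 1?eq_sym //=.
rewrite tpermL tpermR.
have -> : (\sum_(i < d | (i != k) && (i != l)) f i * g (tperm k l i) =
  \sum_(i < d | (i != k) && (i != l)) f i * g i)%N.
  by apply: eq_bigr => i /andP[ik il]; rewrite tpermD // eq_sym.
rewrite !addnA ltn_add2r.
have [m em] : exists m, f l = (f k + m.+1)%N by exists (f l - f k).-1; lia.
have [m' em'] : exists m, g k = (g l + m.+1)%N by exists (g k - g l).-1; lia.
by rewrite em em'; nia.
Qed.

(** If two values of a class were in the wrong order, swapping them would increase
    the sum. *)
Lemma maximal_class_sorted v (s : 'S_d) :
  class_perm s ->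
  (forall t, class_perm t ->
     (\sum_k key k * v (t k) <= \sum_k key k * v (s k))%N) ->
  class_sorted (v \o s).
Proof.
move=> hs smax k l ckl kkl; rewrite leqNgt; apply/negP => vkl.
have := smax (tperm k l * s)%g (class_permM (class_perm_tperm ckl) hs).
have := swap_increases kkl vkl; rewrite ltnNge => /negP h le; apply: h.
apply: leq_trans le; rewrite leq_eqVlt; apply/orP; left; apply/eqP.
by apply: eq_bigr => j _; rewrite permM.
Qed.

Lemma maximal_class_perm v : exists2 s : 'S_d, class_perm s &
  forall t, class_perm t ->
     (\sum_k key k * v (t k) <= \sum_k key k * v (s k))%N.
Proof.
pose P := [pred s : 'S_d | [forall k, cl (s k) == cl k]].
have P1 : P 1%g by apply/forallP => k; rewrite perm1.
case: (arg_maxnP (fun s : 'S_d => \sum_k key k * v (s k))%N P1) => s Ps smax.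
exists s; first by move=> k; apply/eqP/(forallP Ps).
by move=> t ht; apply: smax; apply/forallP => k; rewrite ht.
Qed.

Lemma class_sort v : exists2 s : 'S_d, class_perm s & class_sorted (v \o s).
Proof.
have [s hs smax] := maximal_class_perm v.
by exists s => //; apply: maximal_class_sorted.
Qed.

Hypothesis key_inj : forall k l, cl k = cl l -> key k = key l -> k = l.

(** At the first key where two increasing arrangements of the same values differ,
    the one with the smaller value would have too many values below the larger
    one. *)
Lemma sorted_step v w k :
  class_sorted v -> class_sorted w ->
  (forall t c, #|[set j | (cl j == c) && (v j < t)%N]%SET|
             = #|[set j | (cl j == c) && (w j < t)%N]%SET|) ->
  (forall j, cl j = cl k -> (key j < key k)%N -> v j = w j) ->
  (v k <= w k)%N.
Proof.
move=> sv sw cnt eqlt; rewrite leqNgt; apply/negP => wv.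
have /proper_card : [set j | (cl j == cl k) && (v j < v k)%N]%SET \proper
    [set j | (cl j == cl k) && (w j < v k)%N]%SET.
  apply/properP; split; last by exists k; rewrite !inE eqxx ?ltnn.
  apply/fintype.subsetP => j; rewrite !inE => /andP[/eqP cj vj]; rewrite cj eqxx /=.
  have [kj|kj|/(key_inj cj) ejk] := ltngtP (key j) (key k).
  - by rewrite -eqlt.
  - by have := sv _ _ (esym cj) kj; rewrite leqNgt vj.
  - by rewrite ejk ltnn in vj.
by rewrite cnt ltnn.
Qed.

Lemma class_sorted_unique v s : class_perm s ->
  class_sorted v -> class_sorted (v \o s) -> forall k, v (s k) = v k.
Proof.
move=> hs sv svs.
have cnt t c : #|[set j | (cl j == c) && ((v \o s) j < t)%N]%SET|
             = #|[set j | (cl j == c) && (v j < t)%N]%SET|.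
  rewrite -(card_imset _ (@perm_inj _ s)); apply: eq_card => j; rewrite inE.
  apply/imsetP/andP => [[i]|[cj vj]].
    by rewrite inE => /andP[ci vi] ->; rewrite hs.
  exists ((s^-1)%g j); rewrite ?permKV // inE /= permKV vj.
  by rewrite (class_permV hs) cj.
suff H m k : (key k <= m)%N -> (v \o s) k = v k by move=> k; apply: (H (key k)).
elim: m k => [|m IH] k km.
  apply/eqP; rewrite eqn_leq; apply/andP; split; apply: sorted_step => //;
  by move=> j _; move: km; rewrite leqn0 => /eqP ->.
have IH' j : cl j = cl k -> (key j < key k)%N -> (v \o s) j = v j.
  by move=> _ jk; apply: IH; rewrite -ltnS (leq_trans jk).
apply/eqP; rewrite eqn_leq; apply/andP; split; apply: sorted_step => //.
by move=> j cj jk; rewrite -IH'.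
Qed.

(** The rearrangement inequality, with its equality case: a maximal rearrangement
    is sorted, hence unique. *)
Lemma rearrangement v s : class_perm s -> class_sorted v ->
  (\sum_k key k * v (s k) <= \sum_k key k * v k)%N /\
  ((\sum_k key k * v (s k))%N = (\sum_k key k * v k)%N ->
     forall k, v (s k) = v k).
Proof.
move=> hs sv; have [t ht tmax] := maximal_class_perm v.
have vt := class_sorted_unique ht sv (maximal_class_sorted ht tmax).
have et : (\sum_k key k * v (t k) = \sum_k key k * v k)%N.
  by apply: eq_bigr => k _; rewrite vt.
split; first by rewrite -et; apply: tmax.
move=> es; apply: class_sorted_unique => //; apply: maximal_class_sorted => // t' ht'.
by rewrite es -et; apply: tmax.
Qed.

End Rearrangement.

(** * Signs of permutations acting on words with odd letters *)

Section Signs.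
Variable d : nat.
Implicit Types (s t : 'S_d) (e f : {ffun 'I_d -> bool}).

Lemma word_actM (T : Type) (z : {ffun 'I_d -> T}) s t :
  word_act z (s * t)%g = word_act (word_act z t) s.
Proof. by apply/ffunP => k; rewrite !ffunE permM. Qed.

Lemma word_act1 (T : Type) (z : {ffun 'I_d -> T}) : word_act z 1%g = z.
Proof. by apply/ffunP => k; rewrite !ffunE perm1. Qed.

Lemma word_actK (T : Type) (z : {ffun 'I_d -> T}) s :
  word_act (word_act z s) s^-1%g = z.
Proof. by rewrite -word_actM mulVg word_act1. Qed.

Lemma word_actKV (T : Type) (z : {ffun 'I_d -> T}) s :
  word_act (word_act z s^-1%g) s = z.
Proof. by rewrite -word_actM mulgV word_act1. Qed.

Lemma word_act_inj (T : Type) s :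
  injective (fun z : {ffun 'I_d -> T} => word_act z s).
Proof. by move=> z z' e; rewrite -(word_actK z s) e word_actK. Qed.

(** Inversions are indexed by the places after the permutation, which makes the
    cocycle law a statement about unordered pairs of places. *)
Definition oinv s e : bool :=
  \big[addb/false]_(p : 'I_d * 'I_d | (p.1 < p.2)%N)
    [&& (s p.2 < s p.1)%N, e (s p.1) & e (s p.2)].

Lemma addb_big_mkcond (T : finType) (P Q : pred T) :
  \big[addb/false]_(x | P x) Q x = \big[addb/false]_x (P x && Q x).
Proof. by rewrite big_mkcond; apply: eq_bigr => x _; case: (P x). Qed.

Lemma addb_big_card (T : finType) (P Q : pred T) :
  \big[addb/false]_(x | P x) Q x = odd #|[set x | P x && Q x]%SET|.
Proof.
rewrite addb_big_mkcond -sum1dep_card [in RHS]big_mkcond /=.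
rewrite (big_morph odd oddD (erefl : odd 0 = false)).
by apply: eq_bigr => x _; case: (P x && Q x).
Qed.

Lemma unordered_pairs (F : 'I_d -> 'I_d -> bool) : (forall a, F a a = false) ->
  \big[addb/false]_(p : 'I_d * 'I_d) F p.1 p.2 =
  \big[addb/false]_(p : 'I_d * 'I_d | (p.1 < p.2)%N) (F p.1 p.2 (+) F p.2 p.1).
Proof.
move=> F0; rewrite big_split /= (bigID (fun p : 'I_d * 'I_d => (p.1 < p.2)%N)) /=.
congr addb; rewrite (reindex_inj (h := fun p : 'I_d * 'I_d => (p.2, p.1))) /=.
  rewrite [LHS]addb_big_mkcond [RHS]addb_big_mkcond; apply: eq_bigr => -[a b] _ /=.
  by have [||/val_inj ->] := ltngtP a b; rewrite ?F0.
by move=> [a b] [a' b'] [] -> ->.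
Qed.

Lemma reindex_pairs s (F : 'I_d -> 'I_d -> bool) :
  \big[addb/false]_(p : 'I_d * 'I_d) F (s p.1) (s p.2) =
  \big[addb/false]_(p : 'I_d * 'I_d) F p.1 p.2.
Proof.
rewrite [RHS](reindex_inj (h := fun p => (s p.1, s p.2))) //.
by move=> [a b] [a' b'] [] /perm_inj -> /perm_inj ->.
Qed.

Lemma symmetric_pairs s (g : 'I_d -> 'I_d -> bool) :
  (forall a b, g a b = g b a) ->
  \big[addb/false]_(p : 'I_d * 'I_d | (p.1 < p.2)%N) g (s p.1) (s p.2) =
  \big[addb/false]_(p : 'I_d * 'I_d | (p.1 < p.2)%N) g p.1 p.2.
Proof.
move=> gC; pose F a b := ((s^-1)%g a < (s^-1)%g b)%N && g a b.
rewrite addb_big_mkcond; transitivity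
  (\big[addb/false]_(p : 'I_d * 'I_d) F (s p.1) (s p.2)).
  by apply: eq_bigr => p _; rewrite /F !permK.
rewrite reindex_pairs unordered_pairs /F; last by move=> a; rewrite ltnn.
apply: eq_bigr => -[a b] /= ab; rewrite (gC b a).
have : (s^-1)%g a != (s^-1)%g b by rewrite (inj_eq perm_inj) -val_eqE /= neq_ltn ab.
by rewrite -val_eqE /=; case: ltngtP => //=; case: (g a b).
Qed.

Lemma ltn_ordN (a b : 'I_d) : a != b -> (a < b)%N = ~~ (b < a)%N.
Proof. by move=> ab; rewrite -leqNgt [RHS]leq_eqVlt val_eqE (negbTE ab). Qed.

Lemma oinvM s t e : oinv (s * t)%g e = oinv t e (+) oinv s (word_act e t).
Proof.
pose g (a b : 'I_d) := [&& a != b, ((a < b) != (t a < t b))%N, e (t a) & e (t b)].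
have gC a b : g a b = g b a.
  rewrite /g eq_sym; case: eqP => //= ab.
  have tab : t b != t a by rewrite (inj_eq perm_inj); apply/eqP.
  rewrite (@ltn_ordN a b) 1?eq_sym ?(introF eqP ab) //.
  rewrite (@ltn_ordN (t a) (t b)) 1?eq_sym //.
  by case: (b < a)%N; case: (t b < t a)%N; case: (e (t a)); case: (e (t b)).
have -> : oinv t e = \big[addb/false]_(p : 'I_d * 'I_d | (p.1 < p.2)%N) g p.1 p.2.
  apply: eq_bigr => -[a b] /= ab; rewrite /g ab.
  have -> /= : a != b by apply/eqP => eab; rewrite eab ltnn in ab.
  have tab : t a != t b by rewrite (inj_eq perm_inj); apply/eqP => eab; rewrite eab ltnn in ab.
  by congr andb; move: tab; rewrite -val_eqE /=; case: ltngtP.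
rewrite -(symmetric_pairs s gC) -big_split /=; apply: eq_bigr => -[a b] /= ab.
rewrite /g !permM !ffunE.
have nab : a != b by apply/eqP => eab; rewrite eab ltnn in ab.
have sab : s a != s b by rewrite (inj_eq perm_inj).
have tab : t (s a) != t (s b) by rewrite (inj_eq perm_inj).
rewrite (@ltn_ordN (s b) (s a)) 1?eq_sym // (@ltn_ordN (t (s b)) (t (s a))) 1?eq_sym // sab /=.
by case: (s a < s b)%N; case: (t (s a) < t (s b))%N; case: (e (t (s a))); case: (e (t (s b))).
Qed.

Lemma odd_inversionsE (R : comNzRingType) (A : gsAlg R) s (a : {ffun 'I_d -> A}) :
  odd (odd_inversions s a) = oinv s [ffun k => gs_odd (a k)].
Proof.
rewrite /oinv addb_big_card; congr odd.
pose h (p : 'I_d * 'I_d) := (s p.2, s p.1).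
have hinj : injective h by move=> [x y] [x' y'] [] /perm_inj -> /perm_inj ->.
rewrite -(card_imset _ hinj); apply: eq_card => -[k l].
rewrite inE /=; apply/and4P/imsetP => [[kl slk ok ol]|[[x y]]].
  by exists ((s^-1)%g l, (s^-1)%g k); rewrite ?inE /h /= ?ffunE !permKV // kl slk ok ol.
rewrite !inE /= !ffunE => /and4P[xy sxy ox oy] [-> ->].
by rewrite !permK; split.
Qed.

Definition kinv e f : bool :=
  \big[addb/false]_(p : 'I_d * 'I_d | (p.2 < p.1)%N) (e p.1 && f p.2).

Lemma koszulE (R : comNzRingType) e f : koszul R e f = (-1) ^+ kinv e f.
Proof. by rewrite /koszul /kinv addb_big_card signr_odd. Qed.

Definition addw e f : {ffun 'I_d -> bool} := [ffun k => e k (+) f k].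

(** The product of two tensors is compatible with permuting factors because the
    defect of additivity of the sign cocycle is the coboundary of the Koszul
    sign. *)
Lemma oinv_addw s e f :
  oinv s (addw e f) = (oinv s e (+) oinv s f) (+)
    (kinv e f (+) kinv (word_act e s) (word_act f s)).
Proof.
pose F (a b : 'I_d) := (b < a)%N && (e a && f b).
have -> : kinv e f = \big[addb/false]_(p : 'I_d * 'I_d | (p.1 < p.2)%N)
    (F (s p.1) (s p.2) (+) F (s p.2) (s p.1)).
  rewrite -(unordered_pairs (F := fun a b => F (s a) (s b))); last by move=> a; rewrite /F ltnn.
  by rewrite reindex_pairs /kinv addb_big_mkcond.
have -> : kinv (word_act e s) (word_act f s) =
    \big[addb/false]_(p : 'I_d * 'I_d | (p.1 < p.2)%N) (e (s p.2) && f (s p.1)).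
  rewrite /kinv (reindex_inj (h := fun p : 'I_d * 'I_d => (p.2, p.1))) /=.
    by apply: eq_bigr => p _; rewrite !ffunE.
  by move=> [a b] [a' b'] [] -> ->.
rewrite /oinv -!big_split /=; apply: eq_bigr => -[a b] /= ab.
have sab : s a != s b by rewrite (inj_eq perm_inj) -val_eqE /= neq_ltn ab.
rewrite /F !ffunE (@ltn_ordN (s b) (s a)) 1?eq_sym //.
by case: (s a < s b)%N; case: (e (s a)); case: (e (s b)); case: (f (s a)); case: (f (s b)).
Qed.

Lemma oinv_fix_odd s e : (forall k, e k -> s k = k) -> oinv s e = false.
Proof.
move=> fx; rewrite /oinv big1 // => -[a b] /= ab; apply/negP => /and3P[sab ea eb].
have sa : s a = a by apply: (@perm_inj _ s); rewrite fx.
have sb : s b = b by apply: (@perm_inj _ s); rewrite fx.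
by rewrite sa sb ltnNge ltnW in sab.
Qed.

Lemma oinv1 e : oinv 1%g e = false.
Proof. by apply: oinv_fix_odd => k _; rewrite perm1. Qed.

Lemma word_act_tperm (T : Type) (z : {ffun 'I_d -> T}) k l :
  z k = z l -> word_act z (tperm k l) = z.
Proof. by move=> zkl; apply/ffunP => j; rewrite ffunE; case: tpermP => [->|->|]. Qed.

Lemma addb_big_eq (J : finType) (j : J) (P : pred J) :
  \big[addb/false]_i ((i == j) && P i) = P j.
Proof.
rewrite (bigD1 j) //= eqxx big1 ?addbF // => i /negbTE -> //.
Qed.

(** Besides the swapped pair itself, the inverted pairs of a transposition come
    in twos, one for each odd place in between. *)
Lemma oinv_tperm e k l : k != l -> e k -> e l -> oinv (tperm k l) e.
Proof.
wlog kl : k l / (k < l)%N => [H nkl ek el|_ ek el].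
  have [|lk|/val_inj ekl] := ltngtP k l; first by move=> kl; apply: H.
    by rewrite tpermC; apply: H => //; rewrite eq_sym.
  by rewrite ekl eqxx in nkl.
pose mid (m : 'I_d) := [&& (k < m)%N, (m < l)%N & e m].
have -> : oinv (tperm k l) e = \big[addb/false]_(p : 'I_d * 'I_d)
   (((p.1 == k) && (p.2 == l)) (+) (((p.1 == k) && mid p.2) (+) ((p.2 == l) && mid p.1))).
  rewrite /oinv addb_big_mkcond; apply: eq_bigr => -[a b] _ /=; rewrite /mid.
  case: (tpermP k l a) => [->|->|/eqP ak /eqP al];
  case: (tpermP k l b) => [->|->|/eqP bk /eqP bl]; rewrite ?eqxx ?ek ?el ?(negbTE ak) ?(negbTE al)
    ?(negbTE bk) ?(negbTE bl) ?andbT ?andbF ?ltnn ?kl //=; rewrite -?val_eqE /=; try lia.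
rewrite !big_split /=.
rewrite -(pair_bigA _ (fun a b : 'I_d => (a == k) && (b == l))) /=.
rewrite -(pair_bigA _ (fun a b : 'I_d => (a == k) && mid b)) /=.
rewrite -(pair_bigA _ (fun a b : 'I_d => (b == l) && mid a)) /=.
have -> : \big[addb/false]_a \big[addb/false]_b ((a == k) && (b == l)) = true.
  rewrite (bigD1 k) //= [X in _ (+) X]big1; last by move=> i /negbTE ik; apply: big1 => j _; rewrite ik.
  rewrite eqxx addbF (eq_bigr (fun b => (b == l) && true)) ?addb_big_eq // => b _.
  by rewrite andbT.
have -> : \big[addb/false]_a \big[addb/false]_b ((a == k) && mid b) =
          \big[addb/false]_b mid b.
  rewrite (bigD1 k) //= [X in _ (+) X]big1; last by move=> i /negbTE ik; apply: big1 => j _; rewrite ik.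
  by rewrite eqxx addbF.
have -> : \big[addb/false]_a \big[addb/false]_b ((b == l) && mid a) =
          \big[addb/false]_b mid b.
  apply: eq_bigr => a _; exact: (addb_big_eq l (fun=> mid a)).
by rewrite addbb.
Qed.

(** A permutation of the odd places is a product of transpositions of odd
    places. *)
Lemma oinv_odd_perm s e : (forall k, ~~ e k -> s k = k) -> oinv s e = odd_perm s.
Proof.
move: {2}(#|_|) (leqnn #|[set k | s k != k]%SET|) => m.
elim: m s => [|m IH] s.
  rewrite leqn0 cards_eq0 => /eqP/setP s1 _.
  have -> : s = 1%g.
    by apply/permP => k; rewrite perm1; have := s1 k; rewrite !inE => /negbT/negPn/eqP.
  by rewrite oinv1 odd_perm1.
move=> sm fx; case: (boolP [exists k, s k != k]) => [/existsP[k sk]|]; last first.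
  rewrite negb_exists => /forallP s1; apply: IH => //.
  by apply: (@leq_trans 0) => //; rewrite leqn0 cards_eq0; apply/eqP/setP => k;
     rewrite !inE (negbTE (s1 k)).
have ssk : s (s k) != s k by rewrite (inj_eq perm_inj).
have ek : e k by apply: contraNT sk => /fx ->.
have esk : e (s k) by apply: contraNT ssk => /fx ->.
pose t := tperm k (s k).
have tfix j : s j = j -> t j = j.
  by move=> sj; rewrite tpermD //; apply/eqP => ej; move: sk ssk;
     rewrite ?ej ?sj ?eqxx //; rewrite -ej in sj; rewrite sj eqxx.
have -> : s = (s * t * t)%g by rewrite -mulgA tperm2 mulg1.
rewrite oinvM [RHS]odd_permM odd_tperm.
have et : word_act e t = e by rewrite word_act_tperm // ek esk.
rewrite et oinv_tperm 1?eq_sym // sk addTb addbT; congr negb.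
apply: IH; last first.
  by move=> j ej; rewrite permM fx // tfix // fx.
rewrite -ltnS; apply: leq_trans sm; apply: proper_card; apply/properP; split.
  apply/fintype.subsetP => j; rewrite !inE permM; apply: contra => /eqP sj.
  by rewrite sj tfix.
by exists k; rewrite !inE // permM tpermR eqxx.
Qed.

End Signs.

(** * Shortest coset representatives *)

Section Shortest.
Variable d : nat.
Implicit Types s t : 'S_d.

(** An inverted pair of the swapped permutation is sent to its image under the
    transposition of places, or kept when that image is in the wrong order;
    the swapped pair itself is never reached. *)
Lemma perm_length_swap s (k l : 'I_d) : (k < l)%N -> (s l < s k)%N ->
  (perm_length (tperm k l * s)%g < perm_length s)%N.
Proof.
move=> kl slk; pose t := tperm k l.
pose h (p : 'I_d * 'I_d) := if (t p.1 < t p.2)%N then (t p.1, t p.2) else p.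
pose J := [set p : 'I_d * 'I_d | (p.1 < p.2)%N && ((t * s)%g p.2 < (t * s)%g p.1)%N]%SET.
have hinj : {in J &, injective h}.
  move=> [a b] [a' b']; rewrite !inE /= => /andP[ab _] /andP[ab' _]; rewrite /h /=.
  case: ifP => [tab|ntab]; case: ifP => [tab'|ntab'] [].
  - by move=> /perm_inj -> /perm_inj ->.
  - by move=> e1 e2; rewrite -e1 -e2 /t !tpermK ab in ntab'.
  - by move=> e1 e2; rewrite e1 e2 /t !tpermK ab' in ntab.
  - by move=> -> ->.
rewrite /perm_length -(card_in_imset hinj); apply: proper_card; apply/properP; split.
  apply/fintype.subsetP => q /imsetP[[a b]]; rewrite [_ \in J]inE /= => /andP[ab].
  rewrite !permM => sab ->; rewrite /h /=; case: ifP => tab; rewrite inE /=.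
    by rewrite tab.
  rewrite ab /=; move: ab tab sab; rewrite /t.
  case: tpermP => [ea|ea|n1 n2]; case: tpermP => [eb|eb|n3 n4]; rewrite ?ea ?eb; try lia.
    by move=> _ _ sbl; apply: ltn_trans sbl slk.
  by move=> _ _ ska; apply: ltn_trans slk ska.
exists (k, l); first by rewrite inE kl.
apply/imsetP => -[[a b]]; rewrite [_ \in J]inE /= => /andP[ab sab]; rewrite /h /=.
case: ifP => [_ [ek el]|_ [ek el]].
  have ea : a = l by rewrite -[a](tpermK k l) -/t -ek /t tpermL.
  have eb : b = k by rewrite -[b](tpermK k l) -/t -el /t tpermR.
  by rewrite ea eb ltnNge ltnW in ab.
by move: sab; rewrite -ek -el !permM /t tpermL tpermR ltnNge ltnW.
Qed.

Section Stabilizer.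
Variables (T : Type) (z : {ffun 'I_d -> T}) (G : {set 'S_d}).
Hypothesis memG : forall h, h \in G <-> word_act z h = z.

(** Swapping two places that carry equal letters stays in the coset and would
    shorten a permutation that inverts them. *)
Lemma shortest_monotone s (a b : 'I_d) : shortest_in_coset G s -> z a = z b ->
  (a < b)%N -> ((s^-1)%g a < (s^-1)%g b)%N.
Proof.
move=> /'forall_implyP sh zab ab; rewrite ltnNge leq_eqVlt negb_or.
have nab : a != b by rewrite -val_eqE neq_ltn ab.
rewrite val_eqE (inj_eq perm_inj) eq_sym nab /=; apply/negP => sba.
have : tperm a b \in G by apply/memG; apply: word_act_tperm.
move=> /sh; rewrite leqNgt; case/negP.
have -> : (s * tperm a b)%g = (tperm ((s^-1)%g b) ((s^-1)%g a) * s)%g.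
  apply/permP => j; rewrite !permM.
  case: (tpermP ((s^-1)%g b)) => [->|->|n1 n2]; rewrite ?permKV ?tpermL ?tpermR //.
  by rewrite tpermD //; apply/eqP => e; [case: n2|case: n1]; rewrite e permK.
by apply: perm_length_swap => //; rewrite !permKV.
Qed.

(** The first place moved by [h] would have both its image and its preimage to the
    right, against monotonicity. *)
Lemma fibre_increasing_id h : h \in G ->
  (forall a b : 'I_d, z a = z b -> (a < b)%N -> (h a < h b)%N) -> h = 1%g.
Proof.
move=> /memG hz mono; have zh a : z (h a) = z a by rewrite -[in RHS]hz ffunE.
suff H m (a : 'I_d) : (a <= m)%N -> h a = a.
  by apply/permP => a; rewrite perm1 (H a).
elim/ltn_ind: m a => m IH a am; apply/eqP; case: (eqVneq (h a) a) => // nha.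
have low (b : 'I_d) : (b < a)%N -> h b = b.
  by move=> ba; apply: (IH b) => //; apply: leq_trans ba am.
have ha : (a < h a)%N.
  rewrite ltn_neqAle eq_sym val_eqE nha leqNgt; apply/negP => /[dup] /low.
  by move=> /perm_inj e; rewrite e ltnn.
have hVa : (a < (h^-1)%g a)%N.
  rewrite ltn_neqAle; apply/andP; split.
    by rewrite val_eqE; apply: contra nha => /eqP e; rewrite {1}e permKV.
  by rewrite leqNgt; apply/negP => hlt; have := low _ hlt; rewrite permKV => e; rewrite -e ltnn in hlt.
have := mono a ((h^-1)%g a); rewrite permKV -(zh ((h^-1)%g a)) permKV.
by move=> /(_ (erefl _) hVa); rewrite ltnNge ltnW.
Qed.

Lemma shortest_unique s s' : shortest_in_coset G s -> shortest_in_coset G s' ->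
  word_act z s = word_act z s' -> s = s'.
Proof.
move=> sh sh' zs.
have mem : (s^-1 * s')%g \in G.
  by apply/memG; rewrite word_actM -zs word_actK.
have key (a b : 'I_d) : z a = z b -> (a < b)%N -> ((s^-1 * s')%g a < (s^-1 * s')%g b)%N.
  move=> zab ab; rewrite !permM.
  have lt1 := shortest_monotone sh zab ab.
  have zh c : z ((s^-1 * s')%g c) = z c.
    by move/memG: mem => /(congr1 (fun w : {ffun _ -> _} => w c)); rewrite ffunE.
  have := zh a; have := zh b; rewrite !permM => zb za.
  rewrite ltnNge leq_eqVlt val_eqE !(inj_eq perm_inj) negb_or.
  rewrite -val_eqE [X in ~~ X]eq_sym neq_ltn ab /=; apply/negP => lt2.
  have := shortest_monotone sh' _ lt2; rewrite !permK => /(_ _).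
  by rewrite za zb zab => /(_ (erefl _)); rewrite ltnNge ltnW.
have := fibre_increasing_id mem key => e.
by rewrite -[s'](mulKVg s) e mulg1.
Qed.

Lemma shortest_exists s : exists2 s', shortest_in_coset G s' &
  word_act z s' = word_act z s.
Proof.
have G1 : 1%g \in G by apply/memG; rewrite word_act1.
case: (arg_minnP (fun h => perm_length (s * h)%g) G1) => h /memG hG hmin.
exists (s * h)%g; last by rewrite word_actM hG.
apply/'forall_implyP => g gG; rewrite -mulgA; apply: hmin.
by apply/memG; rewrite word_actM; move/memG: gG => ->.
Qed.

End Stabilizer.
End Shortest.

(** * Signed orbit sums *)

Section SignedOrbits.
Variables (k : idomainType) (d : nat) (Z : finType).
Hypothesis char0 : [pchar k] =i pred0.
Variable e : 'S_d -> {ffun 'I_d -> Z} -> bool.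
Hypothesis eM : forall s t z, e (s * t)%g z = e t z (+) e s (word_act z t).
Local Notation W := {ffun 'I_d -> Z}.

Definition sinv (F : {ffun W -> k^o}) : Prop :=
  forall s z, F (word_act z s) = (-1) ^+ e s z * F z.

(** The words whose signed orbit sum is not forced to vanish. *)
Definition good (z : W) : Prop := forall s, word_act z s = z -> e s z = false.

Definition orb (z0 : W) : {ffun W -> k^o} :=
  [ffun z => if [pick s | z == word_act z0 s] is Some s then (-1) ^+ e s z0 else 0].

Lemma good_sign z s t : good z -> word_act z s = word_act z t -> e s z = e t z.
Proof.
move=> gz st; have : e (t^-1 * s)%g z = false.
  by apply: gz; rewrite word_actM st word_actK.
have := eM t (t^-1 * s)%g z; rewrite mulKVg => ->.
move=> ->; rewrite addFb word_actM st word_actK //.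
Qed.

Lemma orbE z s : good z -> orb z (word_act z s) = (-1) ^+ e s z.
Proof.
move=> gz; rewrite ffunE; case: pickP => [t /eqP st|/(_ s)]; last by rewrite eqxx.
by rewrite (good_sign gz st).
Qed.

Lemma good_e1 z : good z -> e 1%g z = false.
Proof. by apply; rewrite word_act1. Qed.

Lemma orb_id z : good z -> orb z z = 1.
Proof. by move=> gz; rewrite -{2}(word_act1 z) orbE // good_e1. Qed.

Lemma orb_neq0 z0 z : orb z0 z != 0 -> exists s, z = word_act z0 s.
Proof. by rewrite ffunE; case: pickP => [s /eqP -> _|]; [exists s|rewrite eqxx]. Qed.

Lemma sinv_orb z : good z -> sinv (orb z).
Proof.
move=> gz s w; case: (eqVneq (orb z w) 0) => [ow|/orb_neq0[t ->]].
  rewrite ow mulr0; apply/eqP; apply: contraT => /orb_neq0[t wt].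
  have ew : w = word_act z (s^-1 * t)%g by rewrite word_actM -wt word_actK.
  by move: ow; rewrite ew orbE // => /eqP; rewrite signr_eq0.
by rewrite -word_actM !orbE // eM addbC signr_addb.
Qed.

Lemma sinvN F z s : sinv F -> word_act z s = z -> e s z -> F z = 0.
Proof.
move=> iF zs es; have := iF s z; rewrite zs es expr1 mulN1r => /eqP.
rewrite -addr_eq0 -mulr2n -mulr_natl mulf_eq0 => /orP[|/eqP //].
by have /pcharf0P -> := char0.
Qed.

Lemma sinv_good F z : sinv F -> F z != 0 -> good z.
Proof.
move=> iF Fz s zs; apply/negbTE; apply: contra Fz => es.
by rewrite (sinvN iF zs es).
Qed.

Lemma good_act z s : good z -> good (word_act z s).
Proof.
move=> gz; apply: (sinv_good (sinv_orb gz)).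
by rewrite orbE // signr_eq0.
Qed.

Lemma orb_act z s : good z -> orb z = (-1) ^+ e s z *: orb (word_act z s).
Proof.
move=> gz; apply/ffunP => w; rewrite [RHS]ffunE.
case: (eqVneq (orb z w) 0) => [ow|/orb_neq0[t ->]].
  rewrite ow; apply/esym/eqP; rewrite mulf_eq0; apply/orP; right.
  apply: contraT => /orb_neq0[t wt]; move: ow.
  by rewrite wt -word_actM orbE // => /eqP; rewrite signr_eq0.
have -> : t = ((t * s^-1) * s)%g by rewrite mulgKV.
rewrite orbE // eM word_actM orbE; last exact: good_act.
by rewrite signr_addb.
Qed.

Lemma sinv_closed c F G : sinv F -> sinv G -> sinv (c *: F + G).
Proof.
move=> iF iG s z; rewrite ffunE [X in X + _]ffunE [X in _ + X]iG iF.
rewrite [in RHS]ffunE [in RHS]ffunE mulrDr; congr (_ + _).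
by rewrite /GRing.scale /= mulrCA.
Qed.

(** Peeling off the signed orbit of a point of the support, weighted by the value
    there, shrinks the support; so this acts as an induction principle for signed
    invariant functions. *)
Lemma sinv_expand (Q : {ffun W -> k^o} -> Prop) F :
  Q 0 -> (forall G H, Q G -> Q H -> Q (G + H)) -> sinv F ->
  (forall z, F z != 0 -> Q (F z *: orb z)) -> Q F.
Proof.
move=> Q0 QD; move: {2}(#|_|) (leqnn #|[set z | F z != 0]%SET|) => m.
elim: m F => [|m IH] F.
  rewrite leqn0 cards_eq0 => /eqP/setP F0 _ _.
  suff -> : F = 0 by [].
  by apply/ffunP => z; have := F0 z; rewrite !inE ffunE => /negbT/negPn/eqP.
move=> Fm iF QF; case: (boolP [exists z, F z != 0]) => [/existsP[z Fz]|F0]; last first.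
  suff -> : F = 0 by [].
  apply/ffunP => z; rewrite [RHS]ffunE; apply/eqP; move: F0.
  by rewrite negb_exists => /forallP /(_ z) /negPn.
have gz := sinv_good iF Fz.
have Forb s : F (word_act z s) = F z * orb z (word_act z s).
  by rewrite iF orbE // mulrC.
have eF w : (- F z *: orb z + F) w = if orb z w == 0 then F w else 0.
  rewrite ffunE [X in X + _]ffunE; case: eqP => [->|/eqP /orb_neq0[s ->]].
    by rewrite /GRing.scale /= mulr0 add0r.
  by rewrite Forb /GRing.scale /= mulNr addNr.
have -> : F = F z *: orb z + (- F z *: orb z + F).
  by rewrite addrA scaleNr subrr add0r.
apply: QD; first exact: QF.
apply: IH.
- rewrite -ltnS; apply: leq_trans Fm; apply: proper_card; apply/properP; split.
    by apply/fintype.subsetP => w; rewrite !inE eF; case: ifP => //; rewrite eqxx.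
  exists z; rewrite !inE ?Fz // eF orb_id // oner_eq0 eqxx //.
- exact: sinv_closed (sinv_orb gz) iF.
- by move=> w; rewrite eF; case: ifP => [_ /QF //|_]; rewrite eqxx.
Qed.

(** Each coset of the stabilizer contains exactly one shortest permutation. *)
Lemma sum_shortest (M : lmodType k) (f : W -> M) (G : {set 'S_d}) z : good z ->
  (forall h, h \in G <-> word_act z h = z) ->
  \sum_(s : 'S_d | shortest_in_coset G s) (-1) ^+ e s z *: f (word_act z s) =
  \sum_w (orb z w : k) *: f w.
Proof.
move=> gz memG.
transitivity (\sum_(s : 'S_d | shortest_in_coset G s)
   (orb z (word_act z s) : k) *: f (word_act z s)).
  by apply: eq_bigr => s _; rewrite orbE.
rewrite (partition_big (fun s => word_act z s) predT) //=.
apply: eq_bigr => w _.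
case: (eqVneq (orb z w) 0) => [ow|/orb_neq0[t wt]].
  rewrite ow scale0r big1 // => s /andP[_ /eqP sw].
  by rewrite sw ow scale0r.
have [s sh st] := shortest_exists memG t.
rewrite (big_pred1 s) ?st -?wt // => s'; apply/andP/eqP => [[sh' /eqP sw]|->].
  by apply: (shortest_unique memG) => //; rewrite sw wt st.
by rewrite st wt.
Qed.

End SignedOrbits.

(** * Words with block labels *)

Section Words.
Variables (d : nat).

Lemma word_rearrange (Z : finType) (z z' : {ffun 'I_d -> Z}) :
  (forall x, #|[set j | z j == x]%SET| = #|[set j | z' j == x]%SET|) ->
  exists s, z' = word_act z s.
Proof.
move=> cnt.
have cE (w : {ffun 'I_d -> Z}) x :
    count_mem x [tuple w i | i < d] = #|[set j | w j == x]%SET|.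
  by rewrite cardsE cardE /= count_map -size_filter enumT.
have /tuple_permP[s es] : perm_eq [tuple z' i | i < d] [tuple z i | i < d].
  by apply/allP => x _ /=; rewrite !cE cnt.
exists s; apply/ffunP => j; rewrite ffunE.
have /(congr1 (fun t : seq Z => nth (z' j) t j)) := es.
rewrite -!tnth_nth !tnth_mktuple => -> //.
Qed.

Lemma card_word_act (Z : finType) (z : {ffun 'I_d -> Z}) s (P : pred Z) :
  #|[set j | P (word_act z s j)]%SET| = #|[set j | P (z j)]%SET|.
Proof.
rewrite -(card_imset _ (@perm_inj _ s)); apply: eq_card => j; rewrite inE.
apply/imsetP/idP => [[i]|Pj]; first by rewrite inE ffunE => Pi ->.
by exists ((s^-1)%g j); rewrite ?permKV // inE ffunE permKV.
Qed.

Section Parity.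
Variables (Z : finType) (p : Z -> bool).
Implicit Types z : {ffun 'I_d -> Z}.

Definition parw z : {ffun 'I_d -> bool} := [ffun j => p (z j)].
Definition psign (s : 'S_d) z : bool := oinv s (parw z).

Lemma parw_act z s : parw (word_act z s) = word_act (parw z) s.
Proof. by apply/ffunP => j; rewrite !ffunE. Qed.

Lemma psignM s t z : psign (s * t)%g z = psign t z (+) psign s (word_act z t).
Proof. by rewrite /psign oinvM parw_act. Qed.

(** The transposition of two equal odd letters has sign -1. *)
Lemma goodP z : good psign z <->
  (forall i j, i != j -> z i = z j -> ~~ p (z i)).
Proof.
split=> [gz i j ij zij|vz s zs].
  apply/negP => pz; have := gz (tperm i j) (word_act_tperm zij).
  by rewrite /psign oinv_tperm // ffunE // -zij.
apply: oinv_fix_odd => i; rewrite ffunE => pz; apply/eqP; apply: contraT => si.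
have zi : z i = z (s i) by rewrite -{1}zs ffunE.
by have := vz i (s i); rewrite eq_sym si pz => /(_ isT zi).
Qed.

End Parity.

Section Zip.
Variables (L B : finType).

Definition zipw (u : {ffun 'I_d -> L}) (b : {ffun 'I_d -> B}) :
  {ffun 'I_d -> L * B} := [ffun j => (u j, b j)].

Lemma zipw_act u b s : word_act (zipw u b) s = zipw (word_act u s) (word_act b s).
Proof. by apply/ffunP => j; rewrite !ffunE. Qed.

Lemma zipw_inj u b u' b' : zipw u b = zipw u' b' -> u = u' /\ b = b'.
Proof.
move=> /ffunP e; split; apply/ffunP => j; have := e j; rewrite !ffunE.
  by case.
by case.
Qed.

Lemma zipwP (z : {ffun 'I_d -> L * B}) : exists u b, z = zipw u b.
Proof.
exists [ffun j => (z j).1], [ffun j => (z j).2]; apply/ffunP => j.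
by rewrite !ffunE -surjective_pairing.
Qed.

Lemma big_zipw (V : nmodType) (f : {ffun 'I_d -> L * B} -> V) :
  \sum_z f z = \sum_u \sum_b f (zipw u b).
Proof.
rewrite pair_bigA /= (reindex (fun p => zipw p.1 p.2)) //=.
apply: onW_bij; exists (fun z : {ffun 'I_d -> L * B} => ([ffun j => (z j).1], [ffun j => (z j).2])).
  by move=> [u b]; congr pair; apply/ffunP => j; rewrite !ffunE.
by move=> z; apply/ffunP => j; rewrite !ffunE -surjective_pairing.
Qed.

(** All places where the labels differ carry the letter [l0], so the labelled
    letters are the same up to order. *)
Lemma zipw_exchange (u : {ffun 'I_d -> L}) (b b' : {ffun 'I_d -> B}) l0 t :
  b' = word_act b t -> (forall j, u j != l0 -> b' j = b j) ->
  exists s, zipw u b' = word_act (zipw u b) s.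
Proof.
move=> bt bb; apply: word_rearrange => -[l c].
have E (w : {ffun 'I_d -> B}) l1 : #|[set j | zipw u w j == (l1, c)]%SET| =
    #|[set j | (u j == l1) && (w j == c)]%SET|.
  by apply: eq_card => j; rewrite !inE ffunE.
have off l1 : l1 != l0 -> #|[set j | (u j == l1) && (b j == c)]%SET| =
    #|[set j | (u j == l1) && (b' j == c)]%SET|.
  move=> nl; apply: eq_card => j; rewrite !inE; case: eqP => //= ul.
  by rewrite bb ?ul.
rewrite !E; case: (eqVneq l l0) => [->|/off //].
have tot (w : {ffun 'I_d -> B}) : #|[set j | w j == c]%SET| =
    (#|[set j | (u j == l0) && (w j == c)]%SET| +
     \sum_(l1 | l1 != l0) #|[set j | (u j == l1) && (w j == c)]%SET|)%N.
  rewrite -sum1dep_card (partition_big u predT) //= (bigD1 l0) //=.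
  congr addn; [|apply: eq_bigr => l1 _]; rewrite -sum1dep_card; apply: eq_bigl => j;
  by rewrite andbC.
have eb : #|[set j | b' j == c]%SET| = #|[set j | b j == c]%SET|.
  by rewrite bt; exact: (card_word_act b t (pred1 c)).
have es := eq_bigr _ (fun l1 h => off l1 h) : (\sum_(l1 | l1 != l0) _ = \sum_(l1 | l1 != l0) _)%N.
have e1 := tot b; have e2 := tot b'; rewrite -es in e2; lia.
Qed.

End Zip.
End Words.

(** * Products of signed kernels and the Garnir relation *)

Section Kernels.
Variables (k : idomainType) (d n ell : nat).
Hypothesis char0 : [pchar k] =i pred0.
Local Notation Bk := ('I_ell.+1 * 'I_n)%type.
Local Notation WB := {ffun 'I_d -> Bk}.
Implicit Types b c : WB.

Section Kernel.
Variables (L : finType) (tL : L -> 'I_ell.+1) (pL : L -> bool).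

Definition kernel := {ffun {ffun 'I_d -> L * Bk} -> k^o}.

Definition bsign (s : 'S_d) (z : {ffun 'I_d -> L * Bk}) : bool :=
  psign (fun x : L * Bk => pL x.1) s z.

Definition compat (u : {ffun 'I_d -> L}) b : Prop := forall j, tL (u j) = (b j).1.

Definition supported (F : kernel) (b0 : WB) : Prop :=
  sinv bsign F /\ forall u b, F (zipw u b) != 0 ->
    (exists s, b = word_act b0 s) /\ compat u b.

Lemma bsignM s t z : bsign (s * t)%g z = bsign t z (+) bsign s (word_act z t).
Proof. exact: psignM. Qed.

Lemma bgoodP u b : good bsign (zipw u b) <->
  (forall i j, i != j -> u i = u j -> b i = b j -> ~~ pL (u i)).
Proof.
rewrite (goodP (fun x : L * Bk => pL x.1) (zipw u b)); split=> H i j ij.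
  by move=> uij bij; have := H i j ij; rewrite !ffunE uij bij; apply.
by rewrite !ffunE => -[uij bij] /=; apply: H bij.
Qed.

Lemma bsign_zipw s u b : bsign s (zipw u b) = psign pL s u.
Proof.
by rewrite /bsign /psign; congr oinv; apply/ffunP => j; rewrite !ffunE.
Qed.

Lemma compat_act u b s : compat u b -> compat (word_act u s) (word_act b s).
Proof. by move=> h j; rewrite !ffunE h. Qed.

Lemma supported_orb u b : good bsign (zipw u b) -> compat u b ->
  supported (orb k bsign (zipw u b)) b.
Proof.
move=> g cu; split; first exact: (sinv_orb k bsignM g).
move=> u' b' /orb_neq0[s]; rewrite zipw_act => /zipw_inj[-> ->].
by split; [exists s|exact: compat_act].
Qed.

Lemma supported_closed F G (x : k) b0 :
  supported F b0 -> supported G b0 -> supported (x *: F + G) b0.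
Proof.
move=> [iF sF] [iG sG]; split; first exact: sinv_closed.
move=> u b; rewrite ffunE [X in X + _]ffunE => FG.
case: (eqVneq (F (zipw u b)) 0) => [F0|/sF //].
by apply: sG; move: FG; rewrite F0 scaler0 add0r.
Qed.

End Kernel.

Section Product.
Variables (L R : finType) (M : lmodType k).
Variable E : {ffun 'I_d -> L} -> {ffun 'I_d -> R} -> M.

Definition contract (F : kernel L) (H : kernel R) u w : k :=
  \sum_b F (zipw u b) * H (zipw w b).

Definition prodE (F : kernel L) (H : kernel R) : M :=
  \sum_u \sum_w contract F H u w *: E u w.

Lemma prodE_addl (x : k) F F' H : prodE (x *: F + F') H = x *: prodE F H + prodE F' H.
Proof.
rewrite /prodE scaler_sumr -big_split; apply: eq_bigr => u _ /=.
rewrite scaler_sumr -big_split; apply: eq_bigr => w _ /=.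
rewrite scalerA -scalerDl; congr (_ *: _); rewrite /contract mulr_sumr -big_split.
by apply: eq_bigr => b _; rewrite ffunE [X in X + _]ffunE mulrDl mulrA.
Qed.

Lemma prodE0l H : prodE 0 H = 0.
Proof.
rewrite /prodE big1 // => u _; rewrite big1 // => w _.
by rewrite /contract big1 ?scale0r // => b _; rewrite ffunE mul0r.
Qed.

Definition relabel (P : finType) (g : Bk -> Bk) (F : kernel P) : kernel P :=
  [ffun z : {ffun 'I_d -> P * Bk} => F [ffun j => ((z j).1, g (z j).2)]].

Lemma relabelE (P : finType) g (F : kernel P) u b :
  relabel g F (zipw u b) = F (zipw u [ffun j => g (b j)]).
Proof. by rewrite ffunE; congr (F _); apply/ffunP => j; rewrite !ffunE. Qed.

(** Labels carry no sign and are summed over. *)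
Lemma prodE_relabel g F H : bijective g ->
  prodE (relabel g F) (relabel g H) = prodE F H.
Proof.
case=> h hK gK; apply: eq_bigr => u _; apply: eq_bigr => w _; congr (_ *: _).
rewrite /contract [RHS](reindex (fun b : WB => [ffun j => g (b j)])) /=.
  by apply: eq_bigr => b _; rewrite !relabelE.
apply: onW_bij; exists (fun b : WB => [ffun j => h (b j)]) => b;
by apply/ffunP => j; rewrite !ffunE ?hK ?gK.
Qed.

End Product.

Lemma prodEC (L R : finType) (M : lmodType k)
    (E : {ffun 'I_d -> L} -> {ffun 'I_d -> R} -> M) F H :
  prodE E F H = prodE (fun w u => E u w) H F.
Proof.
rewrite /prodE exchange_big; apply: eq_bigr => w _; apply: eq_bigr => u _.
by congr (_ *: _); apply: eq_bigr => b _; rewrite mulrC.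
Qed.

Section Garnir.
Variables (L : finType) (tL : L -> 'I_ell.+1) (pL : L -> bool) (rL : L -> nat).
Hypothesis rL_inj : forall x y, tL x = tL y -> rL x = rL y -> x = y.

Definition rank_moment b (u : {ffun 'I_d -> L}) : nat :=
  (\sum_j (b j).2 * rL (u j))%N.

Variables (b0 b1 : WB) (u0 : {ffun 'I_d -> L}) (P Q : Bk) (a a' : nat).

(** [b1] is the regrouping of [b0] at a violation between the blocks [P] and [Q],
    whose violating entries have ranks [a] and [a']. *)
Hypothesis compat0 : compat tL u0 b0.
Hypothesis good0 : good (bsign pL) (zipw u0 b0).
Hypothesis tag1 : forall j, (b1 j).1 = (b0 j).1.
Hypothesis outside : forall i j, b1 i = b1 j -> b1 i = P \/ b0 i = b0 j.
Hypothesis inside : forall j, b1 j = P ->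
  (b0 j = P /\ (a <= rL (u0 j))%N) \/ (b0 j = Q /\ (rL (u0 j) <= a')%N).
Hypothesis separated : forall i j, b0 i = b0 j -> u0 i = u0 j -> b1 i = b1 j.
Hypothesis PQ : P.1 = Q.1 /\ (P.2 < Q.2)%N.
Hypothesis a'a : (a' <= a)%N.
Hypothesis even_a : a' = a -> forall l, tL l = P.1 -> rL l = a -> ~~ pL l.

Local Notation U := (orb k (bsign pL) (zipw u0 b1)).

Definition coarse_fine (c b : WB) : bool :=
  [exists s, (c == word_act b1 s) && (b == word_act b0 s)].

(** In terms of tensors: comultiply the merged class [P] of the regrouped orbit and
    multiply the parts into the blocks of [b0]. *)
Definition garnir : kernel L :=
  [ffun z : {ffun 'I_d -> L * Bk} => \sum_c U (zipw [ffun j => (z j).1] c) *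
                    (coarse_fine c [ffun j => (z j).2])%:R].

Definition coarsen (R : finType) (H : kernel R) : kernel R :=
  [ffun z : {ffun 'I_d -> R * Bk} => \sum_b (coarse_fine [ffun j => (z j).2] b)%:R *
                    H (zipw [ffun j => (z j).1] b)].

Lemma garnirE u b :
  garnir (zipw u b) = \sum_c U (zipw u c) * (coarse_fine c b)%:R.
Proof.
rewrite ffunE; apply: eq_bigr => c _; congr (U (zipw _ _) * (coarse_fine _ _)%:R);
by apply/ffunP => j; rewrite !ffunE.
Qed.

Lemma coarsenE (R : finType) (H : kernel R) w c :
  coarsen H (zipw w c) = \sum_b (coarse_fine c b)%:R * H (zipw w b).
Proof.
rewrite ffunE; apply: eq_bigr => b _; congr ((coarse_fine _ _)%:R * H (zipw _ _));
by apply/ffunP => j; rewrite !ffunE.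
Qed.

Lemma coarse_fine_act c b s :
  coarse_fine (word_act c s) (word_act b s) = coarse_fine c b.
Proof.
apply/existsP/existsP => -[t /andP[/eqP ct /eqP bt]].
  exists (s^-1 * t)%g; rewrite !word_actM -ct -bt !word_actK !eqxx //.
by exists (s * t)%g; rewrite !word_actM -ct -bt !eqxx.
Qed.

(** Moving the regrouping to the other factor turns a product for the labels [b0]
    into one for the labels [b1]. *)
Lemma prodE_garnir (R : finType) (M : lmodType k)
    (E : {ffun 'I_d -> L} -> {ffun 'I_d -> R} -> M) H :
  prodE E garnir H = prodE E U (coarsen H).
Proof.
apply: eq_bigr => u _; apply: eq_bigr => w _; congr (_ *: _).
rewrite /contract.
under eq_bigr do rewrite garnirE mulr_suml.
rewrite exchange_big; apply: eq_bigr => c _ /=.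
by rewrite coarsenE mulr_sumr; apply: eq_bigr => b _; rewrite mulrA.
Qed.

Lemma reindex_word_act (T : finType) (V : nmodType) (s : 'S_d)
    (f : {ffun 'I_d -> T} -> V) : \sum_c f c = \sum_c f (word_act c s).
Proof. exact: (reindex_inj (@word_act_inj d T s)). Qed.

Lemma good1 : good (bsign pL) (zipw u0 b1).
Proof.
apply/bgoodP => i j ij uij bij.
have g0 := (bgoodP pL u0 b0).1 good0.
case: (outside bij) => [bP|b0ij]; last exact: g0 ij uij b0ij.
have bPj : b1 j = P by rewrite -bij.
have key x y : u0 x = u0 y -> b0 x = P -> (a <= rL (u0 x))%N ->
    (rL (u0 y) <= a')%N -> ~~ pL (u0 x).
  move=> uxy bx ax ay; rewrite -uxy in ay.
  have [e1 e2] : a' = a /\ rL (u0 x) = a by lia.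
  by apply: (even_a e1) => //; rewrite compat0 bx.
case: (inside bP) => -[bi ai]; case: (inside bPj) => -[bj aj].
- by apply: g0 ij uij _; rewrite bi bj.
- exact: key uij bi ai aj.
- by rewrite uij; apply: key (esym uij) bj aj ai.
- by apply: g0 ij uij _; rewrite bi bj.
Qed.

Lemma supported_garnir : supported tL pL garnir b0.
Proof.
have iU : sinv (bsign pL) U := sinv_orb k (@bsignM L pL) good1.
split=> [s z|u b]; last first.
  rewrite garnirE => G0.
  have [c /andP[Uc /existsP[s /andP[/eqP cs /eqP bs]]]] :
      exists c, (U (zipw u c) != 0) && coarse_fine c b.
    apply/existsP; apply: contraNT G0; rewrite negb_exists => /forallP h.
    rewrite big1 // => c _; have := h c; rewrite negb_and negbK.
    by case/orP => [/eqP -> | /negbTE ->]; rewrite ?mul0r ?mulr0.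
  split; first by exists s.
  have [t] := orb_neq0 Uc; rewrite zipw_act => /zipw_inj[-> ct] j.
  rewrite ffunE compat0 -tag1.
  have := congr1 (fun w : WB => (w j).1) ct; rewrite cs !ffunE => <-.
  by rewrite bs ffunE tag1.
have [u [b ->]] := zipwP z; rewrite zipw_act !garnirE (reindex_word_act s) mulr_sumr.
apply: eq_bigr => c _; rewrite coarse_fine_act -zipw_act iU !bsign_zipw.
by rewrite mulrA.
Qed.

Lemma supported_coarsen (R : finType) (tR : R -> 'I_ell.+1) (pR : R -> bool) H :
  supported tR pR H b0 -> supported tR pR (coarsen H) b1.
Proof.
move=> [iH sH]; split=> [s z|w c]; last first.
  rewrite coarsenE => G0.
  have [b /andP[Hb /existsP[s /andP[/eqP cs /eqP bs]]]] :
      exists b, (H (zipw w b) != 0) && coarse_fine c b.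
    apply/existsP; apply: contraNT G0; rewrite negb_exists => /forallP h.
    rewrite big1 // => b _; have := h b; rewrite negb_and negbK.
    by case/orP => [/eqP -> | /negbTE ->]; rewrite ?mul0r ?mulr0.
  split; first by exists s.
  by move=> j; rewrite (sH _ _ Hb).2 bs cs !ffunE tag1.
have [w [c ->]] := zipwP z; rewrite zipw_act !coarsenE (reindex_word_act s) mulr_sumr.
apply: eq_bigr => b _; rewrite coarse_fine_act -zipw_act iH !bsign_zipw.
by rewrite mulrCA.
Qed.

Lemma supported_coarse_orb : supported tL pL U b1.
Proof.
by apply: supported_orb good1 _ => j; rewrite compat0 tag1.
Qed.

(** Outside [P] the letter and the block determine the regrouped label, so the set
    of places labelled [P] could only grow; its cardinality does not change. *)
Lemma regroup_unique s t :
  word_act u0 t = u0 -> word_act b0 s = b0 -> word_act b1 t = word_act b1 s ->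
  word_act b1 t = b1.
Proof.
move=> ut bs ts.
have tsE j : b1 (t j) = b1 (s j).
  by have := congr1 (fun w : WB => w j) ts; rewrite !ffunE.
have utE j : u0 (t j) = u0 j by rewrite -[in RHS]ut ffunE.
have bsE j : b0 (s j) = b0 j by rewrite -[in RHS]bs ffunE.
have out j : b1 (t j) != P -> b1 (t j) = b1 j.
  move=> nP; apply: separated => //.
  by case: (outside (tsE j)) => [/eqP|->] //; rewrite (negbTE nP).
have sub : [set j | b1 j == P]%SET \subset [set j | b1 (t j) == P]%SET.
  apply/fintype.subsetP => j; rewrite !inE => bP; apply: contraT => nP.
  by case/eqP: (nP); rewrite (out _ nP) (eqP bP).
have card : #|[set j | b1 (t j) == P]%SET| = #|[set j | b1 j == P]%SET|.
  rewrite -(card_word_act b1 t (pred1 P)).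
  by apply: eq_card => j; rewrite !inE ffunE.
have /eqP eqS : [set j | b1 j == P]%SET == [set j | b1 (t j) == P]%SET.
  by rewrite eqEcard sub card leqnn.
apply/ffunP => j; rewrite ffunE; case: (eqVneq (b1 (t j)) P) => [e|/out //].
have : j \in [set j | b1 (t j) == P]%SET by rewrite inE e.
by rewrite -eqS inE e => /eqP ->.
Qed.

Lemma garnir_diag : garnir (zipw u0 b0) = 1.
Proof.
rewrite garnirE (bigD1 b1) //= big1 => [|c cb1].
  rewrite (orb_id _ (@bsignM L pL) good1) addr0; have -> : coarse_fine b1 b0; last by rewrite mulr1.
  by apply/existsP; exists 1%g; rewrite !word_act1 !eqxx.
case: (eqVneq (U (zipw u0 c)) 0) => [->|/orb_neq0[t]]; first by rewrite mul0r.
rewrite zipw_act => /zipw_inj[ut ct].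
case: (boolP (coarse_fine c b0)) => [/existsP[s /andP[/eqP cs /eqP bs]]|_]; last by rewrite mulr0.
by case/eqP: cb1; rewrite ct; apply: (regroup_unique (s := s)) => //; rewrite -ct.
Qed.

(** Exchanging entries inside the regrouped class moves larger ranks to the
    later block, since those of [P] are at least [a] and those of [Q] at most
    [a]. *)
Lemma regroup_moment t : word_act b1 t = b1 ->
  (rank_moment b0 u0 <= rank_moment b0 (word_act u0 t))%N /\
  (rank_moment b0 (word_act u0 t) = rank_moment b0 u0 ->
   exists s, zipw (word_act u0 t) b0 = word_act (zipw u0 b0) s).
Proof.
move=> bt.
have btE j : b1 ((t^-1)%g j) = b1 j.
  by rewrite -{1}bt ffunE permKV.
pose r j := (b0 j).2 : nat; pose r' j := r ((t^-1)%g j); pose f j := rL (u0 j).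
have mE : rank_moment b0 (word_act u0 t) = (\sum_j r' j * f j)%N.
  rewrite /rank_moment (reindex_inj (@perm_inj _ (t^-1)%g)).
  by apply: eq_bigr => j _; rewrite ffunE permKV.
have sE : (\sum_j r' j = \sum_j r j)%N.
  by rewrite [RHS](reindex_inj (@perm_inj _ (t^-1)%g)).
have cases j : b0 ((t^-1)%g j) = b0 j \/
    [/\ b0 ((t^-1)%g j) = P, b0 j = Q & (f j <= a)%N] \/
    [/\ b0 ((t^-1)%g j) = Q, b0 j = P & (a <= f j)%N].
  case: (outside (btE j)) => [bP|]; last by left.
  have bPj : b1 j = P by rewrite -btE.
  case: (inside bP) => -[-> _]; case: (inside bPj) => -[-> h]; try by left.
    by right; left; split=> //; apply: leq_trans h a'a.
  by right; right.
have ptw j : (r j * f j + r' j * a <= r' j * f j + r j * a)%N.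
  rewrite /r' /r; case: (cases j) => [->|[[-> -> h]|[-> -> h]]] //.
    by case: PQ => _; move: (P.2 : nat) (Q.2 : nat) => p q; nia.
  by case: PQ => _; move: (P.2 : nat) (Q.2 : nat) => p q; nia.
have sum_ptw : (\sum_j (r j * f j + r' j * a) <= \sum_j (r' j * f j + r j * a))%N.
  by apply: leq_sum => j _; exact: ptw.
have expand : (\sum_j (r j * f j + r' j * a) = rank_moment b0 u0 + (\sum_j r j) * a)%N.
  by rewrite big_split /= -sE big_distrl.
have expand' : (\sum_j (r' j * f j + r j * a) =
    rank_moment b0 (word_act u0 t) + (\sum_j r j) * a)%N.
  by rewrite big_split /= mE [in RHS]big_distrl.
split; first by move: sum_ptw; rewrite expand expand' leq_add2r.
move=> eqm.
have ptw_eq j : (r j * f j + r' j * a = r' j * f j + r j * a)%N.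
  have /leqif_sum H : forall j, true -> (r j * f j + r' j * a <= r' j * f j + r j * a
      ?= iff (r j * f j + r' j * a == r' j * f j + r j * a))%N.
    by move=> i _; split; [exact: ptw|].
  have := H.2; rewrite expand expand' eqm eqxx => /esym /forallP /(_ j) /eqP.
  by [].
have moved j : b0 ((t^-1)%g j) != b0 j -> tL (u0 j) = P.1 /\ rL (u0 j) = a.
  move=> nb; have := ptw_eq j; rewrite /r' /r; case: (cases j) nb => [->|[[-> e h]|[-> e h]]].
  - by rewrite eqxx.
  - move=> _ eqj; rewrite compat0 e; split; first by case: PQ => ->.
    case: PQ => _; move: eqj; rewrite e -/(f j); move: (P.2 : nat) (Q.2 : nat) => p q; nia.
  - move=> _ eqj; rewrite compat0 e; split => //.
    case: PQ => _; move: eqj; rewrite e -/(f j); move: (P.2 : nat) (Q.2 : nat) => p q; nia.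
pose b0' := word_act b0 t^-1%g.
have [s es] : exists s, zipw u0 b0' = word_act (zipw u0 b0) s.
  case: (boolP [exists j, b0' j != b0 j]) => [/existsP[j0 nj0]|]; last first.
    rewrite negb_exists => /forallP h; exists 1%g; rewrite word_act1; congr zipw.
    by apply/ffunP => j; apply/eqP; have := h j; rewrite negbK.
  apply: (zipw_exchange (l0 := u0 j0) (t := t^-1%g)) => // j nj; apply/eqP.
  apply: contraNT nj; rewrite /b0' ffunE => /moved[e1 e2].
  by move: nj0; rewrite ffunE => /moved[e3 e4]; apply/eqP/rL_inj; rewrite ?e1 ?e2.
exists (t * s)%g; rewrite word_actM -es zipw_act; congr zipw.
by rewrite /b0' word_actKV.
Qed.

Lemma garnir_support u : garnir (zipw u b0) != 0 ->
  (rank_moment b0 u0 < rank_moment b0 u)%N \/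
  exists s, zipw u b0 = word_act (zipw u0 b0) s.
Proof.
rewrite garnirE => G0.
have [c /andP[Uc /existsP[s /andP[/eqP cs /eqP bs]]]] :
    exists c, (U (zipw u c) != 0) && coarse_fine c b0.
  apply/existsP; apply: contraNT G0; rewrite negb_exists => /forallP h.
  rewrite big1 // => c _; have := h c; rewrite negb_and negbK.
  by case/orP => [/eqP -> | /negbTE ->]; rewrite ?mul0r ?mulr0.
have [t] := orb_neq0 Uc; rewrite zipw_act => /zipw_inj[ut ct].
pose x := (s^-1 * t)%g.
have bx : word_act b1 x = b1 by rewrite word_actM -ct cs word_actK.
have bsV : word_act b0 s^-1%g = b0 by rewrite {1}bs word_actK.
have ux : u = word_act (word_act u0 x) s.
  by rewrite -word_actM mulKVg.
have mE : rank_moment b0 u = rank_moment b0 (word_act u0 x).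
  rewrite ux /rank_moment [RHS](reindex_inj (@perm_inj _ s)).
  by apply: eq_bigr => j _; rewrite {1}bs !ffunE.
have [le eqm] := regroup_moment bx.
rewrite mE; move: le; rewrite leq_eqVlt => /orP[/eqP e|]; last by left.
have [y ey] := eqm (esym e); right; exists (s * y)%g.
by rewrite word_actM -ey zipw_act -ux -bs.
Qed.

End Garnir.
End Kernels.

(** * Straightening *)

Section Straightening.
Variables (k : idomainType) (d n ell : nat).
Hypothesis char0 : [pchar k] =i pred0.
Local Notation Bk := ('I_ell.+1 * 'I_n)%type.
Local Notation WB := {ffun 'I_d -> Bk}.

(** [b] and [c] list the blocks (component, row) and the columns of the nodes of
    a tuple of Young diagrams. *)
Record shape (b : WB) (c : {ffun 'I_d -> nat}) : Prop := Shape {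
  shape_inj : forall i j, b i = b j -> c i = c j -> i = j;
  shape_row : forall j x, (x < c j)%N -> exists2 i, b i = b j & c i = x;
  shape_col : forall j (x : nat), (x < (b j).2)%N ->
    exists i, [/\ (b i).1 = (b j).1, (b i).2 = x :> nat & c i = c j]
}.

(** Grows when boxes are moved to a longer row; bounded, so it drives the
    induction on shapes. *)
Definition potential (b : WB) : nat := (\sum_(B : Bk) 2 ^ #|[set j | b j == B]%SET|)%N.

Section Half.
Variables (L : finType) (tL : L -> 'I_ell.+1) (pL : L -> bool) (rL : L -> nat).
Hypothesis rL_inj : forall x y, tL x = tL y -> rL x = rL y -> x = y.

Definition standard_word (b : WB) (c : {ffun 'I_d -> nat}) (u : {ffun 'I_d -> L}) : bool :=
  [forall i, forall j,
    ((b i == b j) && (c i < c j)%N ==>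
       (rL (u i) <= rL (u j))%N && ((u i == u j) ==> ~~ pL (u i))) &&
    ([&& (b i).1 == (b j).1, c i == c j & ((b i).2 < (b j).2)%N] ==>
       (rL (u i) <= rL (u j))%N && ((u i == u j) ==> pL (u i)))].

Section Violation.
Variables (b : WB) (c : {ffun 'I_d -> nat}) (u : {ffun 'I_d -> L}).
Hypothesis shape_bc : shape b c.
Hypothesis compat_u : compat tL u b.
Hypothesis good_u : good (bsign pL) (zipw u b).
Hypothesis rows_sorted : class_sorted b c (fun j => rL (u j)).

Lemma violation : ~~ standard_word b c u -> exists i j,
  [/\ (b i).1 = (b j).1, c i = c j, ((b i).2 < (b j).2)%N, (rL (u j) <= rL (u i))%N
    & rL (u j) = rL (u i) -> ~~ pL (u i)].
Proof.
move=> /forallPn[i /forallPn[j]]; rewrite negb_and => /orP[].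
  rewrite negb_imply => /andP[/andP[/eqP bij cij]].
  rewrite (rows_sorted bij cij) /= negb_imply negbK => /andP[/eqP uij pu].
  have ij : i != j by apply/eqP => e; rewrite e ltnn in cij.
  by have := (bgoodP pL u b).1 good_u i j ij uij bij; rewrite pu.
rewrite negb_imply => /andP[/and3P[/eqP bij /eqP cij lt]].
have tij : tL (u i) = tL (u j) by rewrite !compat_u.
rewrite negb_and => H; exists i, j; split => //.
  case/orP: H; first by move=> h; apply: ltnW; rewrite ltnNge.
  by rewrite negb_imply => /andP[/eqP -> _].
move=> e; move: H; rewrite e leqnn /= negb_imply => /andP[] //.
Qed.

(** Entries of the upper row below the violating entry lie strictly to the left of
    the violation, while all entries of the lower row up to the violation are at
    most the lower violating entry; so the regrouped row is longer than the upper
    one. *)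
Lemma violation_count i0 j0 : (b i0).1 = (b j0).1 -> c i0 = c j0 ->
  ((b i0).2 < (b j0).2)%N ->
  (#|[set j | (b j == b i0) && (rL (u j) < rL (u i0))%N]%SET| <
   #|[set j | (b j == b j0) && (rL (u j) <= rL (u j0))%N]%SET|)%N.
Proof.
move=> tij cij lt.
have cx j : j \in [set j | (b j == b i0) && (rL (u j) < rL (u i0))%N]%SET ->
    b j = b i0 /\ (c j < c j0)%N.
  rewrite inE => /andP[/eqP bj rj]; split=> //; rewrite -cij ltnNge leq_eqVlt.
  apply/negP => /orP[/eqP e|h].
    by rewrite (shape_inj shape_bc bj (esym e)) ltnn in rj.
  by have := rows_sorted (esym bj) h; rewrite leqNgt rj.
pose h j := odflt j [pick i | (b i == b j0) && (c i == c j)].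
have hP j : (c j < c j0)%N -> b (h j) = b j0 /\ c (h j) = c j.
  move=> /(shape_row shape_bc)[i bi ci]; rewrite /h; case: pickP => [i' /andP[/eqP -> /eqP ->] //|].
  by move=> /(_ i); rewrite bi ci !eqxx.
have hinj : {in [set j | (b j == b i0) && (rL (u j) < rL (u i0))%N]%SET &, injective h}.
  move=> i j /cx[bi ci] /cx[bj cj] hij; apply: (shape_inj shape_bc); first by rewrite bi.
  by rewrite -(hP i ci).2 -(hP j cj).2 hij.
rewrite -(card_in_imset hinj); apply: proper_card; apply/properP; split.
  apply/fintype.subsetP => q /imsetP[j /cx[bj cj] ->].
  rewrite inE (hP j cj).1 eqxx /=.
  by apply: (rows_sorted (hP j cj).1); rewrite (hP j cj).2.
exists j0; first by rewrite inE eqxx leqnn.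
apply/imsetP => -[j /cx[bj cj] e].
by have := (hP j cj).2; rewrite -e => e'; rewrite -e' ltnn in cj.
Qed.

Lemma shape_rows_decrease i0 j0 : (b i0).1 = (b j0).1 -> ((b i0).2 < (b j0).2)%N ->
  (#|[set j | b j == b j0]%SET| <= #|[set j | b j == b i0]%SET|)%N.
Proof.
move=> tij lt.
pose h j := odflt j [pick i | (b i == b i0) && (c i == c j)].
have hP j : b j = b j0 -> b (h j) = b i0 /\ c (h j) = c j.
  move=> bj; have := shape_col shape_bc (j := j) (x := (b i0).2).
  rewrite bj => /(_ lt)[i [ti ri ci]].
  rewrite /h; case: pickP => [i' /andP[/eqP -> /eqP ->] //|].
  move=> /(_ i); rewrite ci eqxx andbT => /eqP[].
  by apply/eqP; rewrite [b i]surjective_pairing [b i0]surjective_pairing xpair_eqE ti tij eqxx -val_eqE /= ri.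
have hinj : {in [set j | b j == b j0]%SET &, injective h}.
  move=> i j; rewrite !inE => /eqP bi /eqP bj hij.
  apply: (shape_inj shape_bc); first by rewrite bi.
  by rewrite -(hP i bi).2 -(hP j bj).2 hij.
rewrite -(card_in_imset hinj); apply: subset_leq_card.
apply/fintype.subsetP => q /imsetP[j]; rewrite inE => /eqP bj ->.
by rewrite inE (hP j bj).1.
Qed.

End Violation.

(** If all rows were occupied, [Q] twice, there would be more than [n] places. *)
Lemma free_row (b : WB) (P Q : Bk) : (d <= n)%N -> P.1 = Q.1 ->
  (0 < #|[set j | b j == P]%SET|)%N -> (1 < #|[set j | b j == Q]%SET|)%N ->
  exists2 P' : Bk, P'.1 = P.1 & forall j, b j != P'.
Proof.
move=> dn PQ cP cQ.
case: (boolP [exists p : 'I_n, [forall j, b j != (P.1, p)]]) => [/existsP[p /forallP hp]|].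
  by exists (P.1, p).
rewrite negb_exists => /forallP H.
have pos p : (0 < #|[set j | b j == (P.1, p)]%SET|)%N.
  have := H p; rewrite negb_forall => /existsP[j]; rewrite negbK => bj.
  by apply/card_gt0P; exists j; rewrite inE.
have : (\sum_(p : 'I_n) #|[set j | b j == (P.1, p)]%SET| <= d)%N.
  rewrite -[X in (_ <= X)%N](card_ord d) -sum1_card.
  rewrite (partition_big (fun j => (b j).2) predT) //=; apply: leq_sum => p _.
  rewrite -sum1dep_card; rewrite big_mkcond [X in (_ <= X)%N]big_mkcond /=.
  by apply: leq_sum => j _; case: eqP => // ->; rewrite eqxx.
rewrite (bigD1 Q.2) //= PQ -surjective_pairing.
have : (\sum_(p < n | p != Q.2) 1 <= \sum_(p < n | p != Q.2) #|[set j | b j == (Q.1, p)]%SET|)%N.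
  by apply: leq_sum => p _; rewrite -PQ.
have n0 : (0 < n)%N by apply: leq_trans (ltn_ord Q.2).
rewrite sum1_card (eq_card (B := predC1 Q.2)) // cardC1 card_ord => h1 h2.
move: h1 h2 cQ; set S1 := (\sum_(_ < _ | _) _)%N; set c1 := #|_|; lia.
Qed.

(** The regrouping of a violation. When some entries of the upper row are left
    over, they move to an empty row [P']; otherwise [P'] is the upper row
    itself. *)
Lemma garnir_regroup b c u : (d <= n)%N -> shape b c -> compat tL u b ->
  good (bsign pL) (zipw u b) -> class_sorted b c (fun j => rL (u j)) ->
  ~~ standard_word b c u ->
  exists b1 G, [/\ (potential b < potential b1)%N,
    supported tL pL G b, G (zipw u b) = 1,
    (forall u', G (zipw u' b) != 0 -> (rank_moment rL b u < rank_moment rL b u')%N \/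
       exists s, zipw u' b = word_act (zipw u b) s) &
    exists U, supported tL pL U b1 /\
    forall (R : finType) (tR : R -> 'I_ell.+1) (pR : R -> bool) H, supported tR pR H b ->
    exists2 H' : kernel k d n ell R, supported tR pR H' b1 &
      forall (M : lmodType k) (E : {ffun 'I_d -> L} -> {ffun 'I_d -> R} -> M),
      prodE E G H = prodE E U H'].
Proof.
move=> dn sh cu gu rows nst.
have [i0 [j0 [tij cij lt rji ev]]] := violation cu gu rows nst.
pose P := b i0; pose Q := b j0; pose a := rL (u i0); pose a' := rL (u j0).
have cnt := violation_count sh rows tij cij lt.
have dec := shape_rows_decrease sh tij lt.
have PQ : P != Q by apply/eqP => e; rewrite -/P -/Q e ltnn in lt.
have [P' tP' freeP'] : exists2 P' : Bk, P'.1 = P.1 &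
    (P' = P /\ forall j, b j = P -> (a <= rL (u j))%N) \/ (forall j, b j <> P').
  case: (posnP #|[set j | (b j == b i0) && (rL (u j) < rL (u i0))%N]%SET|) => [x0|xpos].
    exists P => //; left; split=> // j bj; rewrite leqNgt; apply/negP => h.
    have : j \in [set j | (b j == b i0) && (rL (u j) < rL (u i0))%N]%SET.
      by rewrite inE bj eqxx.
    by rewrite (cards0_eq x0) inE.
  have cP : (0 < #|[set j | b j == P]%SET|)%N by apply/card_gt0P; exists i0; rewrite inE.
  have cQ : (1 < #|[set j | b j == Q]%SET|)%N.
    apply: leq_ltn_trans xpos _; apply: leq_trans cnt _; apply: subset_leq_card.
    by apply/fintype.subsetP => j; rewrite !inE => /andP[].
  by have [P' tP' hP'] := free_row dn tij cP cQ; exists P' => //; right => j; apply/eqP.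
pose b1 : WB := [ffun j => if b j == P then (if (rL (u j) < a)%N then P' else P)
  else if b j == Q then (if (rL (u j) <= a')%N then P else Q) else b j].
have tag1 j : (b1 j).1 = (b j).1.
  rewrite ffunE; case: eqP => [->|_]; first by case: ifP.
  by case: eqP => [->|//]; case: ifP => // _; rewrite tij.
have inside j : b1 j = P ->
    (b j = P /\ (a <= rL (u j))%N) \/ (b j = Q /\ (rL (u j) <= a')%N).
  rewrite ffunE; case: eqP => [bP|nP].
    case: ifP => [ra e|/negbT]; last by rewrite -leqNgt; left.
    case: freeP' => [[_ h]|h]; first by have := h j bP; rewrite leqNgt ra.
    by case: (h j); rewrite bP e.
  by case: eqP => [bQ|//]; case: ifP => [_ _|_ e]; [right|rewrite e eqxx in PQ].
have stay j : b1 j <> P -> b1 j = b j \/ (b1 j = P' /\ b j = P /\ P' <> P).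
  rewrite ffunE; case: eqP => [bP|nP].
    by case: ifP => // _ nP'; right.
  by case: eqP => [bQ|]; [case: ifP => // _; left|left].
have outside i j : b1 i = b1 j -> b1 i = P \/ b i = b j.
  move=> e; case: (eqVneq (b1 i) P) => [|/eqP ni]; [by left|right].
  have nj : b1 j <> P by rewrite -e.
  case: (stay i ni) (stay j nj) => [ei|[ei [bi nP']]] [ej|[ej [bj nP'']]].
  - by rewrite -ei -ej.
  - by case: freeP' => [[/nP'' //]|/(_ i)]; rewrite -ei e ej.
  - by case: freeP' => [[/nP' //]|/(_ j)]; rewrite -ej -e ei.
  - by rewrite bi bj.
have separated i j : b i = b j -> u i = u j -> b1 i = b1 j.
  by move=> bij uij; rewrite !ffunE bij uij.
have even_a : a' = a -> forall l, tL l = P.1 -> rL l = a -> ~~ pL l.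
  move=> /ev pi l tl rl; have -> : l = u i0; last by [].
  by apply: rL_inj; rewrite ?cu.
have pot : (potential b < potential b1)%N.
  rewrite /potential (bigD1 P) //= (bigD1 Q) 1?eq_sym //=.
  rewrite [X in (_ < X)%N](bigD1 P) //= [X in (_ < _ + X)%N](bigD1 Q) 1?eq_sym //=.
  have rest : (\sum_(B | (B != P) && (B != Q)) 2 ^ #|[set j | b j == B]%SET| <=
      \sum_(B | (B != P) && (B != Q)) 2 ^ #|[set j | b1 j == B]%SET|)%N.
    apply: leq_sum => B /andP[BP BQ]; rewrite leq_pexp2l //; apply: subset_leq_card.
    apply/fintype.subsetP => j; rewrite !inE ffunE => /eqP ->.
    by rewrite (negbTE BP) (negbTE BQ) eqxx.
  have big : (#|[set j | b j == P]%SET| < #|[set j | b1 j == P]%SET|)%N.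
    pose X := [set j | (b j == P) && (rL (u j) < a)%N]%SET.
    pose Y := [set j | (b j == Q) && (rL (u j) <= a')%N]%SET.
    pose Z := [set j | (b j == P) && (a <= rL (u j))%N]%SET.
    have eP : #|[set j | b j == P]%SET| = (#|X| + #|Z|)%N.
      rewrite -cardsUI [#|X :&: Z|]eq_card0 ?addn0 => [|j]; last first.
        by rewrite /X /Z !inE [(a <= _)%N]leqNgt; case: (b j == P); case: (_ < _)%N.
      by apply: eq_card => j; rewrite /X /Z !inE [(a <= _)%N]leqNgt; case: (b j == P); case: (_ < _)%N.
    have eP1 : (#|Y| + #|Z| <= #|[set j | b1 j == P]%SET|)%N.
      rewrite -cardsUI [#|Y :&: Z|]eq_card0 ?addn0 => [|j]; last first.
        rewrite /Y /Z !inE; apply/negP => /andP[/andP[/eqP e _] /andP[/eqP e' _]].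
        by case/eqP: PQ; exact: etrans (esym e') e.
      apply: subset_leq_card; apply/fintype.subsetP => j; rewrite /Y /Z !inE ffunE.
      case/orP => /andP[/eqP e r]; last by rewrite e eqxx ltnNge r.
      by case: (eqVneq (b j) P) => [e'|_]; [case/eqP: PQ; rewrite -e' -e|rewrite e eqxx r].
    by rewrite eP; apply: leq_trans eP1; rewrite ltn_add2r.
  have h1 : (2 * 2 ^ #|[set j | b j == P]%SET| <= 2 ^ #|[set j | b1 j == P]%SET|)%N.
    by rewrite -expnS leq_pexp2l.
  have h2 : (2 ^ #|[set j | b j == Q]%SET| <= 2 ^ #|[set j | b j == P]%SET|)%N.
    by rewrite leq_pexp2l.
  have h3 : (0 < 2 ^ #|[set j | b1 j == Q]%SET|)%N by rewrite expn_gt0.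
  move: h1 h2 h3 rest.
  move: (\sum_(B | (B != P) && (B != Q)) 2 ^ #|[set j | b j == B]%SET|)%N => s1.
  move: (\sum_(B | (B != P) && (B != Q)) 2 ^ #|[set j | b1 j == B]%SET|)%N => s2.
  move: (2 ^ #|[set j | b j == P]%SET|)%N (2 ^ #|[set j | b j == Q]%SET|)%N => x y.
  move: (2 ^ #|[set j | b1 j == P]%SET|)%N (2 ^ #|[set j | b1 j == Q]%SET|)%N => z w.
  lia.
have PQ' : P.1 = Q.1 /\ (P.2 < Q.2)%N by [].
exists b1, (garnir k pL b b1 u); split=> //.
- exact: (supported_garnir k cu gu tag1 outside inside PQ' rji even_a).
- exact: (garnir_diag k cu gu outside inside separated PQ' rji even_a).
- exact: (garnir_support (k := k) rL_inj cu outside inside PQ' rji even_a).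
exists (orb k (bsign pL) (zipw u b1)); split.
  exact: (supported_coarse_orb k cu gu tag1 outside inside PQ' rji even_a).
move=> R tR pR H sH; exists (coarsen b b1 H); first exact: (supported_coarsen tag1 sH).
by move=> M E; exact: prodE_garnir.
Qed.

Lemma supported_expand (Q : kernel k d n ell L -> Prop) F b :
  Q 0 -> (forall x G H, Q G -> Q H -> Q (x *: G + H)) -> supported tL pL F b ->
  (forall u, compat tL u b -> good (bsign pL) (zipw u b) -> F (zipw u b) != 0 ->
     Q (orb k (bsign pL) (zipw u b))) -> Q F.
Proof.
move=> Q0 QL [iF sF] QF.
have QD G H : Q G -> Q H -> Q (G + H).
  by move=> QG QH; rewrite -[G]scale1r; apply: QL.
have QZ x G : Q G -> Q (x *: G).
  by move=> QG; rewrite -[_ *: _]addr0; apply: QL.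
apply: (sinv_expand char0 (@bsignM d n ell L pL) Q0 QD iF) => z.
have [u [b' ->]] := zipwP z => Fz; apply: (QZ).
have [[s bs] cu] := sF _ _ Fz.
have gz := sinv_good char0 iF Fz.
rewrite (orb_act char0 (@bsignM d n ell L pL) s^-1%g gz); apply: QZ.
have Fz' : F (word_act (zipw u b') s^-1%g) != 0 by rewrite iF mulf_neq0 ?signr_eq0.
have gz' := sinv_good char0 iF Fz'; move: gz' Fz'; rewrite zipw_act.
have -> : word_act b' s^-1%g = b by rewrite bs word_actK.
move=> gz' Fz'; apply: QF => //; exact: (sF _ _ Fz').2.
Qed.

(** A violation is resolved by subtracting a Garnir kernel: its product belongs to
    a larger shape, and the remaining words have larger rank moment. *)
Lemma straighten_left (R : finType) (tR : R -> 'I_ell.+1) (pR : R -> bool)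
    (M : lmodType k) (E : {ffun 'I_d -> L} -> {ffun 'I_d -> R} -> M) (S : M -> Prop) b c H :
  (d <= n)%N -> S 0 -> (forall x v w, S v -> S w -> S (x *: v + w)) ->
  shape b c -> supported tR pR H b ->
  (forall b1 F1 H1, (potential b < potential b1)%N -> supported tL pL F1 b1 ->
     supported tR pR H1 b1 -> S (prodE E F1 H1)) ->
  (forall u, standard_word b c u -> compat tL u b -> good (bsign pL) (zipw u b) ->
     S (prodE E (orb k (bsign pL) (zipw u b)) H)) ->
  forall F, supported tL pL F b -> S (prodE E F H).
Proof.
move=> dn S0 SL sh sH IHb Sstd.
have SE0 : S (prodE E 0 H) by rewrite prodE0l.
have SEL x G G' : S (prodE E G H) -> S (prodE E G' H) -> S (prodE E (x *: G + G') H).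
  by move=> h1 h2; rewrite prodE_addl; apply: SL.
pose N := (\sum_(j < d) (b j).2 * \max_l rL l)%N.
have bound u : (rank_moment rL b u <= N)%N.
  by apply: leq_sum => j _; rewrite leq_mul2l leq_bigmax orbT.
suff key m u : (N - rank_moment rL b u < m)%N -> compat tL u b ->
    good (bsign pL) (zipw u b) -> S (prodE E (orb k (bsign pL) (zipw u b)) H).
  move=> F sF; apply: (supported_expand (Q := fun F => S (prodE E F H)) SE0 SEL sF).
  by move=> u cu gu _; apply: key (ltnSn _) cu gu.
elim: m u => // m IH u um cu gu.
have [s bs sorted] := class_sort b c (fun j => rL (u j)).
have bsE : word_act b s = b by apply/ffunP => j; rewrite ffunE bs.
pose u' := word_act u s.
have zE : word_act (zipw u b) s = zipw u' b by rewrite zipw_act bsE.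
have gu' : good (bsign pL) (zipw u' b).
  by rewrite -zE; exact: (good_act char0 (@bsignM d n ell L pL) gu).
have cu' : compat tL u' b by move=> j; rewrite ffunE cu bs.
have um' : rank_moment rL b u' = rank_moment rL b u.
  rewrite /rank_moment [RHS](reindex_inj (@perm_inj _ s)).
  by apply: eq_bigr => j _; rewrite ffunE bs.
rewrite (orb_act char0 (@bsignM d n ell L pL) s gu) zE.
suff Sz : S (prodE E (orb k (bsign pL) (zipw u' b)) H).
  rewrite -[_ *: _]addr0 prodE_addl; apply: SL => //.
case: (boolP (standard_word b c u')) => [st|nst]; first exact: Sstd.
have rows : class_sorted b c (fun j => rL (u' j)).
  by move=> i j bij cij; rewrite !ffunE; apply: sorted.
have [b1 [G [pot sG Gz suppG [U [sU HU]]]]] := garnir_regroup dn sh cu' gu' rows nst.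
have SG : S (prodE E G H).
  by have [H' sH' ->] := HU _ _ _ _ sH; apply: IHb pot sU sH'.
pose D := -1 *: G + orb k (bsign pL) (zipw u' b).
have sO := supported_orb k gu' cu'.
have sD : supported tL pL D b by apply: supported_closed.
have -> : orb k (bsign pL) (zipw u' b) = 1 *: G + D.
  by rewrite /D scaleN1r scale1r addrA subrr add0r.
apply: (SEL) => //; apply: (supported_expand (Q := fun F => S (prodE E F H)) SE0 SEL sD).
move=> v cv gv Dv; apply: IH => //.
have Dorb s' : D (word_act (zipw u' b) s') = 0.
  rewrite (sD.1 s') /D ffunE [X in X + _]ffunE Gz (orb_id _ (@bsignM d n ell L pL) gu').
  by rewrite [_ *: _]mulr1 addNr mulr0.
have lt : (rank_moment rL b u' < rank_moment rL b v)%N.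
  case: (eqVneq (G (zipw v b)) 0) => [G0|/suppG [//|[s' e]]]; last first.
    by rewrite e Dorb eqxx in Dv.
  case: (eqVneq (orb k (bsign pL) (zipw u' b) (zipw v b)) 0) => [O0|/orb_neq0[s' e]]; last first.
    by rewrite e Dorb eqxx in Dv.
  by move: Dv; rewrite /D ffunE [X in X + _]ffunE G0 O0 scaler0 addr0 eqxx.
by have := bound v; move: um; rewrite -um'; lia.
Qed.

End Half.
End Straightening.

(** * The shape of a multipartition *)

Section Multipartition.
Variables (ell n d : nat).
Local Notation Bk := ('I_ell.+1 * 'I_n)%type.

Section Nodes.
Variable lam : multipart ell n d.

Definition node_type := {i : 'I_ell.+1 & diagram (val lam i)}.
HB.instance Definition _ := Finite.on node_type.

Definition node_word : {ffun 'I_d -> node_type} :=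
  reading (fun i u => Tagged (fun i => diagram (val lam i)) u).

Lemma readingE (T : Type) (f : forall i, diagram (val lam i) -> T) j :
  reading f j = f (tag (node_word j)) (tagged (node_word j)).
Proof.
have E : reading_seq f = [seq f (tag u) (tagged u) |
    u <- reading_seq (fun i u => Tagged (fun i => diagram (val lam i)) u)].
  rewrite /reading_seq map_flatten -map_comp; congr flatten.
  apply: eq_map => i /=; rewrite map_flatten -map_comp; congr flatten.
  by apply: eq_map => r /=; rewrite -map_comp.
rewrite !ffunE; set x := (tnth (Tuple (size_reading_seq
  (fun i u => Tagged (fun i => diagram (val lam i)) u))) j).
rewrite (tnth_nth (f (tag x) (tagged x))) /= E (nth_map x).
  by rewrite -[nth x _ j](tnth_nth x (Tuple (size_reading_seq _))).
by rewrite (eqP (size_reading_seq _)).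
Qed.

Lemma node_word_surj (u : node_type) : exists j, node_word j = u.
Proof.
case: u => i [r c].
have : Tagged (fun i => diagram (val lam i)) (Tagged (fun r => 'I_(tnth (val lam i) r)) c)
    \in reading_seq (fun i u => Tagged (fun i => diagram (val lam i)) u).
  apply/flatten_mapP; exists i; first by rewrite mem_enum.
  apply/flatten_mapP; exists r; first by rewrite mem_enum.
  by apply/mapP; exists c; rewrite ?mem_enum.
set x := Tagged _ _ => /(nthP x)[j]; rewrite (eqP (size_reading_seq _)) => jd e.
by exists (Ordinal jd); rewrite ffunE (tnth_nth x) /= e.
Qed.

Lemma card_node_type : #|{: node_type}| = d.
Proof.
rewrite card_tagged sumnE big_map big_enum /=.
have /andP[_ /eqP sl] := valP lam; apply: etrans sl; apply: eq_bigr => i _.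
rewrite card_tagged sumnE big_map big_enum /= sumnE big_tuple.
by apply: eq_bigr => r _; rewrite card_ord.
Qed.

Lemma node_word_inj : injective node_word.
Proof.
have [g gK] := choice node_word_surj.
have cardE : (#|'I_d| <= #|{: node_type}|)%N by rewrite card_ord card_node_type.
have [h hK Kh] := inj_card_bij (can_inj gK) cardE.
move=> i j e; rewrite -(Kh i) -(Kh j); congr g.
by rewrite -(gK (h i)) -(gK (h j)) !Kh.
Qed.

Definition node_block (u : node_type) : Bk := (tag u, node_row (tagged u)).
Definition node_column (u : node_type) : nat := node_col (tagged u).

Lemma node_ext u v : node_block u = node_block v -> node_column u = node_column v -> u = v.
Proof.
case: u v => [x [r p]] [y [r' p']] /= [exy].
move: r' p'; rewrite -exy => r' p' /=; rewrite /node_row /node_column /node_col /= => err.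
by move: p'; rewrite -err => p' /= /val_inj ->.
Qed.

Definition block_word : {ffun 'I_d -> Bk} := [ffun j => node_block (node_word j)].
Definition col_word : {ffun 'I_d -> nat} := [ffun j => node_column (node_word j)].

Lemma block_word_col_inj i j :
  block_word i = block_word j -> col_word i = col_word j -> i = j.
Proof.
rewrite [block_word i]ffunE [block_word j]ffunE [col_word i]ffunE [col_word j]ffunE.
by move=> e c; apply: node_word_inj; exact: node_ext.
Qed.

Lemma block_wordP (i : 'I_ell.+1) (r : 'I_n) x : (x < tnth (val lam i) r)%N ->
  exists2 j, block_word j = (i, r) & col_word j = x.
Proof.
move=> h; have [j e] := node_word_surj
  (Tagged (fun i => diagram (val lam i)) (Tagged (fun r => 'I_(tnth (val lam i) r)) (Ordinal h))).
by exists j; rewrite [LHS]ffunE e.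
Qed.

Lemma col_word_lt j : (col_word j < tnth (val lam (block_word j).1) (block_word j).2)%N.
Proof.
rewrite [block_word j]ffunE [col_word j]ffunE.
by case: (node_word j) => [i [r c]] /=; exact: ltn_ord c.
Qed.

Lemma part_decreasing i (r s : 'I_n) : (r <= s)%N ->
  (tnth (val lam i) s <= tnth (val lam i) r)%N.
Proof.
move=> rs; have /andP[/forallP /(_ i) srt _] := valP lam.
rewrite !(tnth_nth 0%N).
have tr : transitive geq by move=> x y z /= h1 h2; exact: leq_trans h2 h1.
have rf : reflexive geq by move=> x /=.
have mem (q : 'I_n) : (q : nat) \in [pred x | (x < size (val lam i))%N].
  by rewrite inE size_tuple.
exact: (sorted_leq_nth tr rf 0%N srt _ _ (mem r) (mem s) rs).
Qed.

Lemma shape_multipart : shape block_word col_word.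
Proof.
split; first exact: block_word_col_inj.
- move=> j x xj; have := ltn_trans xj (col_word_lt j) => /block_wordP[i ei ci].
  by exists i; rewrite // ei -surjective_pairing.
move=> j x xj; have xn : (x < n)%N by apply: ltn_trans xj (ltn_ord _).
have lt : (col_word j < tnth (val lam (block_word j).1) (Ordinal xn))%N.
  by apply: leq_trans (col_word_lt j) (part_decreasing _ _); rewrite /= ltnW.
by have [i ei ci] := block_wordP lt; exists i; rewrite ei.
Qed.

Lemma card_block_word (B : Bk) :
  #|[set j | block_word j == B]%SET| = tnth (val lam B.1) B.2.
Proof.
case: B => i r /=; rewrite -[RHS]card_ord.
have [f fP] := choice (fun x : 'I_(tnth (val lam i) r) =>
  let: ex_intro2 j e1 e2 := block_wordP (ltn_ord x) in
  ex_intro (fun j => block_word j = (i, r) /\ col_word j = x) j (conj e1 e2)).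
have finj : injective f by move=> x y e; apply: ord_inj; rewrite -[LHS](fP x).2 -[RHS](fP y).2 e.
rewrite -(card_imset _ finj); apply: eq_card => j; rewrite inE; apply/eqP/imsetP => [e|[x _ ->]].
  have lt := col_word_lt j; rewrite e in lt.
  exists (Ordinal lt) => //; apply: block_word_col_inj; first by rewrite (fP _).1.
  by rewrite (fP _).2.
by rewrite (fP x).1.
Qed.

End Nodes.

(** The number of places with a given label is a row length. *)
Lemma multipart_eq (lam mu : multipart ell n d) s :
  block_word lam = word_act (block_word mu) s -> lam = mu.
Proof.
move=> e; apply/val_inj/ffunP => i; apply: eq_from_tnth => r.
rewrite -(card_block_word lam (i, r)) -(card_block_word mu (i, r)) e.
exact: (card_word_act (block_word mu) s (pred1 (i, r))).
Qed.

(** Sorting the row lengths of each component gives the partitions, and the sorting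
    permutations rename the rows. *)
Lemma multipart_of_word (b : {ffun 'I_d -> Bk}) :
  exists (lam : multipart ell n d) (g : Bk -> Bk) s,
  [/\ bijective g, forall B, (g B).1 = B.1 &
      block_word lam = word_act [ffun j => g (b j)] s].
Proof.
pose len (i : 'I_ell.+1) (r : 'I_n) := #|[set j | b j == (i, r)]%SET|.
pose row i := [tuple len i r | r < n].
have srt i : size (sort geq (row i)) == n by rewrite size_sort size_tuple.
pose lam0 : {ffun 'I_ell.+1 -> n.-tuple nat} := [ffun i => Tuple (srt i)].
have exs i : exists s : 'S_n, forall r, tnth (lam0 i) r = len i (s r).
  have /tuple_permP[s es] : perm_eq (lam0 i) (row i) by rewrite ffunE /= perm_sort.
  exists s => r; have := congr1 (fun t : seq nat => nth 0%N t r) es.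
  by rewrite -tnth_nth -(tnth_nth _ [tuple _ | _ < n]) !tnth_mktuple.
have [s sP] := choice exs.
have lamP : is_multipart d lam0.
  apply/andP; split.
    apply/forallP => i; rewrite ffunE /=; apply: sort_sorted => x y /=.
    exact: leq_total.
  apply/eqP; transitivity (\sum_(i < ell.+1) \sum_(r < n) len i r)%N.
    apply: eq_bigr => i _; rewrite sumnE big_tuple.
    rewrite [RHS](reindex_inj (@perm_inj _ (s i))); apply: eq_bigr => r _; exact: sP.
  rewrite pair_bigA /= -[RHS](card_ord d) -[RHS]sum1_card.
  rewrite [RHS](partition_big b predT) //=; apply: eq_bigr => -[i r] _.
  by rewrite -[LHS]sum1_card; apply: eq_bigl => j; rewrite inE.
pose lam : multipart ell n d := exist _ lam0 lamP.
pose g (B : Bk) : Bk := (B.1, ((s B.1)^-1)%g B.2).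
have gb : bijective g.
  by exists (fun B : Bk => (B.1, s B.1 B.2)) => -[i r]; rewrite /g /= ?permK ?permKV.
suff [t et] : exists t, block_word lam = word_act [ffun j => g (b j)] t.
  by exists lam, g, t; split.
apply: word_rearrange => -[i r]; rewrite card_block_word /= sP.
apply: eq_card => j; rewrite !inE ffunE /g.
case: (b j) => i' r' /=; rewrite !xpair_eqE; case: (eqVneq i' i) => //= ->.
by rewrite -(inj_eq (@perm_inj _ (s i))) permKV.
Qed.

End Multipartition.

(** * Standard products span *)

Section StandardSpan.
Variables (k : idomainType) (d n ell : nat).
Hypothesis char0 : [pchar k] =i pred0.
Hypothesis d_le_n : (d <= n)%N.
Local Notation Bk := ('I_ell.+1 * 'I_n)%type.

Lemma potential_bound (b : {ffun 'I_d -> Bk}) : (potential b <= #|{: Bk}| * 2 ^ d)%N.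
Proof.
rewrite -sum_nat_const; apply: leq_sum => B _.
by rewrite leq_pexp2l // -[X in (_ <= X)%N](card_ord d) max_card.
Qed.

Lemma potential_act (b : {ffun 'I_d -> Bk}) s : potential (word_act b s) = potential b.
Proof. by apply: eq_bigr => B _; rewrite (card_word_act b s (pred1 B)). Qed.

Lemma potential_relabel (b : {ffun 'I_d -> Bk}) g : bijective g ->
  potential ([ffun j => g (b j)] : {ffun 'I_d -> Bk}) = potential b.
Proof.
move=> gb; rewrite /potential (reindex g) /=; last exact: onW_bij.
apply: eq_bigr => B _; congr (2 ^ _)%N; apply: eq_card => j; rewrite !inE ffunE.
by rewrite (bij_eq gb).
Qed.

Lemma supported_relabel (L : finType) (tL : L -> 'I_ell.+1) (pL : L -> bool)
    (F : kernel k d n ell L) (b b' : {ffun 'I_d -> Bk}) (g h : Bk -> Bk) s :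
  cancel g h -> cancel h g -> (forall B, (g B).1 = B.1) ->
  b' = word_act [ffun j => g (b j)] s ->
  supported tL pL F b -> supported tL pL (relabel h F) b'.
Proof.
move=> gK hK tg eb [iF sF]; split=> [t z|u c].
  have [u [c ->]] := zipwP z; rewrite zipw_act !relabelE bsign_zipw.
  have -> : [ffun j => h (word_act c t j)] = word_act [ffun j => h (c j)] t.
    by apply/ffunP => j; rewrite !ffunE.
  by rewrite -zipw_act iF bsign_zipw.
rewrite relabelE => /sF[[t ct] cu]; split; last first.
  by move=> j; rewrite cu ffunE -tg hK.
exists (t * s^-1)%g; rewrite eb word_actM word_actK.
apply/ffunP => j; have := congr1 (fun w : {ffun 'I_d -> Bk} => g (w j)) ct.
by rewrite !ffunE hK.
Qed.

Section TwoSided.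
Variables (L R : finType) (tL : L -> 'I_ell.+1) (tR : R -> 'I_ell.+1).
Variables (pL : L -> bool) (pR : R -> bool) (rL : L -> nat) (rR : R -> nat).
Hypothesis rL_inj : forall x y, tL x = tL y -> rL x = rL y -> x = y.
Hypothesis rR_inj : forall x y, tR x = tR y -> rR x = rR y -> x = y.
Variables (M : lmodType k) (E : {ffun 'I_d -> L} -> {ffun 'I_d -> R} -> M).
Variable S : M -> Prop.
Hypothesis S0 : S 0.
Hypothesis SL : forall x v w, S v -> S w -> S (x *: v + w).

(** Straighten the left factor, then the right one, by induction on the potential;
    the contraction is symmetric in its two factors. *)
Lemma standard_span :
  (forall (lam : multipart ell n d) u w,
    let b := block_word lam in let c := col_word lam in
    standard_word pL rL b c u -> compat tL u b -> good (bsign pL) (zipw u b) ->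
    standard_word pR rR b c w -> compat tR w b -> good (bsign pR) (zipw w b) ->
    S (prodE E (orb k (bsign pL) (zipw u b)) (orb k (bsign pR) (zipw w b)))) ->
  forall (b : {ffun 'I_d -> Bk}) F H,
    supported tL pL F b -> supported tR pR H b -> S (prodE E F H).
Proof.
move=> Sstd b F H sF sH; pose N := (#|{: Bk}| * 2 ^ d)%N.
move: (ltnSn (N - potential b)); move: {2}(N - potential b).+1%N => m.
elim: m b F H sF sH => // m IH b F H sF sH bm.
have [lam [g [s [[h gK hK] tg eb]]]] := multipart_of_word b.
have hb : bijective h by exists g.
have gb : bijective g by exists h.
pose bl := block_word lam.
have pot_bl : potential bl = potential b.
  by rewrite /bl eb potential_act potential_relabel.
have IH' (b1 : {ffun 'I_d -> Bk}) F1 H1 : (potential bl < potential b1)%N -> supported tL pL F1 b1 ->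
    supported tR pR H1 b1 -> S (prodE E F1 H1).
  move=> pot sF1 sH1; apply: (IH b1 F1 H1 sF1 sH1).
  by have := potential_bound b1; rewrite -/N; move: bm; rewrite -pot_bl; lia.
have sF' := supported_relabel gK hK tg eb sF.
have sH' := supported_relabel gK hK tg eb sH.
have sh := shape_multipart lam.
rewrite -(prodE_relabel E F H hb).
apply: (straighten_left char0 rL_inj d_le_n S0 SL sh sH' IH') (sF') => u su cu gu.
rewrite prodEC.
have sO := supported_orb k gu cu.
apply: (straighten_left char0 rR_inj d_le_n S0 SL sh sO) sH' => [b1 F1 H1 pot s1 s2|w sw cw gw].
  by rewrite prodEC; apply: IH' pot s2 s1.
by rewrite prodEC; apply: Sstd.
Qed.

End TwoSided.
End StandardSpan.

(** * Standard products are independent *)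

Section Independence.
Variables (k : idomainType) (d n ell : nat).
Hypothesis char0 : [pchar k] =i pred0.
Local Notation Bk := ('I_ell.+1 * 'I_n)%type.
Local Notation WB := {ffun 'I_d -> Bk}.

Lemma eq_oppr0 (x : k) : x = - x -> x = 0.
Proof.
move=> /eqP; rewrite -addr_eq0 -mulr2n -mulr_natl mulf_eq0 => /orP[|/eqP //].
by have /pcharf0P -> := char0.
Qed.

Section Columns.
Variables (b0 : WB) (c0 : {ffun 'I_d -> nat}).
Hypothesis shape0 : shape b0 c0.

Definition column (j : 'I_d) : 'I_ell.+1 * nat := ((b0 j).1, c0 j).

Lemma column_key_inj i j : column i = column j -> (b0 i).2 = (b0 j).2 :> nat -> i = j.
Proof.
move=> [t c] /ord_inj r; apply: (shape_inj shape0) => //.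
by rewrite [b0 i]surjective_pairing [b0 j]surjective_pairing t r.
Qed.

Lemma increasing_column_ge (f : 'I_d -> nat) :
  (forall i j, column i = column j -> ((b0 i).2 < (b0 j).2)%N -> (f i < f j)%N) ->
  forall j, ((b0 j).2 <= f j)%N.
Proof.
move=> mono; suff H m j : ((b0 j).2 <= m)%N -> ((b0 j).2 <= f j)%N.
  by move=> j; apply: (H (b0 j).2).
elim: m j => [|m IH] j; first by rewrite leqn0 => /eqP ->.
case e : ((b0 j).2 : nat) => [|p] // pm.
have [|i [ti ri ci]] := shape_col shape0 (j := j) (x := p); first by rewrite e.
have ip : (p <= f i)%N by rewrite -ri; apply: IH; rewrite ri.
by apply: leq_ltn_trans ip _; apply: mono; rewrite /column ?ti ?ci // ri e.
Qed.

(** Once each column is sorted, the row labels strictly increase down it, so the one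
    in row [r] is at least [r]; if the sums agree it is equal to [r]. *)
Lemma column_distinct_rows (b : WB) : (forall j, (b j).1 = (b0 j).1) ->
  (forall i j, column i = column j -> b i = b j -> i = j) ->
  (\sum_j (b0 j).2 <= \sum_j (b j).2)%N /\
  ((\sum_j (b j).2 = \sum_j (b0 j).2)%N ->
   exists2 s, class_perm column s & b = word_act b0 s).
Proof.
move=> tb inj; have [s hs srt] := class_sort column (fun j => (b0 j).2 : nat) (fun j => (b j).2 : nat).
have tcol i j : column i = column j -> (b i).1 = (b j).1.
  by move=> [t _]; rewrite !tb.
have ge : forall j, ((b0 j).2 <= (b (s j)).2)%N.
  apply: increasing_column_ge => i j cij lt.
  rewrite ltn_neqAle srt // andbT; apply/eqP => /ord_inj e.
  have csij : column (s i) = column (s j) by rewrite !hs.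
  have /perm_inj eij : s i = s j.
    apply: inj => //; rewrite [b (s i)]surjective_pairing [b (s j)]surjective_pairing e.
    by rewrite (tcol _ _ csij).
  by rewrite eij ltnn in lt.
have sE : (\sum_j (b j).2 = \sum_j (b (s j)).2)%N by rewrite (reindex_inj (@perm_inj _ s)).
split; first by rewrite sE; apply: leq_sum => j _.
rewrite sE => /esym e; exists s^-1%g; first exact: class_permV.
have ptw j : (b0 j).2 = (b (s j)).2.
  have /leqif_sum H : forall j, true -> ((b0 j).2 <= (b (s j)).2
      ?= iff ((b0 j).2 == (b (s j)).2 :> nat))%N by move=> i _; split.
  by have := H.2; rewrite e eqxx => /esym /forallP /(_ j) /eqP /ord_inj.
apply/ffunP => j; rewrite ffunE [RHS]surjective_pairing ptw permKV -tb.
have cj : column ((s^-1)%g j) = column j by apply: class_permV.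
by rewrite (tcol _ _ cj) -surjective_pairing.
Qed.

Section Half.
Variables (L : finType) (tL : L -> 'I_ell.+1) (pL : L -> bool) (rL : L -> nat).
Hypothesis rL_inj : forall x y, tL x = tL y -> rL x = rL y -> x = y.

Lemma standard_column u i j : standard_word pL rL b0 c0 u -> column i = column j ->
  ((b0 i).2 < (b0 j).2)%N -> (rL (u i) <= rL (u j))%N && ((u i == u j) ==> pL (u i)).
Proof.
by move=> /forallP /(_ i) /forallP /(_ j) /andP[_ /implyP h] [t c] lt; apply: h;
  rewrite t c !eqxx.
Qed.

Lemma standard_row u i j : standard_word pL rL b0 c0 u -> b0 i = b0 j ->
  (c0 i < c0 j)%N -> (rL (u i) <= rL (u j))%N.
Proof.
move=> /forallP /(_ i) /forallP /(_ j) /andP[/implyP h _] b c.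
by have /h/andP[] : (b0 i == b0 j) && (c0 i < c0 j)%N by rewrite b eqxx c.
Qed.

Lemma standard_moment u s : standard_word pL rL b0 c0 u -> compat tL u b0 ->
  class_perm column s ->
  (rank_moment rL b0 (word_act u s) <= rank_moment rL b0 u)%N /\
  (rank_moment rL b0 (word_act u s) = rank_moment rL b0 u -> word_act u s = u).
Proof.
move=> st cu hs.
have srt : class_sorted column (fun j => (b0 j).2 : nat) (fun j => rL (u j)).
  by move=> i j cij lt; case/andP: (standard_column st cij lt).
have [le eqm] := rearrangement column_key_inj hs srt.
have mE : rank_moment rL b0 (word_act u s) = (\sum_j (b0 j).2 * rL (u (s j)))%N.
  by apply: eq_bigr => j _; rewrite ffunE.
rewrite mE; split=> // /eqm h; apply/ffunP => j; rewrite ffunE; apply: rL_inj => //.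
by rewrite !cu; have [] := hs j.
Qed.

Lemma standard_unique u v s : standard_word pL rL b0 c0 u -> standard_word pL rL b0 c0 v ->
  compat tL u b0 -> zipw v b0 = word_act (zipw u b0) s -> v = u.
Proof.
move=> su sv cu; rewrite zipw_act => /zipw_inj[vu bs].
have hs : class_perm b0 s by move=> j; rewrite [in RHS]bs ffunE.
have s1 : class_sorted b0 c0 (fun j => rL (u j)) by move=> i j; exact: standard_row.
have s2 : class_sorted b0 c0 ((fun j => rL (u j)) \o s).
  by move=> i j bij cij; have := standard_row sv bij cij; rewrite vu !ffunE.
have := class_sorted_unique (shape_inj shape0) hs s1 s2.
move=> h; rewrite vu; apply/ffunP => j; rewrite ffunE; apply: rL_inj => //.
by rewrite !cu hs.
Qed.

(** Equal letters of a standard word in one column are odd, so a permutation of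
    the columns that fixes the word moves odd letters only. *)
Lemma column_fix_sign u s : standard_word pL rL b0 c0 u -> class_perm column s ->
  word_act u s = u -> psign pL s u = odd_perm s.
Proof.
move=> su hs us; apply: oinv_odd_perm => j; rewrite ffunE => pj; apply/eqP.
apply: contraNT pj => sj; have usj : u (s j) = u j by rewrite -[in RHS]us ffunE.
have [lt|lt|e] := ltngtP (b0 j).2 (b0 (s j)).2.
- by case/andP: (standard_column su (esym (hs j)) lt) => _; rewrite usj eqxx.
- by case/andP: (standard_column su (hs j) lt) => _; rewrite usj eqxx.
by case/eqP: sj; apply: column_key_inj.
Qed.

Definition column_alt (F : kernel k d n ell L) (b : WB) (u : {ffun 'I_d -> L}) : k :=
  \sum_(s : 'S_d | [forall j, column (s j) == column j])
    (-1) ^+ (odd_perm s (+) psign pL s u) * F (zipw (word_act u s) b).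

(** The transposition of two places of a column with equal labels changes the
    antisymmetrizer by a sign only. *)
Lemma column_alt_kill (F : kernel k d n ell L) (b : WB) u i j : sinv (bsign pL) F -> i != j ->
  column i = column j -> b i = b j -> column_alt F b u = 0.
Proof.
move=> iF ij cij bij; apply: eq_oppr0; rewrite {1}/column_alt -sumrN.
rewrite (reindex_inj (@mulgI _ (tperm i j))) /=.
apply: eq_big => [s|s _].
  apply/forallP/forallP => h l; apply/eqP.
    have := h (tperm i j l); rewrite permM tpermK => /eqP ->.
    exact: class_perm_tperm.
  rewrite permM (eqP (h _)); exact: class_perm_tperm.
rewrite odd_permM odd_tperm ij psignM word_actM.
have -> : zipw (word_act (word_act u s) (tperm i j)) b =
    word_act (zipw (word_act u s) b) (tperm i j).
  by rewrite zipw_act (word_act_tperm bij).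
rewrite iF bsign_zipw mulrA -signr_addb -mulNr; congr (_ * _).
by case: (odd_perm s); case: (psign _ _ u); case: (psign _ _ _);
  rewrite /= ?expr0 ?expr1 ?opprK.
Qed.

End Half.
End Columns.

Section TwoSided.
Variables (L R : finType) (tL : L -> 'I_ell.+1) (tR : R -> 'I_ell.+1).
Variables (pL : L -> bool) (pR : R -> bool) (rL : L -> nat) (rR : R -> nat).
Hypothesis rL_inj : forall x y, tL x = tL y -> rL x = rL y -> x = y.
Hypothesis rR_inj : forall x y, tR x = tR y -> rR x = rR y -> x = y.

Section Pair.
Variables (b0 : WB) (c0 : {ffun 'I_d -> nat}).
Hypothesis shape0 : shape b0 c0.
Variables (u0 u1 : {ffun 'I_d -> L}) (w0 w1 : {ffun 'I_d -> R}).
Hypotheses (su0 : standard_word pL rL b0 c0 u0) (su1 : standard_word pL rL b0 c0 u1).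
Hypotheses (cu0 : compat tL u0 b0) (gu1 : good (bsign pL) (zipw u1 b0)).
Hypotheses (sw0 : standard_word pR rR b0 c0 w0) (sw1 : standard_word pR rR b0 c0 w1).
Hypotheses (cw0 : compat tR w0 b0) (gw1 : good (bsign pR) (zipw w1 b0)).
Hypothesis minimal : (rank_moment rL b0 u0 + rank_moment rR b0 w0 <=
  rank_moment rL b0 u1 + rank_moment rR b0 w1)%N.
Local Notation F := (orb k (bsign pL) (zipw u1 b0)).
Local Notation H := (orb k (bsign pR) (zipw w1 b0)).

Lemma orbit_moment (T : finType) (pT : T -> bool) (rT : T -> nat) (u v : {ffun 'I_d -> T}) :
  orb k (bsign pT) (zipw u b0) (zipw v b0) != 0 ->
  rank_moment rT b0 v = rank_moment rT b0 u.
Proof.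
move=> /orb_neq0[s]; rewrite zipw_act => /zipw_inj[-> bs].
rewrite /rank_moment [RHS](reindex_inj (@perm_inj _ s)).
by apply: eq_bigr => j _; rewrite {1}bs !ffunE.
Qed.

(** A surviving term of the column alternation comes from the words themselves:
    moments only decrease under column permutations, and those of the competing
    pair are not smaller. *)
Lemma surviving_term s t :
  class_perm (column b0 c0) s -> class_perm (column b0 c0) t ->
  F (zipw (word_act u0 s) (word_act b0 t)) != 0 ->
  H (zipw w0 (word_act b0 t)) != 0 ->
  [/\ u1 = u0, w1 = w0 &
   (-1) ^+ (odd_perm s (+) psign pL s u0) *
     F (zipw (word_act u0 s) (word_act b0 t)) * H (zipw w0 (word_act b0 t)) = 1].
Proof.
move=> hs ht Fn Hn.
have iF : sinv (bsign pL) F := sinv_orb k (@bsignM d n ell L pL) gu1.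
have iH : sinv (bsign pR) H := sinv_orb k (@bsignM d n ell R pR) gw1.
have shift (T : finType) (v : {ffun 'I_d -> T}) :
    zipw v (word_act b0 t) = word_act (zipw (word_act v t^-1%g) b0) t.
  by rewrite zipw_act word_actKV.
pose r := (t^-1 * s)%g.
have er : word_act (word_act u0 s) t^-1%g = word_act u0 r by rewrite -word_actM.
have hr : class_perm (column b0 c0) r.
  by apply: class_permM => //; apply: class_permV.
have htV := class_permV ht.
move: Fn Hn; rewrite !shift iF iH er !mulf_eq0 !negb_or => /andP[_ Fn] /andP[_ Hn].
have [leL eqL] := standard_moment shape0 rL_inj su0 cu0 hr.
have [leR eqR] := standard_moment shape0 rR_inj sw0 cw0 htV.
have mL := orbit_moment rL Fn; have mR := orbit_moment rR Hn.
have uE : word_act u0 r = u0 by apply: eqL; move: minimal; lia.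
have wE : word_act w0 t^-1%g = w0 by apply: eqR; move: minimal; lia.
rewrite uE in Fn; rewrite wE in Hn.
have [s1 e1] := orb_neq0 Fn; have [s2 e2] := orb_neq0 Hn.
have u10 : u1 = u0.
  apply: (standard_unique shape0 rL_inj (s := s1^-1%g) su0 su1 cu0).
  by rewrite e1 word_actK.
have w10 : w1 = w0.
  apply: (standard_unique shape0 rR_inj (s := s2^-1%g) sw0 sw1 cw0).
  by rewrite e2 word_actK.
have F1 : F (zipw u0 b0) = 1 by rewrite -u10 (orb_id _ (@bsignM d n ell L pL) gu1).
have H1 : H (zipw w0 b0) = 1 by rewrite -w10 (orb_id _ (@bsignM d n ell R pR) gw1).
split=> //; rewrite uE wE F1 H1 !mulr1.
rewrite !bsign_zipw.
have wt : word_act w0 t = w0 by rewrite -{1}wE word_actKV.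
rewrite (column_fix_sign shape0 sw0 ht wt).
have sE : s = (t * r)%g by rewrite mulKVg.
rewrite sE psignM uE (column_fix_sign shape0 su0 hr uE) odd_permM.
rewrite -!signr_addb; case: (odd_perm t); case: (odd_perm r); case: (psign _ _ _) => //=.
Qed.

End Pair.

(** [i0] is an index of the support with the largest row sum and, among those, the
    smallest total moment. After antisymmetrizing along its columns and evaluating
    at its pair of words, every other index contributes 0 and [i0] contributes the
    number of its surviving terms. *)
Lemma standard_independent (m : nat) (lam : 'I_m -> multipart ell n d)
    (u : 'I_m -> {ffun 'I_d -> L}) (w : 'I_m -> {ffun 'I_d -> R}) (x : 'I_m -> k) :
  let b i := block_word (lam i) in let c i := col_word (lam i) in
  (forall i, [/\ standard_word pL rL (b i) (c i) (u i), compat tL (u i) (b i) &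
     good (bsign pL) (zipw (u i) (b i))]) ->
  (forall i, [/\ standard_word pR rR (b i) (c i) (w i), compat tR (w i) (b i) &
     good (bsign pR) (zipw (w i) (b i))]) ->
  (forall i j, lam i = lam j -> u i = u j -> w i = w j -> i = j) ->
  (forall u' w', \sum_i x i * contract (orb k (bsign pL) (zipw (u i) (b i)))
      (orb k (bsign pR) (zipw (w i) (b i))) u' w' = 0) ->
  forall i, x i = 0.
Proof.
move=> b c Hu Hw inj rel i1; apply/eqP; apply: contraT => xi1.
pose rows i := (\sum_j (b i j).2)%N.
case: (@arg_maxnP _ i1 (fun i => x i != 0) rows xi1) => i2 xi2 max2.
pose P i := (x i != 0) && (rows i == rows i2).
have P2 : P i2 by rewrite /P xi2 eqxx.
pose mom i := (rank_moment rL (b i) (u i) + rank_moment rR (b i) (w i))%N.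
case: (@arg_minnP _ i2 P mom P2) => i0 /andP[xi0 /eqP rows0] min0.
have max0 i : x i != 0 -> (rows i <= rows i0)%N by rewrite rows0; exact: max2.
pose b0 := b i0; pose c0 := c i0; pose u0 := u i0; pose w0 := w i0.
pose F i := orb k (bsign pL) (zipw (u i) (b i)).
pose H i := orb k (bsign pR) (zipw (w i) (b i)).
have sh : shape b0 c0 by exact: shape_multipart.
have [su0 cu0 gu0] := Hu i0; have [sw0 cw0 gw0] := Hw i0.
pose col (s : 'S_d) := [forall j, column b0 c0 (s j) == column b0 c0 j].
have colP s : reflect (class_perm (column b0 c0) s) (col s).
  by apply: (iffP forallP) => h j; apply/eqP.
pose T i := \sum_e column_alt b0 c0 pL (F i) e u0 * H i (zipw w0 e).
have sumT : \sum_i x i * T i = 0.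
  transitivity (\sum_(s | col s) (-1) ^+ (odd_perm s (+) psign pL s u0) *
     (\sum_i x i * contract (F i) (H i) (word_act u0 s) w0)).
    under [RHS]eq_bigr do rewrite mulr_sumr.
    rewrite [RHS]exchange_big /=; apply: eq_bigr => i _.
    under [RHS]eq_bigr do rewrite mulrCA.
    rewrite -mulr_sumr; congr (_ * _).
    rewrite /T /contract; under [RHS]eq_bigr do rewrite mulr_sumr.
    rewrite [RHS]exchange_big /=; apply: eq_bigr => e _.
    by rewrite /column_alt mulr_suml; apply: eq_bigr => s _; rewrite mulrA.
  by apply: big1 => s _; rewrite rel mulr0.
(* The row sum of surviving labels is that of [lam i], hence at most that of [b0]
   by the choice of [i0], and at least that because they differ in columns. *)
have surv i e : x i != 0 -> column_alt b0 c0 pL (F i) e u0 * H i (zipw w0 e) != 0 ->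
    lam i = lam i0 /\ exists2 t, col t & e = word_act b0 t.
  move=> xi; rewrite mulf_eq0 negb_or => /andP[Fn Hn].
  have [s1] := orb_neq0 Hn; rewrite zipw_act => /zipw_inj[ws es].
  have [_ cwi _] := Hw i; have [_ _ gui] := Hu i.
  have te j : (e j).1 = (b0 j).1.
    have ws' : w i0 j = w i (s1 j) by rewrite -/w0 ws ffunE.
    have es' : e j = b i (s1 j) by rewrite es; exact: ffunE.
    by rewrite es' -(cw0 j) ws' (cwi (s1 j)).
  have dist p q : column b0 c0 p = column b0 c0 q -> e p = e q -> p = q.
    move=> cpq epq; apply/eqP; apply: contraT => npq; move: Fn.
    rewrite (column_alt_kill u0 (sinv_orb k (@bsignM d n ell L pL) gui) npq cpq epq).
    by rewrite eqxx.
  have [le eqr] := column_distinct_rows sh te dist.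
  have re : (\sum_j (e j).2 = rows i)%N.
    by rewrite /rows [RHS](reindex_inj (@perm_inj _ s1)); apply: eq_bigr => j _; rewrite es ffunE.
  have [t /colP ht et] : exists2 t, class_perm (column b0 c0) t & e = word_act b0 t.
    apply: eqr; apply/eqP; rewrite eqn_leq le andbT re; exact: max0.
  split; last by exists t.
  apply: (multipart_eq (s := (s1^-1 * t)%g)).
  by rewrite word_actM -[block_word (lam i0)]/b0 -et es word_actK.
have term i s t : x i != 0 -> lam i = lam i0 -> col s -> col t ->
    F i (zipw (word_act u0 s) (word_act b0 t)) * H i (zipw w0 (word_act b0 t)) != 0 ->
    i = i0 /\ (-1) ^+ (odd_perm s (+) psign pL s u0) *
     F i (zipw (word_act u0 s) (word_act b0 t)) * H i (zipw w0 (word_act b0 t)) = 1.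
  move=> xi el /colP hs /colP ht; rewrite mulf_eq0 negb_or => /andP[Fn Hn].
  have ebi : b i = b0 by rewrite /b el.
  have eci : c i = c0 by rewrite /c el.
  have [sui cui gui] := Hu i; have [swi cwi gwi] := Hw i.
  rewrite /F /H ebi in Fn Hn *.
  rewrite ebi ?eci in sui gui swi gwi.
  have mini : (rank_moment rL b0 u0 + rank_moment rR b0 w0 <=
     rank_moment rL b0 (u i) + rank_moment rR b0 (w i))%N.
    have Pi : P i by rewrite /P xi -rows0 /rows ebi eqxx.
    by have := min0 i Pi; rewrite /mom ebi.
  have [e1 e2 ->] := surviving_term sh su0 sui cu0 gui sw0 swi cw0 gwi mini hs ht Fn Hn.
  by split=> //; apply: inj.
have T0 i : x i != 0 -> i != i0 -> T i = 0.
  move=> xi ii0; apply: big1 => e _; apply/eqP; apply: contraT => ne.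
  have [el [t ct et]] := surv i e xi ne; case/negP: ne.
  rewrite /column_alt mulr_suml big1 // => s cs; apply/eqP.
  apply: contraT; rewrite -mulrA mulf_eq0 negb_or => /andP[_]; rewrite et => ns.
  by case/eqP: ii0; exact: (term i s t xi el cs ct ns).1.
have Ti0 : T i0 != 0.
  pose conj (e : WB) := [exists t, col t && (e == word_act b0 t)].
  pose N (e : WB) (s : 'S_d) : bool :=
    conj e && (F i0 (zipw (word_act u0 s) e) * H i0 (zipw w0 e) != 0).
  have -> : T i0 = (\sum_e \sum_(s | col s) N e s)%:R.
    rewrite natr_sum; apply: eq_bigr => e _; rewrite natr_sum /N.
    case: (boolP (conj e)) => [/existsP[t /andP[ct /eqP et]]|nc]; last first.
      rewrite big1 //; apply/eqP; apply: contraNT nc => /(surv i0 e xi0)[_ [t ct et]].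
      by apply/existsP; exists t; rewrite ct et eqxx.
    rewrite {1}/column_alt mulr_suml; apply: eq_bigr => s cs /=.
    case: (eqVneq (F i0 (zipw (word_act u0 s) e) * H i0 (zipw w0 e)) 0) => [z|ns].
      by rewrite -mulrA z mulr0.
    by rewrite et in ns *; rewrite (term i0 s t xi0 (erefl _) cs ct ns).2.
  have col1 : col 1%g by apply/colP; exact: class_perm1.
  have /pcharf0P -> := char0; rewrite -lt0n (bigD1 b0) //= (bigD1 1%g) //= /N.
  have -> : conj b0 by apply/existsP; exists 1%g; rewrite col1 word_act1 eqxx.
  rewrite word_act1 (orb_id _ (@bsignM d n ell L pL) gu0) (orb_id _ (@bsignM d n ell R pR) gw0).
  by rewrite mulr1 oner_eq0.
have := sumT; rewrite (bigD1 i0) //= big1 => [|i ii0].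
  by rewrite addr0 => /eqP; rewrite mulf_eq0 (negbTE xi0) (negbTE Ti0).
by case: (eqVneq (x i) 0) => [->|xi]; rewrite ?mul0r // T0 // mulr0.
Qed.

End TwoSided.
End Independence.

(** * Multiplicities of pairs of odd letters *)

Lemma perm_restrict d (A : {set 'I_d}) (s : 'S_d) :
  (forall j, (s j \in A) = (j \in A)) ->
  exists q : 'S_d, forall j, q j = if j \in A then s j else j.
Proof.
move=> sA; have finj : injective (fun j => if j \in A then s j else j).
  move=> i j; case: ifP => iA; case: ifP => jA //; first exact: perm_inj.
    by move=> e; rewrite -e sA iA in jA.
  by move=> e; rewrite e sA jA in iA.
by exists (perm finj) => j; rewrite permE.
Qed.

Section FibrePerms.
Variables (d : nat) (Zt : eqType) (f : 'I_d -> Zt).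

Definition fibre_perms (P : pred Zt) : {set 'S_d} :=
  [set s : 'S_d | [forall j, (f (s j) == f j) && (P (f j) || (s j == j))]]%SET.

Lemma fibre_permsP (P : pred Zt) (s : 'S_d) :
  reflect (forall j, f (s j) = f j /\ (~~ P (f j) -> s j = j)) (s \in fibre_perms P).
Proof.
rewrite inE; apply: (iffP forallP) => h j.
  have /andP[/eqP -> Pj] := h j; split=> // nP; apply/eqP.
  by move: Pj; rewrite (negbTE nP).
have [-> hj] := h j; rewrite eqxx /=; case: (boolP (P (f j))) => //= nP.
by rewrite hj.
Qed.

Lemma fibre_perms_group (P : pred Zt) : group_set (fibre_perms P).
Proof.
apply/group_setP; split; first by apply/fibre_permsP => j; rewrite perm1.
move=> s t /fibre_permsP hs /fibre_permsP ht; apply/fibre_permsP => j.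
have [fs es] := hs j; have [ft et] := ht (s j).
rewrite permM ft fs; split=> // nP; rewrite -{2}(es nP); apply: et.
by rewrite fs.
Qed.

Canonical fibre_perms_groupType P := Group (fibre_perms_group P).

(** Split off the permutations of one fibre. *)
Lemma card_fibre_perms (r : seq Zt) : uniq r ->
  #|fibre_perms (mem r)| = (\prod_(z <- r) (#|[set j | f j == z]%SET|)`!)%N.
Proof.
elim: r => [_|z r IH /= /andP[zr ur]].
  rewrite big_nil; apply/eqP/cards1P; exists 1%g; apply/setP => s; rewrite finset.inE.
  apply/fibre_permsP/eqP => [h|-> j]; last by rewrite perm1.
  by apply/permP => j; rewrite perm1; apply: (h j).2.
rewrite big_cons -(IH ur); pose A := [set j | f j == z]%SET.
have -> : (#|A|)`! = #|[set p : 'S_d | perm_on A p]%SET|.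
  by rewrite -card_perm; apply: eq_card => p; rewrite inE.
rewrite -cardsX.
pose h (p : 'S_d * 'S_d) := (p.1 * p.2)%g.
have mul_on p q j : perm_on A p -> q \in fibre_perms (mem r) ->
    (p * q)%g j = if j \in A then p j else q j.
  move=> onp /fibre_permsP hq; rewrite permM; case: ifP => jA; last first.
    by rewrite (out_perm onp) ?jA.
  apply: (hq (p j)).2; have : p j \in A by rewrite perm_closed.
  by rewrite inE => /eqP ->.
have hinj : {in finset.setX [set p | perm_on A p]%SET (fibre_perms (mem r)) &, injective h}.
  move=> [p q] [p' q']; rewrite !finset.in_setX !finset.in_set => /andP[onp hq] /andP[onp' hq'] e.
  have pp : p = p'.
    apply/permP => j; case: (boolP (j \in A)) => jA; last by rewrite !(out_perm _ jA).
    have := congr1 (fun s : 'S_d => s j) e.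
    by rewrite /h /= (mul_on p q) ?(mul_on p' q') ?jA // finset.in_set.
  by congr pair => //; move: e; rewrite /h /= pp; exact: mulgI.
rewrite -(card_in_imset hinj); apply: eq_card => s.
apply/idP/imsetP => [hs|[[p q]]]; last first.
  rewrite finset.in_setX finset.in_set => /andP[/= onp hq] ->; apply/fibre_permsP => j.
  have mE := mul_on p q j onp hq; rewrite /h /= mE.
  move/fibre_permsP: hq => hq; case: ifP => jA.
    have : p j \in A by rewrite perm_closed.
    move: jA; rewrite !inE => /eqP -> /eqP ->; split=> //.
    by rewrite /= ?inE ?eqxx.
  have [-> qj] := hq j; split=> //= nr; apply: qj; apply: contra nr => /= fr.
  by rewrite inE fr orbT.
move/fibre_permsP: hs => hs.
have [|p pE'] := @perm_restrict d A s; first by move=> j; rewrite !inE (hs j).1.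
have onp : perm_on A p.
  by apply/fintype.subsetP => j; rewrite inE pE'; case: ifP => //; rewrite eqxx.
have pE j : j \in A -> p j = s j by move=> jA; rewrite pE' jA.
exists (p, (p^-1 * s)%g); last by rewrite /h /= mulKVg.
rewrite finset.in_setX finset.in_set onp /=; apply/fibre_permsP => j.
rewrite permM; case: (boolP (j \in A)) => jA.
  have iA : (p^-1)%g j \in A by rewrite -(perm_closed _ onp) permKV.
  by rewrite -pE // permKV.
have -> : (p^-1)%g j = j by apply: (@perm_inj _ p); rewrite permKV (out_perm onp jA).
have [-> sj] := hs j; split=> // nr; apply: sj; rewrite inE negb_or; apply/andP; split=> //.
by move: jA; rewrite inE.
Qed.

End FibrePerms.

Section PairKernels.
Variables (k : idomainType) (d n ell : nat).
Hypothesis char0 : [pchar k] =i pred0.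
Hypothesis d_le_n : (d <= n)%N.
Local Notation Bk := ('I_ell.+1 * 'I_n)%type.
Local Notation WB := {ffun 'I_d -> Bk}.

(** Every orbit that meets the support has [#|Q|] points and a constant value. *)
Lemma free_orbit_sum (Q : {group 'S_d}) (f : WB -> k) :
  (forall b s, s \in Q -> f (word_act b s) = f b) ->
  (forall b s, f b != 0 -> s \in Q -> word_act b s = b -> s = 1%g) ->
  exists x, \sum_b f b = #|Q|%:R * x.
Proof.
move: {2}(#|_|) (leqnn #|[set b | f b != 0]%SET|) => m.
elim: m f => [|m IH] f.
  rewrite leqn0 cards_eq0 => /eqP/setP f0 _ _; exists 0; rewrite mulr0 big1 // => b _.
  by have := f0 b; rewrite !inE => /negbT/negPn/eqP.
move=> fm inv fr; case: (boolP [exists b, f b != 0]) => [/existsP[b fb]|f0]; last first.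
  exists 0; rewrite mulr0 big1 // => b _; apply/eqP; move: f0.
  by rewrite negb_exists => /forallP /(_ b) /negPn.
pose O := [set word_act b s | s in Q]%SET.
have Oact c s : s \in Q -> (word_act c s \in O) = (c \in O).
  move=> sQ; apply/imsetP/imsetP => -[t tQ e].
    exists (s^-1 * t)%g; first by rewrite groupM ?groupV.
    by rewrite word_actM -e word_actK.
  by exists (s * t)%g; rewrite ?groupM // word_actM e.
pose f' c := if c \in O then 0 else f c.
have [|||x ex] := IH f'.
- rewrite -ltnS; apply: leq_trans fm; apply: proper_card; apply/properP; split.
    by apply/fintype.subsetP => c; rewrite !inE /f'; case: ifP => //; rewrite eqxx.
  exists b; rewrite !inE ?fb // /f'; have -> : b \in O; last by rewrite eqxx.
  by apply/imsetP; exists 1%g; rewrite ?group1 ?word_act1.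
- by move=> c s sQ; rewrite /f' Oact // inv.
- by move=> c s; rewrite /f'; case: ifP => [|_]; [rewrite eqxx|exact: fr].
exists (f b + x); rewrite mulrDr -ex (bigID (mem O)) /=; congr (_ + _); last first.
  by rewrite big_mkcond; apply: eq_bigr => c _; rewrite /f'; case: (c \in O).
rewrite big_imset /=; last first.
  move=> s t sQ tQ e; apply/eqP; rewrite eq_mulgV1; apply/eqP.
  have h : (t^-1 * s)%g = 1%g.
    apply: (fr b) => //; first by rewrite groupM ?groupV.
    by rewrite word_actM e word_actK.
  by rewrite -[s](mulKVg t) h mulg1 mulgV.
rewrite (eq_bigr (fun=> f b)) => [|s sQ]; last exact: inv.
by rewrite sumr_const mulr_natl.
Qed.

Variables (L R : finType) (tL : L -> 'I_ell.+1) (tR : R -> 'I_ell.+1).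
Variables (pL : L -> bool) (pR : R -> bool).

Definition pair_sign (s : 'S_d) (z : {ffun 'I_d -> L * R}) : bool :=
  psign (fun x : L * R => pL x.1) s z (+) psign (fun x : L * R => pR x.2) s z.

Lemma pair_signM s t z :
  pair_sign (s * t)%g z = pair_sign t z (+) pair_sign s (word_act z t).
Proof. by rewrite /pair_sign !psignM; do 4!case: (psign _ _ _). Qed.

Lemma pair_sign_zipw s u w : pair_sign s (zipw u w) = psign pL s u (+) psign pR s w.
Proof.
by congr addb; rewrite /psign; congr oinv; apply/ffunP => j; rewrite !ffunE.
Qed.

Lemma psign_tperm (Z : finType) (p : Z -> bool) (z : {ffun 'I_d -> Z}) i j :
  i != j -> z i = z j -> psign p (tperm i j) z = p (z i).
Proof.
move=> ij zij; case: (boolP (p (z i))) => pz.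
  by rewrite /psign oinv_tperm // ffunE // -zij.
apply: oinv_fix_odd => l; rewrite ffunE => pl; rewrite tpermD //.
  by apply: contraNneq pz => ->.
by apply: contraNneq pz => e; rewrite zij e.
Qed.

(** On the stabilizer the two signs multiply to the sign of the word of pairs, where
    an even pair contributes nothing. *)
Lemma pair_goodP u w : good pair_sign (zipw u w) <->
  (forall i j, i != j -> u i = u j -> w i = w j -> pL (u i) = pR (w i)).
Proof.
split=> [g i j ij uij wij|v s].
  have := g (tperm i j); rewrite zipw_act !word_act_tperm // => /(_ erefl).
  by rewrite pair_sign_zipw !psign_tperm //; case: (pL _); case: (pR _).
rewrite zipw_act pair_sign_zipw => /zipw_inj[us ws].
have := oinv_addw s (parw pL u) (parw pR w).
rewrite -!parw_act us ws addbb addbF => <-.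
apply: oinv_fix_odd => j; rewrite !ffunE => odd; apply/eqP; apply: contraT => sj.
have us' : u (s j) = u j by rewrite -[in RHS]us ffunE.
have ws' : w (s j) = w j by rewrite -[in RHS]ws ffunE.
by have := v (s j) j sj us' ws'; rewrite us' ws' => e; rewrite e addbb in odd.
Qed.

Definition odd_pair_perms u w : {group 'S_d} :=
  [group of fibre_perms (zipw u w) (fun x : L * R => pL x.1 && pR x.2)].

Lemma odd_pair_permsP u w (s : 'S_d) : reflect
  [/\ word_act u s = u, word_act w s = w &
      forall j, ~~ (pL (u j) && pR (w j)) -> s j = j] (s \in odd_pair_perms u w).
Proof.
apply: (iffP (fibre_permsP _ _ _)) => [h|[us ws h] j].
  split=> [||j nj].
  - by apply/ffunP => j; have := (h j).1; rewrite !ffunE => -[].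
  - by apply/ffunP => j; have := (h j).1; rewrite !ffunE => -[].
  - by apply: (h j).2; rewrite ffunE.
have us' : u (s j) = u j by rewrite -[in RHS]us ffunE.
have ws' : w (s j) = w j by rewrite -[in RHS]ws ffunE.
by rewrite !ffunE us' ws'; split=> // /h.
Qed.

Lemma odd_pair_sign u w s : s \in odd_pair_perms u w ->
  psign pL s u = odd_perm s /\ psign pR s w = odd_perm s.
Proof.
move=> /odd_pair_permsP[_ _ h]; split; apply: oinv_odd_perm => j; rewrite ffunE => pj.
  by apply: h; rewrite (negbTE pj).
by apply: h; rewrite (negbTE pj) andbF.
Qed.

(** The permutations of equal odd pairs act on the block labels of a product;
    equal odd letters carry distinct labels, so the action is free on the
    support. *)
Lemma contract_divisible (F : kernel k d n ell L) (H : kernel k d n ell R) u w :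
  sinv (bsign pL) F -> sinv (bsign pR) H ->
  exists x, contract F H u w = #|odd_pair_perms u w|%:R * x.
Proof.
move=> iF iH; apply: free_orbit_sum => b s => [hs|fb hs]; have [us ws h] := odd_pair_permsP _ _ _ hs.
  have [sL sR] := odd_pair_sign hs.
  rewrite -{1}us -{1}ws -!zipw_act iF iH !bsign_zipw sL sR mulrACA -signr_addb addbb.
  by rewrite mul1r.
move: fb; rewrite mulf_eq0 negb_or => /andP[Fb _] bs.
have gF := (bgoodP pL u b).1 (sinv_good char0 iF Fb).
apply/permP => j; rewrite perm1; apply/eqP; apply: contraT => sj.
have us' : u (s j) = u j by rewrite -[in RHS]us ffunE.
have bs' : b (s j) = b j by rewrite -[in RHS]bs ffunE.
have := gF _ _ sj us' bs'; rewrite us' => npj.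
by case/eqP: sj; apply: h; rewrite (negbTE npj).
Qed.

Lemma contract_act (F : kernel k d n ell L) (H : kernel k d n ell R) u w s :
  sinv (bsign pL) F -> sinv (bsign pR) H ->
  contract F H (word_act u s) (word_act w s) =
  (-1) ^+ pair_sign s (zipw u w) * contract F H u w.
Proof.
move=> iF iH; rewrite /contract (reindex_word_act s) mulr_sumr.
apply: eq_bigr => b _; rewrite -!zipw_act iF iH !bsign_zipw pair_sign_zipw signr_addb.
by rewrite mulrACA.
Qed.

(** Let places with the same even right letter share a label and give all other
    places labels of their own. Then the only freedom in the product is to permute
    the labels of equal odd pairs, which contributes their factorials. *)
Lemma monomial_product u w : good pair_sign (zipw u w) ->
  (forall j, tL (u j) = tR (w j)) ->
  exists b : WB, [/\ compat tL u b, compat tR w b,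
    good (bsign pL) (zipw u b), good (bsign pR) (zipw w b) &
    forall u' w', contract (orb k (bsign pL) (zipw u b)) (orb k (bsign pR) (zipw w b)) u' w' =
      #|odd_pair_perms u w|%:R * orb k pair_sign (zipw u w) (zipw u' w')].
Proof.
move=> guw tuw; have guwP := (pair_goodP u w).1 guw.
pose rep (j : 'I_d) : 'I_d := if pR (w j) then j else odflt j [pick i | w i == w j].
have wrep j : w (rep j) = w j.
  rewrite /rep; case: ifP => // _; case: pickP => [i /eqP //|_]; by [].
have repE i j : rep i = rep j -> w i = w j /\ (pR (w i) -> i = j).
  move=> e; have wij : w i = w j by rewrite -wrep e wrep.
  by split=> // pw; move: e; rewrite /rep -wij pw.
have repS i j : w i = w j -> ~~ pR (w i) -> rep i = rep j.
  move=> wij npw; rewrite /rep -wij (negbTE npw).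
  case: pickP => // none; have := none i; by rewrite eqxx.
pose b : WB := [ffun j => (tL (u j), widen_ord d_le_n (rep j))].
have bE i j : b i = b j -> w i = w j /\ (pR (w i) -> i = j).
  by rewrite !ffunE => -[_ e]; apply: repE; exact: val_inj.
have bS i j : w i = w j -> ~~ pR (w i) -> b i = b j.
  by move=> wij npw; rewrite !ffunE (repS i j) // !tuw wij.
have cu : compat tL u b by move=> j; rewrite ffunE.
have cw : compat tR w b by move=> j; rewrite ffunE -tuw.
have gu : good (bsign pL) (zipw u b).
  apply/bgoodP => i j ij uij /bE[wij nij]; rewrite (guwP i j ij uij wij).
  by apply/negP => /nij e; rewrite e eqxx in ij.
have gw : good (bsign pR) (zipw w b).
  apply/bgoodP => i j ij wij /bE[_ nij].
  by apply/negP => /nij e; rewrite e eqxx in ij.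
exists b; split=> //.
pose F := orb k (bsign pL) (zipw u b); pose H := orb k (bsign pR) (zipw w b).
have iF : sinv (bsign pL) F := sinv_orb k (@bsignM d n ell L pL) gu.
have iH : sinv (bsign pR) H := sinv_orb k (@bsignM d n ell R pR) gw.
(* Places with equal labels carry equal letters of [w]. *)
have same s t : word_act b s = word_act b t -> word_act w s = word_act w t.
  move=> /ffunP e; apply/ffunP => j; rewrite !ffunE; apply: (bE _ _ _).1.
  by have := e j; rewrite !ffunE.
have supp u' w' c : F (zipw u' c) != 0 -> H (zipw w' c) != 0 ->
    exists s, [/\ u' = word_act u s, w' = word_act w s & c = word_act b s].
  move=> /orb_neq0[s]; rewrite zipw_act => /zipw_inj[us cs].
  move=> /orb_neq0[t]; rewrite zipw_act => /zipw_inj[wt ct].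
  by exists s; split=> //; rewrite wt; apply: same; rewrite -ct.
have diag : contract F H u w = #|odd_pair_perms u w|%:R.
  have terms c : F (zipw u c) * H (zipw w c) =
      (c \in [set word_act b s | s in odd_pair_perms u w]%SET)%:R.
    case: imsetP => [[s hs ->]|none].
      have [us ws _] := odd_pair_permsP _ _ _ hs; have [sL sR] := odd_pair_sign hs.
      rewrite -{1}us -{1}ws -!zipw_act iF iH !bsign_zipw sL sR.
      rewrite (orb_id _ (@bsignM d n ell L pL) gu) (orb_id _ (@bsignM d n ell R pR) gw).
      by rewrite !mulr1 -signr_addb addbb.
    apply/eqP; apply: contraT; rewrite mulf_eq0 negb_or => /andP[Fc Hc].
    have [s [us ws cs]] := supp u w c Fc Hc; case: none.
    pose D := [set j | pL (u j) && pR (w j)]%SET.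
    have us' j : u (s j) = u j by rewrite [in RHS]us ffunE.
    have ws' j : w (s j) = w j by rewrite [in RHS]ws ffunE.
    have [|q qE'] := @perm_restrict d D s; first by move=> j; rewrite !inE us' ws'.
    have qnD j : j \notin D -> q j = j by move=> jD; rewrite qE' (negbTE jD).
    have qE j : q j = s j \/ q j = j /\ j \notin D.
      by rewrite qE'; case: ifP => jD; [left|right].
    exists q.
      apply/odd_pair_permsP; split=> [||j nj]; last by apply: qnD; rewrite inE.
        by apply/ffunP => j; rewrite ffunE; case: (qE j) => [->|[-> _]].
      by apply/ffunP => j; rewrite ffunE; case: (qE j) => [->|[-> _]].
    rewrite cs; apply/ffunP => j; rewrite !(ffunE (fun _ => b _)).
    case: (qE j) => [-> //|[-> nD]]; case: (boolP (pR (w j))) => pw; last first.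
      by apply: bS; rewrite ?ws'.
    have npu : ~~ pL (u j) by move: nD; rewrite inE pw andbT.
    have -> : s j = j; last by [].
    apply/eqP; apply: contraT => sj; have := guwP _ _ sj (us' j) (ws' j).
    by rewrite us' ws' pw (negbTE npu).
  rewrite /contract; under eq_bigr do rewrite terms.
  rewrite -natr_sum; congr (_%:R).
  rewrite -big_mkcond /= sum1_card card_in_imset // => s t hs ht e.
  have [us ws hsf] := odd_pair_permsP _ _ _ hs; have [ut wt htf] := odd_pair_permsP _ _ _ ht.
  apply/permP => j; case: (boolP (pL (u j) && pR (w j))) => pj; last by rewrite hsf ?htf.
  have /bE[_] : b (s j) = b (t j) by have := congr1 (fun c : WB => c j) e; rewrite !(ffunE (fun _ => b _)).
  apply; have -> : w (s j) = w j by rewrite -[in RHS]ws ffunE.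
  by case/andP: pj.
move=> u' w'; case: (eqVneq (orb k pair_sign (zipw u w) (zipw u' w')) 0) => [o0|/orb_neq0[s]].
  rewrite o0 mulr0; apply: big1 => c _; apply/eqP; apply: contraT.
  rewrite mulf_eq0 negb_or => /andP[Fc Hc].
  have [s [us ws _]] := supp u' w' c Fc Hc; move: o0.
  by rewrite us ws -zipw_act (orbE _ pair_signM) // => /eqP; rewrite signr_eq0.
rewrite zipw_act => /zipw_inj[-> ->]; rewrite -zipw_act (orbE _ pair_signM) //.
by rewrite -/F -/H contract_act // diag mulrC.
Qed.

End PairKernels.

(** * Homogeneous elements and matrix units *)

Section Homogeneous.
Variables (R : comNzRingType) (A : gsAlg R).

Lemma parity_part_comp p (a : A) eps : gs_comp p a = a ->
  parity_part eps a = if p.2 == eps then a else 0.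
Proof.
move=> ha; rewrite (@parity_partE _ _ eps a [:: p]) // ?big_seq1 ?ha //.
by rewrite big_cons big_nil; case: ifP => _; rewrite ?addr0.
Qed.

Lemma gs_odd_comp p (a : A) : gs_comp p a = a -> a != 0 -> gs_odd a = p.2.
Proof.
move=> ha a0; rewrite /gs_odd (parity_part_comp true ha).
by case: p.2; rewrite ?eqxx // eq_sym (negbTE a0).
Qed.

Lemma gs_even_odd (a : A) : homogeneous a -> a != 0 -> gs_even a = ~~ gs_odd a.
Proof.
move=> [p ha] a0; rewrite (gs_odd_comp ha a0) /gs_even (parity_part_comp false ha).
by case: p.2; rewrite ?eqxx // eq_sym (negbTE a0).
Qed.

Lemma gs_mul_homogeneous (a b : A) : homogeneous a -> homogeneous b ->
  homogeneous (gs_mul a b).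
Proof. by move=> [p ha] [q hb]; exists (p.1 + q.1, p.2 (+) q.2); apply: gs_mul_graded. Qed.

Lemma gs_odd_mul (a b : A) : homogeneous a -> homogeneous b -> gs_mul a b != 0 ->
  gs_odd (gs_mul a b) = gs_odd a (+) gs_odd b.
Proof.
move=> [p ha] [q hb] ab0.
have a0 : a != 0 by apply: contraNneq ab0 => ->; rewrite gs_mul0l.
have b0 : b != 0 by apply: contraNneq ab0 => ->; rewrite gs_mul0r.
rewrite (gs_odd_comp ha a0) (gs_odd_comp hb b0).
by rewrite (gs_odd_comp (gs_mul_graded ha hb) ab0).
Qed.

End Homogeneous.

Section MatrixUnits.
Variables (R : comNzRingType) (A : gsAlg R) (n : nat).

Lemma xi1E (a : A) (r s i j : 'I_n) :
  (xi1 a r s : 'M[A]_n) i j = if (i == r) && (j == s) then a else 0.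
Proof. by rewrite mxE. Qed.

Lemma parity_part_xi1 (a : A) (r s : 'I_n) : homogeneous a -> a != 0 ->
  parity_part (gs_odd a) (xi1 a r s) = xi1 a r s.
Proof.
move=> [p ha] a0; rewrite (gs_odd_comp ha a0).
have hx : gs_comp p (xi1 a r s) = xi1 a r s.
  apply/matrixP => i j; rewrite [LHS]mxE !xi1E.
  by case: ifP => _ //; rewrite gs_comp0.
by rewrite (parity_part_comp (A := mx_gsAlg A n) _ hx) eqxx.
Qed.

Lemma gs_mul_xi1 (a b : A) (r s s' t : 'I_n) :
  gs_mul (xi1 a r s) (xi1 b s' t) = if s == s' then xi1 (gs_mul a b) r t else 0.
Proof.
apply/matrixP => i j; rewrite [LHS]mxE.
rewrite (bigD1 s) //= big1 => [|q qs]; last first.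
  by rewrite xi1E (negbTE qs) andbF gs_mul0l.
rewrite addr0 !xi1E eqxx andbT; case: (eqVneq s s') => [_|ss]; last first.
  by rewrite gs_mul0r mxE.
rewrite xi1E; case: ifP => ir; case: ifP => jt /=; rewrite ?gs_mul0l ?gs_mul0r //.
Qed.

End MatrixUnits.

(** * Spans *)

Section Spans.
Variables (R : comNzRingType) (V : lmodType R) (P : V -> Prop).

Lemma span0 : Defs.span P 0.
Proof.
exists 0%N, (fun=> 0), (fun=> 0); split; first by case.
by rewrite big_ord0.
Qed.

Lemma span_gen v : P v -> Defs.span P v.
Proof.
by move=> Pv; exists 1%N, (fun=> 1), (fun=> v); split=> //; rewrite big_ord1 scale1r.
Qed.

Lemma span_closed x v w : Defs.span P v -> Defs.span P w -> Defs.span P (x *: v + w).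
Proof.
move=> [m [c [f [Pf ->]]]] [m' [c' [f' [Pf' ->]]]].
exists (m + m')%N, (fun i => match split i with inl j => x * c j | inr j => c' j end),
  (fun i => match split i with inl j => f j | inr j => f' j end); split.
  by move=> i; case: (split i).
rewrite big_split_ord scaler_sumr; congr (_ + _); apply: eq_bigr => i _.
  by rewrite (unsplitK (inl i)) scalerA.
by rewrite (unsplitK (inr i)).
Qed.

Lemma span_ind (Q : V -> Prop) :
  Q 0 -> (forall x v w, Q v -> Q w -> Q (x *: v + w)) ->
  (forall v, P v -> Q v) -> forall v, Defs.span P v -> Q v.
Proof.
move=> Q0 QL QP v [m [c [f [Pf ->]]]].
elim: m c f Pf => [|m IH] c f Pf; first by rewrite big_ord0.
by rewrite big_ord_recl; apply: QL; [apply: QP | apply: IH].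
Qed.

End Spans.

(** * Consequences of the heredity axioms *)

Section Heredity.
Variables (k : idomainType) (A : gsAlg k) (ell : nat) (le : rel 'I_ell.+1).
Variables (X Y : 'I_ell.+1 -> {fset A}) (e : 'I_ell.+1 -> A).
Hypothesis hd : heredity_data (fun _ : A => True) le X Y e.

Local Notation pairs := {i : 'I_ell.+1 & (X i * Y i)%type}.

Definition hpair i x y (xX : x \in X i) (yY : y \in Y i) : pairs :=
  Tagged (fun i => (X i * Y i)%type) ([` xX]%fset, [` yY]%fset).

Lemma heredity_prod_neq0 (p : pairs) : heredity_prod p != 0.
Proof.
apply/eqP => p0; have [li _] := hd_basis hd.
have inj1 : injective (fun _ : 'I_1 => p) by move=> i j; rewrite !ord1.
have sum1 : \sum_(i < 1) 1 *: heredity_prod p = 0 by rewrite big_ord1 p0 scaler0.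
by have /eqP := li 1%N (fun=> p) (fun=> 1) inj1 sum1 ord0; rewrite oner_eq0.
Qed.

Lemma heredity_prod_inj : injective (@heredity_prod _ A ell X Y).
Proof.
move=> p q pq; apply/eqP; apply: contraT => npq; have [li _] := hd_basis hd.
pose j (i : 'I_2) := if i == ord0 then p else q.
have jinj : injective j.
  move=> a b; rewrite /j; case: (eqVneq a ord0) => [->|na]; case: (eqVneq b ord0) => [->|nb] //.
  - by move=> epq; rewrite epq eqxx in npq.
  - by move=> epq; rewrite epq eqxx in npq.
  - by move=> _; apply/val_inj; move: na nb; rewrite -!val_eqE; case: a b => [[|[|a]] ?] [[|[|b]] ?].
pose c (i : 'I_2) : k := if i == ord0 then 1 else -1.
have sum2 : \sum_(i < 2) c i *: heredity_prod (j i) = 0.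
  by rewrite !big_ord_recl big_ord0 /j /c /= pq scale1r scaleN1r addr0 subrr.
by have /eqP := li 2%N j c jinj sum2 ord0; rewrite /c eqxx oner_eq0.
Qed.

Lemma X_neq0 i x : x \in X i -> x != 0.
Proof.
move=> xX; have := heredity_prod_neq0 (hpair xX (hd_e hd i).2).
by rewrite /heredity_prod /= (hd_xe hd xX).
Qed.

Lemma Y_neq0 i y : y \in Y i -> y != 0.
Proof.
move=> yY; have := heredity_prod_neq0 (hpair (hd_e hd i).1 yY).
by rewrite /heredity_prod /= (hd_ey hd yY).
Qed.

Lemma X_tag i j x : x \in X i -> x \in X j -> i = j.
Proof.
move=> xi xj; apply/eqP; apply: contraT => /(hd_X_disj hd) /fdisjointP /(_ x xi).
by rewrite xj.
Qed.

Lemma Y_tag i j y : y \in Y i -> y \in Y j -> i = j.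
Proof.
move=> yi yj; apply/eqP; apply: contraT => /(hd_Y_disj hd) /fdisjointP /(_ y yi).
by rewrite yj.
Qed.

(** The product of [e i] and [e j] is 0 or equal to both of them, and these differ
    because [X i] and [X j] are disjoint. *)
Lemma heredity_orthogonal i j x y : i != j -> x \in X i -> y \in Y j -> gs_mul x y = 0.
Proof.
move=> ij xX yY; rewrite -(hd_xe hd xX) -(hd_ey hd yY) gs_mulA -(gs_mulA x).
suff -> : gs_mul (e i) (e j) = 0 by rewrite gs_mul0r gs_mul0l.
case: (hd_ejx hd i (hd_e hd j).1) => // e1; case: (hd_yej hd j (hd_e hd i).2) => // e2.
have eij : e i = e j by rewrite -e1 e2.
have ej := (hd_e hd j).1; rewrite -eij in ej.
by rewrite (X_tag (hd_e hd i).1 ej) eqxx in ij.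
Qed.

Lemma heredity_coordinates : exists f : pairs -> A -> k,
  (forall p c a b, f p (c *: a + b) = c * f p a + f p b) /\
  (forall p q, f p (heredity_prod q) = (p == q)%:R).
Proof.
have [li sp] := hd_basis hd.
have ex a : exists c : {ffun pairs -> k}, a = \sum_p c p *: heredity_prod p.
  have sa : Defs.span (fun w => exists j : pairs, w = heredity_prod j) a by apply/sp.
  apply: (span_ind (Q := fun a => exists c : {ffun pairs -> k},
    a = \sum_p c p *: heredity_prod p) _ _ _ sa) => [|x v w [c ->] [c' ->]|v [j ->]].
  - exists [ffun=> 0]; rewrite big1 // => p _; rewrite ffunE scale0r //.
  - exists [ffun p => x * c p + c' p]; rewrite scaler_sumr -big_split.
    by apply: eq_bigr => p _; rewrite ffunE scalerDl scalerA.
  - exists [ffun p => (p == j)%:R]; rewrite (bigD1 j) //= ffunE eqxx scale1r big1 ?addr0 //.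
    by move=> p /negbTE pj; rewrite ffunE pj scale0r.
have uniq (c c' : pairs -> k) :
    \sum_p c p *: heredity_prod p = \sum_p c' p *: heredity_prod p -> c =1 c'.
  move=> cc p; apply/eqP; rewrite -subr_eq0; apply/eqP.
  have := li #|{: pairs}| (@enum_val _ _) (fun i => c (enum_val i) - c' (enum_val i))
    (@enum_val_inj _ _) _ (enum_rank p).
  rewrite enum_rankK; apply.
  transitivity (\sum_p (c p - c' p) *: heredity_prod p).
    by rewrite [RHS](reindex (@enum_val _ predT)) //; exact: onW_bij (enum_val_bij _).
  by under eq_bigr do rewrite scalerBl; rewrite sumrB cc subrr.
have [f fP] := choice ex; exists (fun p a => f a p); split=> [p c a b|p q].
  apply: (uniq (f (c *: a + b)) (fun p => c * f a p + f b p)).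
  rewrite -fP {1}(fP a) {1}(fP b) scaler_sumr -big_split.
  by apply: eq_bigr => q _; rewrite scalerDl scalerA.
apply: (uniq (f (heredity_prod q)) (fun p => (p == q)%:R)).
rewrite -fP (bigD1 q) //= eqxx scale1r big1 ?addr0 // => p' /negbTE ->.
by rewrite scale0r.
Qed.

End Heredity.

(** * Letters of the alphabets and tensors of pairs of words *)

Section Letters.
Variables (R : comNzRingType) (A : gsAlg R) (ell n : nat).
Variable Z : 'I_ell.+1 -> {fset A}.
Variable leZ : forall i, rel (letter n (Z i)).

Definition letters := {i : 'I_ell.+1 & letter n (Z i)}.
HB.instance Definition _ := Finite.on letters.

Definition component (l : letters) : 'I_ell.+1 := tag l.
Definition row_index (l : letters) : 'I_n := (tagged l).1.
Definition colour (l : letters) : A := val (tagged l).2.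
Definition odd_letter (l : letters) : bool := gs_odd (colour l).

(** Turns the order of each alphabet into a comparison of natural numbers. *)
Definition letter_rank (l : letters) : nat :=
  #|[set l' : letter n (Z (tag l)) | leZ l' (tagged l)]%SET|.

Lemma colour_mem l : colour l \in Z (component l).
Proof. exact: valP. Qed.

Lemma letter_ext l l' : component l = component l' -> row_index l = row_index l' ->
  colour l = colour l' -> l = l'.
Proof.
case: l l' => [i [r x]] [j [s y]]; rewrite /component /row_index /colour /= => eij.
by move: y; rewrite -eij => y -> /val_inj ->.
Qed.

Hypothesis leZ_order : forall i, letter_order (@leZ i).

Lemma letter_rank_le i (a b : letter n (Z i)) :
  (letter_rank (Tagged (fun i => letter n (Z i)) a) <=
   letter_rank (Tagged (fun i => letter n (Z i)) b))%N = leZ a b.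
Proof.
have [tot anti tr _] := leZ_order i; rewrite /letter_rank /=.
apply/idP/idP => [|ab]; last first.
  by apply: subset_leq_card; apply/fintype.subsetP => c; rewrite !inE => /tr; apply.
apply: contraTT => nab; have ba : leZ b a by case/orP: (tot a b) nab => [->|].
rewrite -ltnNge; apply: proper_card; apply/properP; split.
  by apply/fintype.subsetP => c; rewrite !inE => /tr; apply.
by exists a; rewrite inE //; case/orP: (tot a a).
Qed.

Lemma letter_rank_inj l l' : component l = component l' ->
  letter_rank l = letter_rank l' -> l = l'.
Proof.
case: l l' => [i a] [j b] /= eij; move: b; rewrite -eij => b e.
have [_ anti _ _] := leZ_order i; congr (Tagged _ _); apply: anti.
by rewrite -!letter_rank_le e leqnn.
Qed.

End Letters.

Section Tensors.
Variables (k : idomainType) (A : gsAlg k) (ell n d : nat) (le : rel 'I_ell.+1).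
Variables (X Y : 'I_ell.+1 -> {fset A}) (e : 'I_ell.+1 -> A).
Hypothesis hd : heredity_data (fun _ : A => True) le X Y e.
Local Notation LX := (letters n X).
Local Notation LY := (letters n Y).
Local Notation M := (tpow (mx_gsAlg A n) d).

Definition pair_elt (x : LX) (y : LY) : A := gs_mul (colour x) (colour y).

Definition pair_tensor (u : {ffun 'I_d -> LX}) (w : {ffun 'I_d -> LY}) : M :=
  tpure [ffun j => xi1 (pair_elt (u j) (w j)) (row_index (u j)) (row_index (w j))].

(** The product of the tensors of two labelled words with equal labels, see
    [tmul_labelled]. *)
Definition koszul_tensor (u : {ffun 'I_d -> LX}) (w : {ffun 'I_d -> LY}) : M :=
  (-1) ^+ kinv (parw (@odd_letter k A ell n X) u) (parw (@odd_letter k A ell n Y) w) *: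
  pair_tensor u w.

Lemma pair_eltE (x : LX) (y : LY) : component x = component y ->
  exists p : {i : 'I_ell.+1 & (X i * Y i)%type}, [/\ pair_elt x y = heredity_prod p,
    tag p = component x, val (tagged p).1 = colour x & val (tagged p).2 = colour y].
Proof.
case: x y => [i [r x]] [j [s y]]; rewrite /component /= => eij; move: y.
rewrite -eij => y; by exists (Tagged (fun i => (X i * Y i)%type) (x, y)).
Qed.

Lemma pair_elt_inj (x x' : LX) (y y' : LY) : component x = component y ->
  component x' = component y' -> pair_elt x y = pair_elt x' y' ->
  row_index x = row_index x' -> row_index y = row_index y' -> x = x' /\ y = y'.
Proof.
move=> c c' epp rx ry.
have [p [pE tp px py]] := pair_eltE c; have [p' [pE' tp' px' py']] := pair_eltE c'.
have ep : p = p' by apply: (heredity_prod_inj hd); rewrite -pE -pE'.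
by split; apply: letter_ext => //; rewrite -?px -?px' -?py -?py' -?c -?c' -?tp -?tp' ep.
Qed.

Lemma colourX_homogeneous (x : LX) : homogeneous (colour x).
Proof. exact: (hd_X hd (colour_mem x)).2. Qed.

Lemma colourY_homogeneous (y : LY) : homogeneous (colour y).
Proof. exact: (hd_Y hd (colour_mem y)).2. Qed.

Lemma pair_elt_neq0 (x : LX) (y : LY) : component x = component y -> pair_elt x y != 0.
Proof. by move=> c; have [p [-> _ _ _]] := pair_eltE c; exact: heredity_prod_neq0 hd p. Qed.

Lemma pair_elt_homogeneous (x : LX) (y : LY) : homogeneous (pair_elt x y).
Proof. exact: gs_mul_homogeneous (colourX_homogeneous x) (colourY_homogeneous y). Qed.

Lemma pair_elt_odd (x : LX) (y : LY) : component x = component y ->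
  gs_odd (pair_elt x y) = odd_letter x (+) odd_letter y.
Proof.
move=> c; apply: gs_odd_mul (colourX_homogeneous x) (colourY_homogeneous y) _.
exact: pair_elt_neq0.
Qed.

Lemma pair_elt_tag (x : LX) (y : LY) : component x != component y -> pair_elt x y = 0.
Proof. by move=> c; exact: (heredity_orthogonal hd c (colour_mem x) (colour_mem y)). Qed.

(** A product of coordinate forms is multilinear and isolates one tensor of basis
    elements. *)
Lemma koszul_tensor_independent (C : {ffun 'I_d -> LX} -> {ffun 'I_d -> LY} -> k) :
  (forall u w, C u w != 0 -> forall j, component (u j) = component (w j)) ->
  \sum_u \sum_w C u w *: koszul_tensor u w = 0 -> forall u w, C u w = 0.
Proof.
move=> supp sum0 u0 w0; apply/eqP; apply: contraT => C0.
have c0 := supp _ _ C0; have [f [flin fE]] := heredity_coordinates hd.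
have [p pP] := choice (fun j => pair_eltE (c0 j)).
pose psi j (V : mx_gsAlg A n) : k :=
  f (p j) ((V : 'M[A]_n) (row_index (u0 j)) (row_index (w0 j))).
have psi_lin j c V W : psi j (c *: V + W) = c * psi j V + psi j W.
  by rewrite /psi amx_linP flin.
pose phi (v : {ffun 'I_d -> mx_gsAlg A n}) : k^o := \prod_j psi j (v j).
have phi_multi : multilinear phi.
  move=> v i c V W; rewrite /phi !(bigD1 (P := predT) i) //=.
  have rest Z : \prod_(j < d | j != i) psi j (upd v i Z j) = \prod_(j < d | j != i) psi j (v j).
    by apply: eq_bigr => j /negbTE ji; rewrite ffunE ji.
  rewrite !rest !ffunE eqxx psi_lin mulrDl /GRing.scale /= mulrA //.
have f0 j : f (p j) 0 = 0.
  by have := flin (p j) (-1) 0 0; rewrite scaler0 addr0 mulN1r addNr.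
have phiE u w : C u w != 0 ->
    phi [ffun j => xi1 (pair_elt (u j) (w j)) (row_index (u j)) (row_index (w j))] =
    ((u == u0) && (w == w0))%:R.
  move=> Cuw; have c := supp _ _ Cuw.
  case: andP => [[/eqP -> /eqP ->]|ne].
    rewrite /phi big1 // => j _; rewrite ffunE /psi xi1E !eqxx /=.
    by have [-> _ _ _] := pP j; rewrite fE eqxx.
  have [j nj] : exists j, ~~ ((u j == u0 j) && (w j == w0 j)).
    apply/existsP; rewrite -negb_forall; apply/negP => /forallP h; apply: ne.
    by split; apply/eqP/ffunP => j; have /andP[/eqP eu /eqP ew] := h j.
  rewrite /phi (bigD1 j) //= ffunE /psi xi1E.
  case: ifP => [/andP[/eqP ru /eqP rw]|_]; last by rewrite f0 mul0r.
  have [q [qE tq qx qy]] := pair_eltE (c j); rewrite qE fE.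
  case: eqP => [epq|_]; last by rewrite mul0r.
  have [pE _ _ _] := pP j; case/negP: nj.
  have ee : pair_elt (u0 j) (w0 j) = pair_elt (u j) (w j) by rewrite pE qE epq.
  by have [-> ->] := pair_elt_inj (c0 j) (c j) ee ru rw; rewrite !eqxx.
have := congr1 (tlift phi) sum0.
have lin := tlift_linear phi_multi.
have T0 : tlift phi 0 = 0 by exact: tlift_zero phi_multi.
have TD : {morph tlift phi : x y / x + y}.
  by move=> x y; have := lin 1 x y; rewrite !scale1r.
have TZ c x : tlift phi (c *: x) = c * tlift phi x.
  by have := lin c x 0; rewrite !addr0 T0 addr0.
rewrite T0 (big_morph _ TD T0) (bigD1 u0) //= (big_morph _ TD T0) (bigD1 w0) //=.
have other u w : (u == u0) && (w == w0) = false ->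
    tlift phi (C u w *: koszul_tensor u w) = 0.
  move=> h; rewrite TZ; case: (eqVneq (C u w) 0) => [->|Cuw]; first by rewrite mul0r.
  by rewrite /koszul_tensor TZ (tlift_pure _ phi_multi) phiE // h !mulr0.
rewrite big1 => [|w /negbTE nw]; last by apply: other; rewrite nw andbF.
rewrite big1 => [|u /negbTE nu]; last first.
  by rewrite (big_morph _ TD T0) big1 // => w _; apply: other; rewrite nu.
rewrite !addr0 TZ /koszul_tensor TZ (tlift_pure _ phi_multi) phiE // !eqxx mulr1.
by move=> /eqP; rewrite mulf_eq0 (negbTE C0) signr_eq0.
Qed.

End Tensors.

(** * Standard tableaux as words *)

Section Tableaux.
Variables (k : idomainType) (A : gsAlg k) (ell n d : nat).
Hypothesis char0 : [pchar k] =i pred0.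
Variable Z : 'I_ell.+1 -> {fset A}.
Variable leZ : forall i, rel (letter n (Z i)).
Hypothesis leZ_order : forall i, letter_order (@leZ i).
Hypothesis Z_homogeneous : forall i x, x \in Z i -> homogeneous x /\ x != 0.
Hypothesis Z_tag : forall i j x, x \in Z i -> x \in Z j -> i = j.
Local Notation LZ := (letters n Z).
Local Notation Bk := ('I_ell.+1 * 'I_n)%type.
Local Notation odd := (@odd_letter k A ell n Z).
Local Notation rank := (letter_rank leZ).

Lemma gs_even_letter (l : LZ) : gs_even (colour l) = ~~ odd l.
Proof. by have [h n0] := Z_homogeneous (colour_mem l); exact: gs_even_odd. Qed.

Section Words.
Variable lam : multipart ell n d.
Local Notation bl := (block_word lam).
Local Notation cl := (col_word lam).
Local Notation nd := (Tagged (fun i => diagram (val lam i))).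

Definition letter_at (t : multitab Z lam) (x : node_type lam) : LZ :=
  Tagged (fun i => letter n (Z i)) (t (tag x) (tagged x)).

Definition tab_word (t : multitab Z lam) : {ffun 'I_d -> LZ} :=
  [ffun j => letter_at t (node_word lam j)].

Lemma colour_tab_word t : colour_word t = [ffun j => colour (tab_word t j)].
Proof. by apply/ffunP => j; rewrite /colour_word readingE [RHS]ffunE [tab_word t j]ffunE. Qed.

Lemma letter_tab_word t : letter_word t = [ffun j => row_index (tab_word t j)].
Proof. by apply/ffunP => j; rewrite /letter_word readingE [RHS]ffunE [tab_word t j]ffunE. Qed.

Lemma row_block_word : row_word lam = [ffun j => (bl j).2].
Proof. by apply/ffunP => j; rewrite /row_word readingE [RHS]ffunE [bl j]ffunE. Qed.

Lemma compat_tab_word t : compat (@component k A ell n Z) (tab_word t) bl.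
Proof. by move=> j; rewrite [tab_word t j]ffunE [bl j]ffunE. Qed.

Lemma letter_at_rank t i (v v' : diagram (val lam i)) :
  (rank (letter_at t (nd v)) <= rank (letter_at t (nd v')))%N =
  leZ (t i v) (t i v').
Proof. exact: letter_rank_le. Qed.

Lemma letter_at_eq t i (v v' : diagram (val lam i)) :
  (letter_at t (nd v) == letter_at t (nd v')) = (t i v == t i v').
Proof. by rewrite /letter_at eq_Tagged. Qed.

Lemma standard_tab_word (t : multitab Z lam) :
  [forall i, standard (@leZ i) (t i)] = standard_word odd rank bl cl (tab_word t).
Proof.
pose cond (x y : node_type lam) :=
  ((node_block x == node_block y) && (node_column x < node_column y)%N ==>
     (rank (letter_at t x) <= rank (letter_at t y))%N &&
     ((letter_at t x == letter_at t y) ==> ~~ odd (letter_at t x))) &&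
  ([&& tag x == tag y, node_column x == node_column y &
      ((node_block x).2 < (node_block y).2)%N] ==>
     (rank (letter_at t x) <= rank (letter_at t y))%N &&
     ((letter_at t x == letter_at t y) ==> odd (letter_at t x))).
have -> : standard_word odd rank bl cl (tab_word t) = [forall x, forall y, cond x y].
  apply/forallP/forallP => h x; apply/forallP => y.
    have [i <-] := node_word_surj x; have [j <-] := node_word_surj y.
    have /forallP /(_ j) := h i.
    by rewrite [bl i]ffunE [bl j]ffunE [cl i]ffunE [cl j]ffunE [tab_word t i]ffunE [tab_word t j]ffunE.
  have /forallP /(_ (node_word lam y)) := h (node_word lam x).
  by rewrite [bl x]ffunE [bl y]ffunE [cl x]ffunE [cl y]ffunE [tab_word t x]ffunE [tab_word t y]ffunE.
have condE i (v v' : diagram (val lam i)) : cond (nd v) (nd v') =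
  ((node_row v == node_row v') && (node_col v < node_col v')%N ==>
     leZ (t i v) (t i v') && ((t i v == t i v') ==> gs_even (val (t i v).2))) &&
  ((node_col v == node_col v') && (node_row v < node_row v')%N ==>
     leZ (t i v) (t i v') && ((t i v == t i v') ==> gs_odd (val (t i v).2))).
  rewrite /cond letter_at_rank letter_at_eq /node_block /= xpair_eqE !eqxx /=.
  by have := gs_even_letter (letter_at t (nd v)); rewrite /colour /= => ->.
apply/forallP/forallP => [h [i v]|h i].
  apply/forallP => -[i' v']; case: (eqVneq i i') => [eii|nii]; last first.
    by rewrite /cond /= xpair_eqE (negbTE nii).
  move: v'; rewrite -eii => v'; rewrite condE.
  by have /forallP /(_ v) /forallP /(_ v') := h i.
apply/forallP => v; apply/forallP => v'; rewrite -condE.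
by have /forallP := h (nd v); apply.
Qed.

Lemma good_tab_word (t : multitab Z lam) : [forall i, standard (@leZ i) (t i)] ->
  good (bsign odd) (zipw (tab_word t) bl).
Proof.
rewrite standard_tab_word => st; apply/bgoodP => i j ij uij bij.
have key a b : a != b -> tab_word t a = tab_word t b -> bl a = bl b -> (cl a < cl b)%N ->
    ~~ odd (tab_word t a).
  move=> _ uab bab cab; have /forallP /(_ b) /andP[/implyP h _] := (forallP st) a.
  have /h/andP[_ /implyP] : (bl a == bl b) && (cl a < cl b)%N by rewrite bab eqxx.
  by rewrite uab eqxx; apply.
case: (ltngtP (cl i) (cl j)) => c; first exact: key ij uij bij c.
  by rewrite uij; apply: key c => //; rewrite eq_sym.
by rewrite (block_word_col_inj bij c) eqxx in ij.
Qed.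

Lemma tab_of_word (u : {ffun 'I_d -> LZ}) : compat (@component k A ell n Z) u bl ->
  exists t, tab_word t = u.
Proof.
move=> cu; have [g gK] := choice (@node_word_surj ell n d lam).
have ex i (v : diagram (val lam i)) : exists l : letter n (Z i),
    u (g (nd v)) = Tagged (fun i => letter n (Z i)) l.
  have := cu (g (nd v)).
  rewrite [bl _]ffunE gK /=; case: (u _) => j l /=; rewrite /component /= => ej.
  by move: l; rewrite ej => l; exists l.
pose t : multitab Z lam := [ffun i => [ffun v => sval (cid (ex i v))]].
have tE i v : t i v = sval (cid (ex i v)) by rewrite /t ffunE ffunE.
exists t; apply/ffunP => j; rewrite [LHS]ffunE /letter_at tE.
case: cid => l /= <-; congr (u _); apply: (@node_word_inj _ _ _ lam).
by rewrite gK; case: (node_word lam j).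
Qed.

Lemma tab_word_inj : injective tab_word.
Proof.
move=> t t' e; apply/ffunP => i; apply/ffunP => v.
have [j ej] := node_word_surj (nd v).
have : tab_word t j = tab_word t' j by rewrite e.
rewrite [tab_word t j]ffunE [tab_word t' j]ffunE ej /letter_at /=.
by move/eqP; rewrite eq_Tagged => /eqP.
Qed.

End Words.

(** A letter is determined by its component, row and colour, and a colour
    determines its component; so the stabilizer of the triple in [xi] is that of
    the labelled word. *)
Lemma xi_orb (p q : LZ * Bk -> 'I_n) (z : {ffun 'I_d -> LZ * Bk}) :
  good (bsign odd) z -> (forall j, component (z j).1 = (z j).2.1) ->
  (forall x y, p x = p y -> q x = q y -> row_index x.1 = row_index y.1 /\ x.2.2 = y.2.2) ->
  xi [ffun j => colour (z j).1] [ffun j => p (z j)] [ffun j => q (z j)] =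
  \sum_z' (orb k (bsign odd) z z' : k) *:
    (tpure [ffun j => xi1 (colour (z' j).1) (p (z' j)) (q (z' j))] : tpow (mx_gsAlg A n) d).
Proof.
move=> gz cz pq; set a := [ffun j => colour (z j).1].
set r := [ffun j => p (z j)]; set s := [ffun j => q (z j)].
have memG h : h \in triple_stab a r s <-> word_act z h = z.
  rewrite finset.inE; split=> [/and3P[/eqP ah /eqP rh /eqP sh]|zh]; last first.
    have zE j : z (h j) = z j by rewrite -[in RHS]zh ffunE.
    by apply/and3P; split; apply/eqP/ffunP => j; rewrite !ffunE zE.
  apply/ffunP => j; rewrite ffunE.
  have aj : colour (z (h j)).1 = colour (z j).1.
    by have := congr1 (fun w : {ffun 'I_d -> A} => w j) ah; rewrite !ffunE.
  have rj : p (z (h j)) = p (z j).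
    by have := congr1 (fun w : {ffun 'I_d -> 'I_n} => w j) rh; rewrite !ffunE.
  have sj : q (z (h j)) = q (z j).
    by have := congr1 (fun w : {ffun 'I_d -> 'I_n} => w j) sh; rewrite !ffunE.
  have [e1 e2] := pq _ _ rj sj.
  have tj : component (z (h j)).1 = component (z j).1.
    by apply: (Z_tag (colour_mem (z (h j)).1)); rewrite aj; exact: colour_mem.
  have -> : z (h j) = ((z (h j)).1, ((z (h j)).2.1, (z (h j)).2.2)).
    by rewrite -!surjective_pairing.
  by rewrite (letter_ext tj e1 aj) e2 -cz tj cz -!surjective_pairing.
rewrite -(sum_shortest (@bsignM d n ell _ odd)
  (fun z' => tpure [ffun j => xi1 (colour (z' j).1) (p (z' j)) (q (z' j))] :
     tpow (mx_gsAlg A n) d) gz memG).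
apply: eq_bigr => h _; rewrite /xi_tensor_act -signr_odd odd_inversionsE.
congr (_ ^+ _ *: tpure _).
  by congr (nat_of_bool (oinv _ _)); apply/ffunP => j; rewrite !ffunE.
by apply/ffunP => j; rewrite !ffunE.
Qed.

End Tableaux.

(** * The basis theorem *)

Section Basis.
Variables (k : idomainType) (n d : nat) (A : gsAlg k) (ell : nat) (le : rel 'I_ell.+1).
Hypothesis char0 : [pchar k] =i pred0.
Hypothesis d_le_n : (d <= n)%N.
Variables (X Y : 'I_ell.+1 -> {fset A}) (e : 'I_ell.+1 -> A).
Hypothesis hd : heredity_data (fun _ : A => True) le X Y e.
Local Notation LX := (letters n X).
Local Notation LY := (letters n Y).
Local Notation M := (tpow (mx_gsAlg A n) d).
Local Notation oX := (@odd_letter k A ell n X).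
Local Notation oY := (@odd_letter k A ell n Y).
Local Notation cX := (@component k A ell n X).
Local Notation cY := (@component k A ell n Y).
Local Notation E := (@koszul_tensor k A ell n d X Y).
Local Notation KX := (kernel k d n ell LX).
Local Notation KY := (kernel k d n ell LY).

Lemma X_homogeneous i x : x \in X i -> homogeneous x /\ x != 0.
Proof. by move=> xX; split; [exact: (hd_X hd xX).2|exact: (X_neq0 hd xX)]. Qed.

Lemma Y_homogeneous i y : y \in Y i -> homogeneous y /\ y != 0.
Proof. by move=> yY; split; [exact: (hd_Y hd yY).2|exact: (Y_neq0 hd yY)]. Qed.

Lemma tmul_sum (I J : finType) (a : I -> k) (x : I -> M) (b : J -> k) (y : J -> M) :
  tmul (\sum_i a i *: x i) (\sum_j b j *: y j) =
  \sum_i \sum_j (a i * b j) *: tmul (x i) (y j).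
Proof.
have lin0 (f : M -> M) : linear f -> f 0 = 0.
  by move=> lf; have := lf (-1) 0 0; rewrite scaler0 addr0 scaleN1r addNr.
have linZ (f : M -> M) c v : linear f -> f (c *: v) = c *: f v.
  by move=> lf; have := lf c v 0; rewrite !addr0 (lin0 _ lf) addr0.
have linD (f : M -> M) : linear f -> {morph f : v w / v + w}.
  by move=> lf v w; have := lf 1 v w; rewrite !scale1r.
have ll := @tmul_linearl k (mx_gsAlg A n) d; have lr := @tmul_linearr k (mx_gsAlg A n) d.
pose y' : M := \sum_j b j *: y j; rewrite -/y'.
rewrite (big_morph (fun v : M => tmul v y') (linD _ (ll y')) (lin0 _ (ll y'))).
apply: eq_bigr => i _; rewrite (linZ (fun v : M => tmul v y') _ _ (ll y')).
rewrite /y' (big_morph (tmul (x i)) (linD _ (lr (x i))) (lin0 _ (lr (x i)))) scaler_sumr.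
by apply: eq_bigr => j _; rewrite (linZ (tmul (x i)) _ _ (lr (x i))) scalerA.
Qed.

(** Matrix units compose only along equal rows, and [X i] annihilates [Y j] for
    distinct components; so different labels give 0. *)
Lemma tmul_labelled (u : {ffun 'I_d -> LX}) (w : {ffun 'I_d -> LY})
    (b c : {ffun 'I_d -> 'I_ell.+1 * 'I_n}) : compat cX u b -> compat cY w c ->
  tmul (tpure [ffun j => xi1 (colour (u j)) (row_index (u j)) (b j).2] : M)
       (tpure [ffun j => xi1 (colour (w j)) (c j).2 (row_index (w j))]) =
  (b == c)%:R *: E u w.
Proof.
move=> cu cw.
rewrite (@tmul_pure _ _ _ _ _ (parw oX u) (parw oY w)); first last.
- move=> j; rewrite !ffunE; have [h n0] := Y_homogeneous (colour_mem (w j)).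
  exact: parity_part_xi1.
- move=> j; rewrite !ffunE; have [h n0] := X_homogeneous (colour_mem (u j)).
  exact: parity_part_xi1.
rewrite koszulE; case: (eqVneq b c) => [<-|/eqP nbc].
  rewrite scale1r /koszul_tensor; congr (_ *: tpure _).
  by apply/ffunP => j; rewrite !ffunE gs_mul_xi1 eqxx.
have [j nj] : exists j, b j != c j.
  apply/existsP; rewrite -negb_forall; apply/negP => /forallP h; apply: nbc.
  by apply/ffunP => j; apply/eqP.
rewrite scale0r (@tpure0 _ _ _ _ j) ?scaler0 // !ffunE gs_mul_xi1.
case: eqP => // bc2; have bc1 : cX (u j) != cY (w j).
  rewrite cu cw; apply: contra nj => /eqP bc1.
  by rewrite [b j]surjective_pairing [c j]surjective_pairing bc1 bc2.
have -> : gs_mul (colour (u j)) (colour (w j)) = 0 := pair_elt_tag hd bc1.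
by apply/matrixP => p q; rewrite xi1E mxE; case: ifP.
Qed.

Variables (leX : forall i, rel (letter n (X i))) (leY : forall i, rel (letter n (Y i))).
Hypothesis leX_order : forall i, letter_order (@leX i).
Hypothesis leY_order : forall i, letter_order (@leY i).

Local Notation rX := (letter_rank leX).
Local Notation rY := (letter_rank leY).
Local Notation orbX u b := (orb k (bsign oX) (zipw u b)).
Local Notation orbY w b := (orb k (bsign oY) (zipw w b)).

Lemma codet_prodE lam (S : Std leX lam) (T : Std leY lam) :
  tmul (codetX (val S)) (codetY (val T)) =
  prodE E (orbX (tab_word (val S)) (block_word lam)) (orbY (tab_word (val T)) (block_word lam)).
Proof.
set u := tab_word (val S); set w := tab_word (val T); pose b := block_word lam.
have gu : good (bsign oX) (zipw u b).
  exact: (good_tab_word leX_order X_homogeneous (valP S)).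
have gw : good (bsign oY) (zipw w b).
  exact: (good_tab_word leY_order Y_homogeneous (valP T)).
have cu : compat cX u b by exact: compat_tab_word.
have cw : compat cY w b by exact: compat_tab_word.
have eX : codetX (val S) = \sum_z (orbX u b z : k) *:
    (tpure [ffun j => xi1 (colour (z j).1) (row_index (z j).1) (z j).2.2] : M).
  rewrite -(@xi_orb k A ell n d X (X_tag hd) (fun x => row_index x.1) (fun x => x.2.2) (zipw u b)) //.
    rewrite /codetX colour_tab_word letter_tab_word row_block_word.
    by congr xi; apply/ffunP => j; rewrite [LHS]ffunE [RHS]ffunE [zipw u b j]ffunE.
  by move=> j; rewrite [zipw u b j]ffunE; exact: cu.
have eY : codetY (val T) = \sum_z (orbY w b z : k) *:
    (tpure [ffun j => xi1 (colour (z j).1) (z j).2.2 (row_index (z j).1)] : M).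
  rewrite -(@xi_orb k A ell n d Y (Y_tag hd) (fun x => x.2.2) (fun x => row_index x.1) (zipw w b)) //.
    rewrite /codetY colour_tab_word letter_tab_word row_block_word.
    by congr xi; apply/ffunP => j; rewrite [LHS]ffunE [RHS]ffunE [zipw w b j]ffunE.
  by move=> j; rewrite [zipw w b j]ffunE; exact: cw.
have eL (u' : {ffun 'I_d -> LX}) (b' : {ffun 'I_d -> 'I_ell.+1 * 'I_n}) :
    [ffun j => xi1 (colour (zipw u' b' j).1) (row_index (zipw u' b' j).1) (zipw u' b' j).2.2] =
    [ffun j => xi1 (colour (u' j)) (row_index (u' j)) (b' j).2] :> {ffun 'I_d -> mx_gsAlg A n}.
  by apply/ffunP => j; rewrite !ffunE.
have eR (w' : {ffun 'I_d -> LY}) (b' : {ffun 'I_d -> 'I_ell.+1 * 'I_n}) :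
    [ffun j => xi1 (colour (zipw w' b' j).1) (zipw w' b' j).2.2 (row_index (zipw w' b' j).1)] =
    [ffun j => xi1 (colour (w' j)) (b' j).2 (row_index (w' j))] :> {ffun 'I_d -> mx_gsAlg A n}.
  by apply/ffunP => j; rewrite !ffunE.
rewrite eX eY tmul_sum big_zipw /prodE; apply: eq_bigr => u' _.
under eq_bigr do rewrite big_zipw.
rewrite exchange_big /=; apply: eq_bigr => w' _; rewrite /contract scaler_suml.
apply: eq_bigr => b' _; rewrite (bigD1 b') //= big1 => [|c cb].
  rewrite addr0.
  case: (eqVneq (orbX u b (zipw u' b')) 0) => [->|Fn]; first by rewrite !mul0r !scale0r.
  case: (eqVneq (orbY w b (zipw w' b')) 0) => [->|Hn]; first by rewrite !mulr0 !scale0r.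
  have cu' := ((supported_orb k gu cu).2 _ _ Fn).2.
  have cw' := ((supported_orb k gw cw).2 _ _ Hn).2.
  by rewrite eL eR tmul_labelled // eqxx scale1r.
case: (eqVneq (orbX u b (zipw u' b')) 0) => [->|Fn]; first by rewrite !mul0r !scale0r.
case: (eqVneq (orbY w b (zipw w' c)) 0) => [->|Hn]; first by rewrite !mulr0 !scale0r.
have cu' := ((supported_orb k gu cu).2 _ _ Fn).2.
have cw' := ((supported_orb k gw cw).2 _ _ Hn).2.
by rewrite eL eR tmul_labelled // eq_sym (negbTE cb) scale0r scaler0.
Qed.

Local Notation cod := (@codet ell n d k A X Y leX leY).

Section Eta.
Variables (u : {ffun 'I_d -> LX}) (w : {ffun 'I_d -> LY}).
Hypothesis tuw : forall j, component (u j) = component (w j).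
Hypothesis guw : good (pair_sign oX oY) (zipw u w).

Local Notation bw := [ffun j => pair_elt (u j) (w j)].
Local Notation rw := [ffun j => row_index (u j)].
Local Notation sw := [ffun j => row_index (w j)].

Lemma odd_prod_setP i x y : x \in X i -> y \in Y i ->
  (gs_mul x y \in odd_prod_set X Y) = gs_odd x && gs_odd y.
Proof.
move=> xX yY; have oddE (Z : 'I_ell.+1 -> {fset A}) j z :
    (z \in odd_part Z j) = (z \in Z j) && gs_odd z by rewrite /odd_part in_fset !inE.
apply/bigfcupP/andP => [[j _ /imfset2P[x' /= x'X [y' /= y'Y epp]]]|[ox oy]].
  move: x'X y'Y; rewrite !oddE => /andP[x'X ox] /andP[y'Y oy].
  have epq : hpair xX yY = hpair x'X y'Y.
    by apply: (heredity_prod_inj hd); exact: epp.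
  have ex : x = x' := congr1 (fun p : {i : 'I_ell.+1 & (X i * Y i)%type} => val (tagged p).1) epq.
  have ey : y = y' := congr1 (fun p : {i : 'I_ell.+1 & (X i * Y i)%type} => val (tagged p).2) epq.
  by rewrite ex ey.
exists i; first by rewrite mem_index_enum.
by apply/imfset2P; exists x; rewrite /= ?oddE ?xX //; exists y; rewrite /= ?oddE ?yY.
Qed.

Lemma pair_word_fix h :
  [/\ word_act bw h = bw, word_act rw h = rw & word_act sw h = sw] <->
  word_act (zipw u w) h = zipw u w.
Proof.
split=> [[bh rh sh]|]; last first.
  rewrite zipw_act => /zipw_inj[/ffunP uh /ffunP wh].
  split; apply/ffunP => j; have := uh j; have := wh j; rewrite !ffunE.
  - by move=> -> ->.
  - by move=> _ ->.
  - by move=> ->.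
rewrite zipw_act; congr zipw; apply/ffunP => j; rewrite ffunE.
  have := congr1 (fun v : {ffun 'I_d -> A} => v j) bh.
  have := congr1 (fun v : {ffun 'I_d -> 'I_n} => v j) rh.
  have := congr1 (fun v : {ffun 'I_d -> 'I_n} => v j) sh; rewrite !ffunE => e1 e2 e3.
  by have [] := pair_elt_inj hd (tuw _) (tuw _) e3 e2 e1.
have := congr1 (fun v : {ffun 'I_d -> A} => v j) bh.
have := congr1 (fun v : {ffun 'I_d -> 'I_n} => v j) rh.
have := congr1 (fun v : {ffun 'I_d -> 'I_n} => v j) sh; rewrite !ffunE => e1 e2 e3.
by have [] := pair_elt_inj hd (tuw _) (tuw _) e3 e2 e1.
Qed.

(** The sign of a word of products differs from the product of the signs of its two
    words by a coboundary, which is absorbed in the Koszul signs. *)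
Lemma xi_pair_orb : xi bw rw sw =
  (-1) ^+ kinv (parw oX u) (parw oY w) *:
  \sum_u' \sum_w' (orb k (pair_sign oX oY) (zipw u w) (zipw u' w') : k) *: E u' w'.
Proof.
pose E' (z : {ffun 'I_d -> LX * LY}) : M := E [ffun j => (z j).1] [ffun j => (z j).2].
have zE (u' : {ffun 'I_d -> LX}) (w' : {ffun 'I_d -> LY}) : E' (zipw u' w') = E u' w'.
  by rewrite /E'; congr koszul_tensor; apply/ffunP => j; rewrite !ffunE.
have -> : \sum_u' \sum_w' (orb k (pair_sign oX oY) (zipw u w) (zipw u' w') : k) *: E u' w' =
    \sum_z (orb k (pair_sign oX oY) (zipw u w) z : k) *: E' z.
  by rewrite big_zipw; apply: eq_bigr => u' _; apply: eq_bigr => w' _; rewrite zE.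
have memG h : h \in triple_stab bw rw sw <-> word_act (zipw u w) h = zipw u w.
  rewrite -pair_word_fix finset.inE.
  by split=> [/and3P[/eqP -> /eqP -> /eqP ->]|[-> -> ->]] //; rewrite !eqxx.
rewrite -(sum_shortest (@pair_signM d LX LY oX oY) E' guw memG) scaler_sumr.
apply: eq_bigr => h _; rewrite zipw_act zE /xi_tensor_act -signr_odd odd_inversionsE.
rewrite /koszul_tensor !scalerA; congr (_ *: _); last first.
  by rewrite /xi_tensor /pair_tensor; congr tpure; apply/ffunP => j; rewrite !ffunE.
have -> : [ffun j => gs_odd (bw j)] = addw (parw oX u) (parw oY w).
  by apply/ffunP => j; rewrite !ffunE (pair_elt_odd hd) // tuw.
rewrite oinv_addw pair_sign_zipw /psign !parw_act -!signr_addb.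
by congr ((-1) ^+ nat_of_bool _); do 2!case: (oinv _ _); do 2!case: (kinv _ _).
Qed.

(** The factorials in [eta] count the permutations of equal odd pairs. *)
Lemma eta_pair_orb : Defs.eta X Y bw rw sw =
  (-1) ^+ kinv (parw oX u) (parw oY w) *:
  ((#|odd_pair_perms oX oY u w|)%:R *:
  \sum_u' \sum_w' (orb k (pair_sign oX oY) (zipw u w) (zipw u' w') : k) *: E u' w').
Proof.
rewrite /Defs.eta xi_pair_orb !scalerA mulrC; congr (_ * _%:R *: _).
pose f j := (bw j, rw j, sw j).
pose r := [seq (c, j) | c <- [seq (c, i) | c <- (odd_prod_set X Y : seq A), i <- enum 'I_n],
  j <- enum 'I_n].
have ur : uniq r.
  apply: allpairs_uniq; rewrite ?enum_uniq //; last by move=> [? ?] [? ?] _ _ [-> ->].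
  apply: allpairs_uniq; rewrite ?enum_uniq ?fset_uniq //.
  by move=> [? ?] [? ?] _ _ [-> ->].
transitivity #|fibre_perms f (mem r)|.
  rewrite (card_fibre_perms f ur) /r big_allpairs big_allpairs.
  apply: eq_bigr => c _; rewrite big_enum; apply: eq_bigr => i _.
  by rewrite big_enum; apply: eq_bigr => j _.
apply: eq_card => s; apply/fibre_permsP/odd_pair_permsP => [h|[us ws h] j].
  have /pair_word_fix : [/\ word_act bw s = bw, word_act rw s = rw & word_act sw s = sw].
    by split; apply/ffunP => j; have := (h j).1; rewrite /f => -[e1 e2 e3]; rewrite [LHS]ffunE.
  rewrite zipw_act => /zipw_inj[-> ->]; split=> // j nj; apply: (h j).2.
  apply: contra nj => /allpairsP[[ci i] /= [/allpairsP[[c i'] /= [cin _ ->]] _ [ec _ _]]].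
  move: cin; rewrite -ec ffunE /pair_elt.
  have yY : colour (w j) \in Y (component (u j)) by rewrite tuw colour_mem.
  by rewrite (odd_prod_setP (colour_mem (u j)) yY).
have us' : u (s j) = u j by rewrite -[in RHS]us ffunE.
have ws' : w (s j) = w j by rewrite -[in RHS]ws ffunE.
split; first by rewrite /f !ffunE us' ws'.
move=> nr; apply: h; apply: contra nr => oj.
have yY : colour (w j) \in Y (component (u j)) by rewrite tuw colour_mem.
apply/allpairsP; exists ((bw j, rw j), sw j); split=> //=; last by rewrite mem_enum.
apply/allpairsP; exists (bw j, rw j); split=> //=; last by rewrite mem_enum.
by rewrite ffunE /pair_elt (odd_prod_setP (colour_mem (u j)) yY).
Qed.

End Eta.

(** Each [eta] is up to sign a product of two signed orbits, which straightens. *)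
Lemma T_alg_codets (v : M) : T_alg X Y v ->
  Defs.span (fun v => exists p, v = cod p) v.
Proof.
apply: span_ind; [exact: span0|by move=> *; exact: span_closed|].
move=> {}v [b [r [s [[bP rep] ->]]]].
have pick j : exists x : LX * LY, [/\ component x.1 = component x.2,
    pair_elt x.1 x.2 = b j, row_index x.1 = r j & row_index x.2 = s j].
  have /bigfcupP[i _ /imfset2P[x /= xX [y /= yY ->]]] := bP j.
  exists (Tagged (fun i => letter n (X i)) (r j, [` xX]%fset),
          Tagged (fun i => letter n (Y i)) (s j, [` yY]%fset)).
  by split.
have [z zP] := choice pick.
pose u := [ffun j => (z j).1]; pose w := [ffun j => (z j).2].
have tuw j : component (u j) = component (w j) by rewrite !ffunE; case: (zP j).
have bE : b = [ffun j => pair_elt (u j) (w j)].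
  by apply/ffunP => j; rewrite !ffunE; case: (zP j).
have rE : r = [ffun j => row_index (u j)].
  by apply/ffunP => j; rewrite !ffunE; case: (zP j).
have sE : s = [ffun j => row_index (w j)].
  by apply/ffunP => j; rewrite !ffunE; case: (zP j).
have guw : good (pair_sign oX oY) (zipw u w).
  apply/pair_goodP => i j ij uij wij; have := rep i j ij.
  have bj l : b l = pair_elt (u l) (w l) by rewrite bE [LHS]ffunE.
  have rj l : r l = row_index (u l) by rewrite rE [LHS]ffunE.
  have sj l : s l = row_index (w l) by rewrite sE [LHS]ffunE.
  rewrite !bj !rj !sj uij wij => /(_ erefl).
  rewrite (gs_even_odd (pair_elt_homogeneous hd _ _) (pair_elt_neq0 hd (tuw j))).
  by rewrite (pair_elt_odd hd (tuw j)); case: (odd_letter _); case: (odd_letter _).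
rewrite bE rE sE eta_pair_orb //.
have [c [cu cw gu gw H]] := monomial_product k d_le_n guw tuw.
set x := (_ ^+ _); rewrite -[x *: _]addr0; apply: span_closed; last exact: span0.
have -> : #|odd_pair_perms oX oY u w|%:R *:
    (\sum_u' \sum_w' (orb k (pair_sign oX oY) (zipw u w) (zipw u' w') : k) *: E u' w') =
    prodE E (orbX u c) (orbY w c).
  rewrite /prodE scaler_sumr; apply: eq_bigr => u' _.
  by rewrite scaler_sumr; apply: eq_bigr => w' _; rewrite scalerA H.
apply: (standard_span char0 d_le_n (letter_rank_inj leX_order) (letter_rank_inj leY_order)
  (span0 _) (@span_closed _ _ _) _ (supported_orb k gu cu) (supported_orb k gw cw)).
move=> lam u' w' /= su cu' gu' sw cw' gw'; apply: span_gen.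
have [S eS] := tab_of_word cu'; have [T eT] := tab_of_word cw'.
have sS : [forall i, standard (@leX i) (S i)].
  by rewrite (standard_tab_word leX_order X_homogeneous) eS.
have sT : [forall i, standard (@leY i) (T i)].
  by rewrite (standard_tab_word leY_order Y_homogeneous) eT.
pose S' : Std leX lam := exist _ S sS; pose T' : Std leY lam := exist _ T sT.
exists (Tagged (fun lam => (Std leX lam * Std leY lam)%type) (S', T')).
have eS' : tab_word (val S') = u' := eS; have eT' : tab_word (val T') = w' := eT.
by rewrite -eS' -eT'; exact: esym (codet_prodE S' T').
Qed.

(** Expand the product into signed orbits of pairs of words; the coefficient of each
    is divisible by the factorials in the corresponding [eta]. *)
Lemma codet_T_alg p : T_alg X Y (cod p).
Proof.
case: p => lam [S T].
have -> : cod (existT _ lam (S, T)) = _ := codet_prodE S T.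
set F := orb _ _ _; set H := orb _ _ _.
have gu := good_tab_word leX_order X_homogeneous (valP S).
have gw := good_tab_word leY_order Y_homogeneous (valP T).
have sF : supported cX oX F (block_word lam) := supported_orb k gu (compat_tab_word _).
have sH : supported cY oY H (block_word lam) := supported_orb k gw (compat_tab_word _).
pose C : {ffun {ffun 'I_d -> LX * LY} -> k^o} :=
  [ffun z : {ffun 'I_d -> LX * LY} => contract F H [ffun j => (z j).1] [ffun j => (z j).2]].
have CE u w : C (zipw u w) = contract F H u w.
  by rewrite ffunE; congr contract; apply/ffunP => j; rewrite !ffunE.
have iC : sinv (pair_sign oX oY) C.
  move=> s z; have [u [w ->]] := zipwP z.
  by rewrite zipw_act !CE (contract_act u w s sF.1 sH.1).
pose Phi (G : {ffun {ffun 'I_d -> LX * LY} -> k^o}) : M :=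
  \sum_u \sum_w (G (zipw u w) : k) *: E u w.
have PhiD G G' : Phi (G + G') = Phi G + Phi G'.
  rewrite /Phi -big_split; apply: eq_bigr => u _; rewrite -big_split.
  by apply: eq_bigr => w _; rewrite ffunE scalerDl.
have PhiZ x G : Phi (x *: G) = x *: Phi G.
  rewrite /Phi scaler_sumr; apply: eq_bigr => u _; rewrite scaler_sumr.
  by apply: eq_bigr => w _; rewrite ffunE scalerA.
have -> : prodE E F H = Phi C.
  by apply: eq_bigr => u _; apply: eq_bigr => w _; rewrite CE.
apply: (sinv_expand char0 (@pair_signM d LX LY oX oY) (Q := fun G => T_alg X Y (Phi G)) _ _ iC).
- by rewrite /Phi big1 ?span0; [exact: span0|move=> u _; rewrite big1 // => w _; rewrite ffunE scale0r].
- by move=> G G' TG TG'; rewrite PhiD -[Phi G]scale1r; exact: span_closed.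
move=> z; have [u [w ->]] := zipwP z => Cz.
have guw := sinv_good char0 iC Cz.
have tuw j : component (u j) = component (w j).
  have [b] : exists b, F (zipw u b) * H (zipw w b) != 0.
    apply/existsP; apply: contraNT Cz; rewrite negb_exists => /forallP h.
    by rewrite CE /contract big1 // => b _; apply/eqP/negPn/h.
  rewrite mulf_eq0 negb_or => /andP[Fb Hb].
  by rewrite ((sF.2 _ _ Fb).2 j) ((sH.2 _ _ Hb).2 j).
have [x ex] := contract_divisible char0 u w sF.1 sH.1.
rewrite PhiZ CE ex mulrC -scalerA.
have := eta_pair_orb tuw guw; set y := (-1) ^+ _ => eE.
have -> : #|odd_pair_perms oX oY u w|%:R *: Phi (orb k (pair_sign oX oY) (zipw u w)) =
  y *: Defs.eta X Y [ffun j => pair_elt (u j) (w j)] [ffun j => row_index (u j)] [ffun j => row_index (w j)].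
  by rewrite eE scalerA -signr_addb addbb scale1r.
rewrite scalerA -[_ *: _]addr0; apply: span_closed; last exact: span0.
apply: span_gen; do 3!eexists; split; last by [].
split=> [j|i j ij]; rewrite !ffunE.
  apply/bigfcupP; exists (component (u j)); first by rewrite mem_index_enum.
  apply/imfset2P; exists (colour (u j)) => /=; first exact: colour_mem.
  by exists (colour (w j)) => //=; rewrite tuw colour_mem.
move=> [e1 e2 e3]; have [uij wij] := pair_elt_inj hd (tuw i) (tuw j) e1 e2 e3.
rewrite (gs_even_odd (pair_elt_homogeneous hd _ _) (pair_elt_neq0 hd (tuw i))).
rewrite (pair_elt_odd hd (tuw i)).
by have := (pair_goodP _ _ u w).1 guw i j ij uij wij; rewrite /oX => ->; rewrite addbb.
Qed.

Lemma codet_independent : lin_indep cod.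
Proof.
move=> m j c jinj sum0.
pose lam i := tag (j i).
pose u i := tab_word (val (tagged (j i)).1); pose w i := tab_word (val (tagged (j i)).2).
have gu i : good (bsign oX) (zipw (u i) (block_word (lam i))).
  exact: (good_tab_word leX_order X_homogeneous (valP (tagged (j i)).1)).
have gw i : good (bsign oY) (zipw (w i) (block_word (lam i))).
  exact: (good_tab_word leY_order Y_homogeneous (valP (tagged (j i)).2)).
have cu i : compat cX (u i) (block_word (lam i)) by exact: compat_tab_word.
have cw i : compat cY (w i) (block_word (lam i)) by exact: compat_tab_word.
apply: (standard_independent char0 (letter_rank_inj leX_order) (letter_rank_inj leY_order)
  (lam := lam) (u := u) (w := w)) => [i|i|i i' el eu ew|].
- split=> //; rewrite -(standard_tab_word leX_order X_homogeneous).
  exact: (valP (tagged (j i)).1).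
- split=> //; rewrite -(standard_tab_word leY_order Y_homogeneous).
  exact: (valP (tagged (j i)).2).
- apply: jinj; move: el eu ew; rewrite /lam /u /w.
  case: (j i) (j i') => [l [S T]] [l' [S' T']] /= ell'; move: S' T'; rewrite -ell' => S' T'.
  by move=> /tab_word_inj/val_inj -> /tab_word_inj/val_inj ->.
apply: (koszul_tensor_independent hd) => [u' w' nz l|].
  have [i] : exists i, c i * contract (orbX (u i) (block_word (lam i))) (orbY (w i) (block_word (lam i))) u' w' != 0.
    apply/existsP; apply: contraNT nz; rewrite negb_exists => /forallP h.
    by rewrite big1 // => i _; apply/eqP/negPn/h.
  rewrite mulf_eq0 negb_or => /andP[_ nzc].
  have [b] : exists b, orbX (u i) (block_word (lam i)) (zipw u' b) * orbY (w i) (block_word (lam i)) (zipw w' b) != 0.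
    apply/existsP; apply: contraNT nzc; rewrite negb_exists => /forallP h.
    by rewrite /contract big1 // => b _; apply/eqP/negPn/h.
  rewrite mulf_eq0 negb_or => /andP[Fb Hb].
  by rewrite (((supported_orb k (gu i) (cu i)).2 _ _ Fb).2 l) (((supported_orb k (gw i) (cw i)).2 _ _ Hb).2 l).
rewrite -[RHS]sum0; under [RHS]eq_bigr => i _.
  have -> : cod (j i) = _ := codet_prodE (tagged (j i)).1 (tagged (j i)).2.
  rewrite /prodE scaler_sumr; over.
rewrite [RHS]exchange_big /=; apply: eq_bigr => u' _.
under [RHS]eq_bigr do rewrite scaler_sumr.
rewrite [RHS]exchange_big /=; apply: eq_bigr => w' _; rewrite scaler_suml.
by apply: eq_bigr => i _; rewrite [RHS]scalerA.
Qed.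

End Basis.

Theorem theorem5p17 (k : idomainType) (char0 : [pchar k] =i pred0)
  (n d : nat) (n_gt0 : (0 < n)%N)
  (A : gsAlg k) (ell : nat) (le : rel 'I_ell.+1)
  (numbering : forall i j : 'I_ell.+1, le i j -> (i <= j)%N)
  (X Y : 'I_ell.+1 -> {fset A}) (e : 'I_ell.+1 -> A)
  (A_heredity : heredity_data (fun _ : A => True) le X Y e)
  (a : A -> Prop) (a_conforming : conforming a le X Y e)
  (leX : forall i, rel (letter n (X i))) (leX_order : forall i, letter_order (leX i))
  (leY : forall i, rel (letter n (Y i))) (leY_order : forall i, letter_order (leY i))
  (d_le_n : (d <= n)%N) :
  is_basis (@T_alg k A n d ell X Y) (@codet ell n d k A X Y leX leY).
Proof.
split; first exact: (codet_independent char0 A_heredity).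
move=> v; split; first exact: (T_alg_codets char0 d_le_n A_heredity leX_order leY_order).
apply: span_ind; [exact: span0|by move=> *; exact: span_closed|].
by move=> {}v [p ->]; exact: (codet_T_alg char0 A_heredity leX_order leY_order).
Qed.
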